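(* Let $(X_n)_{n\geq -1}$ be a second-order Galton--Watson process with immigration with generic offspring variables $\xi,\eta$ and generic immigration variable $\varepsilon$, such that $X_0$, $X_{-1}$, $\xi$ and $\eta$ are regularly varying with index $\alpha\in[1,\infty)$, $\mathbb{E}(X_0),\mathbb{E}(X_{-1}),m_\xi,m_\eta\in(0,\infty)$, $\mathbb{P}(\xi>x)=O(\mathbb{P}(X_0>x))$, $\mathbb{P}(\xi>x)=O(\mathbb{P}(X_{-1}>x))$, $\mathbb{P}(\eta>x)=O(\mathbb{P}(X_0>x))$, $\mathbb{P}(\eta>x)=O(\mathbb{P}(X_{-1}>x))$ and $\mathbb{P}(\xi>x)\asymp\mathbb{P}(\eta>x)$ as $x\to\infty$, and there exists $r\in(\alpha,\infty)$ such that $\mathbb{E}(\varepsilon^r)<\infty$. Then for all $n\in\mathbb{N}$, writing $u(x) := (\mathbb{P}(\xi>x), \mathbb{P}(\eta>x))^\top$, \begin{align*} \mathbb{P}(X_n > x) &\sim \begin{bmatrix}\mathbb{E}(X_0)\\ \mathbb{E}(X_{-1})\end{bmatrix}^\top \sum_{k=0}^{n-1} m_k^\alpha \bigl(M^{n-k-1}\bigr)^\top u(x) + \begin{bmatrix} m_\varepsilon \\ 0\end{bmatrix}^\top \sum_{i=1}^{n-1}\sum_{j=0}^{n-i-1} m_j^\alpha \bigl(M^{n-i-j-1}\bigr)^\top u(x) \\ &\quad + m_n^\alpha\,\mathbb{P}(X_0>x) + m_{n-1}^\alpha m_\eta^\alpha\,\mathbb{P}(X_{-1}>x) \end{align*}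 as $x\to\infty$, yielding that $X_n$ is regularly varying with index $\alpha$.
   Context: A second-order Galton--Watson process with immigration $(X_n)_{n\geq -1}$ is defined by $X_n = \sum_{i=1}^{X_{n-1}} \xi_{n,i} + \sum_{j=1}^{X_{n-2}} \eta_{n,j} + \varepsilon_n$ for $n\in\mathbb{N}=\{1,2,\dots\}$, where $X_{-1}, X_0$ (initial values) and all $\xi_{n,i},\eta_{n,j},\varepsilon_n$ ($n,i,j\in\mathbb{N}$) are independent non-negative integer-valued random variables, the $\xi_{n,i}$ are identically distributed with generic copy $\xi$, the $\eta_{n,j}$ identically distributed with generic copy $\eta$, and the $\varepsilon_n$ identically distributed with generic copy $\varepsilon$. Write $m_\xi=\mathbb{E}(\xi)$, $m_\eta=\mathbb{E}(\eta)$, $m_\varepsilon=\mathbb{E}(\varepsilon)$, and $M := \begin{bmatrix} m_\xi & m_\eta\\ 1 & 0\end{bmatrix}$. Set $m_0:=1$ and for $k\in\mathbb{N}$, $m_k := \frac{\lambda_+^{k+1}-\lambda_-^{k+1}}{\lambda_+-\lambda_-}$ with $\lambda_\pm := \frac{m_\xi \pm \sqrt{m_\xi^2+4m_\eta}}{2}$. A non-negative random variable $X$ is regularly varying with index $\alpha\geq 0$ if $\lim_{x\to\infty}\mathbb{P}(X>qx)/\mathbb{P}(X>x) = q^{-\alpha}$ for all $q>0$. For positive functions, $f\sim g$ means $f/g\to1$, $f=O(g)$ means $\limsup f/g<\infty$, and $f\asymp g$ means $f=O(g)$ and $g=O(f)$, as $x\to\infty$. *)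

(* Defs.v *)
From HB Require Import structures.
From mathcomp Require Import all_boot all_order all_algebra.
From mathcomp Require Import all_classical all_reals all_analysis.

Set Implicit Arguments.
Unset Strict Implicit.
Unset Printing Implicit Defensive.

Import Order.TTheory GRing.Theory Num.Theory.
Import numFieldNormedType.Exports.

Local Open Scope classical_set_scope.
Local Open Scope ring_scope.

(* Real-valued probability of an event (P takes values in [0,1], so [fine]
   loses nothing). *)
Definition pr d (T : measurableType d) (R : realType) (P : probability T R)
  (A : set T) : R := fine (P A).

Definition tail d (T : measurableType d) (R : realType) (P : probability T R)
  (Z : T -> nat) (x : R) : R := pr P [set w | x < (Z w)%:R].

Definition nat_measurable d (T : measurableType d) (Z : T -> nat) : Prop :=
  forall B : set nat, measurable (Z @^-1` B).

Definition mean d (T : measurableType d) (R : realType) (P : probability T R)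
  (Z : T -> nat) : \bar R := (\int[P]_w ((Z w)%:R)%:E)%E.

(* Regular variation with index alpha: P(Z > qx)/P(Z > x) -> q^(-alpha)
   for every q > 0 (the tail being eventually positive so the ratio makes
   sense). *)
Definition regularly_varying d (T : measurableType d) (R : realType)
  (P : probability T R) (Z : T -> nat) (alpha : R) : Prop :=
  (\forall x \near +oo, 0 < tail P Z x) /\
  forall q : R, 0 < q ->
    (fun x => tail P Z (q * x) / tail P Z x) @ +oo --> q `^ (- alpha).

Definition asymp_equiv (R : realType) (f g : R -> R) : Prop :=
  (fun x => f x / g x) @ +oo --> (1 : R).

(* f = O(g) as x -> oo (for positive functions: limsup f/g < oo) *)
Definition bigO_oo (R : realType) (f g : R -> R) : Prop :=
  exists C : R, 0 < C /\ \forall x \near +oo, f x <= C * g x.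

Definition asymp_same (R : realType) (f g : R -> R) : Prop :=
  bigO_oo f g /\ bigO_oo g f.

Definition gw_index : eqType := (bool + (nat * nat) + (nat * nat) + nat)%type.

Definition gw_family d (T : measurableType d) (Xm1 X0 : T -> nat)
  (xi eta : nat -> nat -> T -> nat) (eps : nat -> T -> nat)
  (k : gw_index) : T -> nat :=
  match k with
  | inl (inl (inl b)) => if b then X0 else Xm1
  | inl (inl (inr (n, i))) => xi n.+1 i.+1
  | inl (inr (n, j)) => eta n.+1 j.+1
  | inr n => eps n.+1
  end.

Definition mutually_independent d (T : measurableType d) (R : realType)
  (P : probability T R) (I : eqType) (Z : I -> T -> nat) : Prop :=
  forall (s : seq I) (B : I -> set nat), uniq s ->
    pr P (\bigcap_(i in [set` s]) (Z i @^-1` B i))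
    = \prod_(i <- s) pr P (Z i @^-1` B i).

Definition SOGWI d (T : measurableType d) (R : realType) (P : probability T R)
  (Xm1 X0 : T -> nat) (xi eta : nat -> nat -> T -> nat) (eps : nat -> T -> nat)
  : Prop :=
  [/\ forall k, nat_measurable (gw_family Xm1 X0 xi eta eps k),
      mutually_independent P (gw_family Xm1 X0 xi eta eps),
      (forall n i (B : set nat),
          pr P (xi n.+1 i.+1 @^-1` B) = pr P (xi 1%N 1%N @^-1` B)),
      (forall n j (B : set nat),
          pr P (eta n.+1 j.+1 @^-1` B) = pr P (eta 1%N 1%N @^-1` B)) &
      (forall n (B : set nat), pr P (eps n.+1 @^-1` B) = pr P (eps 1%N @^-1` B))].

(* The process, shifted by one: gw ... k = X_{k-1}, i.e.
   gw 0 = X_{-1}, gw 1 = X_0, and for n >= 1,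
   X_n = sum_{i=1}^{X_{n-1}} xi_{n,i} + sum_{j=1}^{X_{n-2}} eta_{n,j} + eps_n. *)
Fixpoint gw d (T : measurableType d) (Xm1 X0 : T -> nat)
  (xi eta : nat -> nat -> T -> nat) (eps : nat -> T -> nat) (k : nat)
  : T -> nat :=
  match k with
  | 0 => Xm1
  | 1 => X0
  | S ((S k') as k1) => fun w =>
      (\sum_(1 <= i < (gw Xm1 X0 xi eta eps k1 w).+1) xi k1 i w
       + \sum_(1 <= j < (gw Xm1 X0 xi eta eps k' w).+1) eta k1 j w
       + eps k1 w)%N
  end.

Definition lambda_plus (R : realType) (mxi meta : R) : R :=
  (mxi + Num.sqrt (mxi ^+ 2 + 4 * meta)) / 2.
Definition lambda_minus (R : realType) (mxi meta : R) : R :=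
  (mxi - Num.sqrt (mxi ^+ 2 + 4 * meta)) / 2.
Definition m_seq (R : realType) (mxi meta : R) (k : nat) : R :=
  if k is 0 then 1 else
  (lambda_plus mxi meta ^+ k.+1 - lambda_minus mxi meta ^+ k.+1)
  / (lambda_plus mxi meta - lambda_minus mxi meta).

Definition M_mat (R : realType) (mxi meta : R) : 'M[R]_2 :=
  \matrix_(i < 2, j < 2)
    (if (i : nat) == 0%N then (if (j : nat) == 0%N then mxi else meta)
     else (if (j : nat) == 0%N then 1 else 0)).

Definition vec2 (R : realType) (a b : R) : 'cV[R]_2 :=
  \col_(i < 2) (if (i : nat) == 0%N then a else b).

Definition gw_rhs d (T : measurableType d) (R : realType) (P : probability T R)
  (Xm1 X0 : T -> nat) (xi eta : nat -> nat -> T -> nat) (eps : nat -> T -> nat)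
  (alpha : R) (n : nat) (x : R) : R :=
  let mxi := fine (mean P (xi 1%N 1%N)) in
  let meta := fine (mean P (eta 1%N 1%N)) in
  let meps := fine (mean P (eps 1%N)) in
  let mX0 := fine (mean P X0) in
  let mXm1 := fine (mean P Xm1) in
  let M := M_mat mxi meta in
  let m := m_seq mxi meta in
  let u := vec2 (tail P (xi 1%N 1%N) x) (tail P (eta 1%N 1%N) x) in
  ((vec2 mX0 mXm1)^T *m
     (\sum_(k < n) (m k `^ alpha) *: (M ^+ (n - k - 1))^T) *m u) 0 0
  + ((vec2 meps 0)^T *m
     (\sum_(1 <= i < n) \sum_(j < n - i)
         (m j `^ alpha) *: (M ^+ (n - i - j - 1))^T) *m u) 0 0
  + (m n `^ alpha) * tail P X0 x
  + (m n.-1 `^ alpha) * (meta `^ alpha) * tail P Xm1 x.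

(* Main.v *)
(* The tails are propagated one generation at a time, for linear combinations
   a X_n + b X_(n-1).  Given (X_(n-1), X_(n-2)) = (m, k), the law of large
   numbers concentrates a X_n + b X_(n-1) around (a m_xi + b) m + a m_eta k,
   and it can exceed a larger level x only through one big offspring.  So

     P(a X_n + b X_(n-1) > x)
       = P((a m_xi + b) X_(n-1) + a m_eta X_(n-2) > x)
         + a^alpha (E X_(n-1) P(xi > x) + E X_(n-2) P(eta > x)) + o(F(x)),

   where F(x) = P(X_0 > x) + P(X_(-1) > x).  The second term is obtained by
   dominated convergence over (m, k): for fixed (m, k) it is the single big jump
   principle, and the domination by a multiple of (m + k + 1) F(x) is a large
   deviation bound (Chernoff's inequality for truncated summands, with a
   truncation level proportional to x).  Iterating down to (X_0, X_(-1)) from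
   (a, b) = (1, 0) turns a into m_k and b into m_(k-1) m_eta. *)

Require Import Defs.
From HB Require Import structures.
From mathcomp Require Import all_boot all_order all_algebra.
From mathcomp Require Import all_classical all_reals all_analysis.
From mathcomp Require Import measurable_realfun ring lra zify.
Import Order.TTheory GRing.Theory Num.Theory.
Import numFieldNormedType.Exports.
Set Implicit Arguments.
Unset Strict Implicit.
Unset Printing Implicit Defensive.
Local Open Scope classical_set_scope.
Local Open Scope ring_scope.

(** * Regular variation *)

Section regular_variation.
Context {R : realType}.
Implicit Types (f g F : R -> R) (q k x y : R).

(** The tails of [X0] and [Xm1] need not be comparable with each other, so every error is an
    additive o(F) for their sum [F]; ratios return only at the end, where both initial tails carry
    positive coefficients and the leading term is at least a multiple of [F]. Two consecutive
    generations are dependent, so the terms of a X_n + b X_(n-1) cannot be treated separately; one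
    step back, however, the combination is again a linear combination of the preceding pair plus
    fresh independent fluctuations. The delicate point is the domination: the number m of summands
    ranges up to a multiple of x, the bound has to be linear in m, and the variance may be infinite.
    A Chernoff parameter adapted to E min(z, y)^2 turns the exponential remainder into a power of m
    E min(z, y)^2 / y^2, in which one factor supplies the m and the others the decay in x. The
    matrices arise when the one-step contributions are summed: the mean vector of two consecutive
    generations evolves by [M] with an added immigration term. *)

Lemma near_dilation q (Q : R -> Prop) : 0 < q ->
  (\forall x \near +oo, Q x) -> \forall x \near +oo, Q (q * x).
Proof.
move=> q0 [M [_ H]]; exists (M / q); split; first exact: num_real.
by move=> x; rewrite ltr_pdivrMr// mulrC => /H.
Qed.

Lemma near_ge (M : R) : \forall x \near +oo, M <= x.
Proof. by apply: nbhs_pinfty_ge; exact: num_real. Qed.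

Lemma near_gt (M : R) : \forall x \near +oo, M < x.
Proof. by apply: nbhs_pinfty_gt; exact: num_real. Qed.

Lemma near_threshold (Q : R -> Prop) : (\forall x \near +oo, Q x) ->
  exists2 x0, 0 < x0 & forall x, x0 <= x -> Q x.
Proof.
move=> [M [_ H]]; exists (Num.max M 0 + 1).
  by rewrite ltr_wpDl// le_max lexx orbT.
move=> x hx; apply: H; apply: lt_le_trans hx.
by rewrite (@le_lt_trans _ _ (Num.max M 0)) ?le_max ?lexx// ltrDl.
Qed.

(** The limit of ratios in cross-multiplied form: estimates can then be added without dividing by a
    tail. *)
Definition rv (alpha : R) f := (\forall x \near +oo, 0 < f x) /\
  forall q, 0 < q -> forall k, 0 < k ->
    \forall x \near +oo, `|f (q * x) - q `^ (- alpha) * f x| <= k * f x.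

Lemma rvP (alpha : R) f : rv alpha f <-> (\forall x \near +oo, 0 < f x) /\
  forall q : R, 0 < q -> (fun x => f (q * x) / f x) @ +oo --> q `^ (- alpha).
Proof.
split=> -[f0 H]; split => // q q0.
  apply/cvgrPdist_le => e e0; near=> x.
  have fx : 0 < f x by near: x.
  have -> : q `^ (- alpha) - f (q * x) / f x =
    - (f (q * x) - q `^ (- alpha) * f x) / f x by field; exact: lt0r_neq0.
  rewrite normrM normrN normfV (gtr0_norm fx) ler_pdivrMr//.
  by near: x; exact: H.
move=> k k0; have /cvgrPdist_le/(_ _ k0) h := H q q0.
near=> x; have fx : 0 < f x by near: x.
have -> : f (q * x) - q `^ (- alpha) * f x =
   - (q `^ (- alpha) - f (q * x) / f x) * f x by field; exact: lt0r_neq0.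
rewrite normrM normrN (gtr0_norm fx) ler_wpM2r ?(ltW fx)//.
by near: x.
Unshelve. all: by end_near. Qed.

Lemma rv_dilation_le (alpha : R) f q : rv alpha f -> 0 < q ->
  \forall x \near +oo, f (q * x) <= (q `^ (- alpha) + 1) * f x.
Proof.
move=> [f0 H] q0; near=> x.
have : `|f (q * x) - q `^ (- alpha) * f x| <= 1 * f x by near: x; exact: H.
by rewrite ler_distl mul1r => /andP[_]; rewrite mulrDl mul1r.
Unshelve. all: by end_near. Qed.

Lemma rv_sum (alpha : R) f g : rv alpha f -> rv alpha g -> rv alpha (fun x => f x + g x).
Proof.
move=> [f0 H] [g0 K]; split.
  by near=> x; rewrite addr_gt0//; near: x.
move=> q q0 k k0; near=> x.
have h1 : `|f (q * x) - q `^ (- alpha) * f x| <= k * f x by near: x; exact: H.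
have h2 : `|g (q * x) - q `^ (- alpha) * g x| <= k * g x by near: x; exact: K.
rewrite mulrDr opprD addrACA mulrDr.
exact: le_trans (ler_normD _ _) (lerD h1 h2).
Unshelve. all: by end_near. Qed.

(** Induction over the dyadic blocks starting at [x0]. It is the common engine of the Potter bounds
    and of the bound on truncated moments. *)
Lemma dyadic_le (u v : R -> R) (C x0 : R) : 0 < x0 ->
  (forall x, x0 <= x -> x <= 2 * x0 -> u x <= C * v x) ->
  (forall x, x0 <= x -> u x <= C * v x -> u (2 * x) <= C * v (2 * x)) ->
  forall x, x0 <= x -> u x <= C * v x.
Proof.
move=> x00 H K.
have main n : forall x, x0 <= x -> x <= 2 ^+ n * (2 * x0) -> u x <= C * v x.
  elim: n => [|n IH] x xx0; first by rewrite expr0 mul1r => /H; exact.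
  move=> xn; have [x2|x2] := leP x (2 * x0); first exact: H.
  have hx : x0 <= x / 2 by rewrite ler_pdivlMr// mulrC ltW.
  have -> : x = 2 * (x / 2) by field.
  apply: K => //; apply: IH => //.
  by rewrite ler_pdivrMr// (le_trans xn)// exprS; lra.
move=> x xx0; apply: (main (Num.truncn (x / x0))) => //.
set n := Num.truncn _.
have h : x / x0 < n.+1%:R by rewrite truncnS_gt// ?divr_ge0 ?(ltW x00)// (le_trans _ xx0)// ltW.
rewrite ltr_pdivrMr// in h; apply: ltW; apply: (lt_le_trans h).
rewrite mulrA ler_pM2r// -natrX -natrM ler_nat -expnSr.
exact: ltn_trans (ltnSn n) (ltn_expl _ _).
Qed.

Lemma powR_pinv (alpha k : R) : alpha != 0 -> 0 < k -> (k `^ (- alpha^-1)) `^ (- alpha) = k.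
Proof.
move=> a0 k0; rewrite -powRrM mulrNN mulVf// powRr1//; exact: ltW.
Qed.

(** Supplies the dilation whose cost for an index-alpha tail is exactly the factor 1 + k. *)
Lemma powR_lt1_ratio (alpha k : R) : 0 < alpha -> 0 < k ->
  exists q, [/\ 0 < q, q < 1 & q `^ (- alpha) = 1 + k].
Proof.
move=> a0 k0; exists ((1 + k) `^ (- alpha^-1)).
have k1 : 0 < 1 + k by rewrite addr_gt0.
rewrite powR_gt0// powR_pinv ?gt_eqF//; split => //.
have E1 : 1 `^ alpha^-1 = 1 :> R by rewrite powR1.
rewrite powRN invf_lt1 ?powR_gt0// -[ltLHS]E1.
by rewrite gt0_ltr_powR ?invr_gt0// ?nnegrE ?ltW// ltrDl.
Qed.

Lemma powR_gt1_ratio (alpha k : R) : 0 < alpha -> 0 < k < 1 ->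
  exists q, 1 < q /\ q `^ (- alpha) = 1 - k.
Proof.
move=> a0 /andP[k0 k1]; exists ((1 - k) `^ (- alpha^-1)).
have k2 : 0 < 1 - k by rewrite subr_gt0.
rewrite powR_pinv ?gt_eqF//; split => //.
have E1 : 1 `^ alpha^-1 = 1 :> R by rewrite powR1.
rewrite powRN invf_gt1 ?powR_gt0// -[ltRHS]E1.
by rewrite gt0_ltr_powR ?invr_gt0// ?nnegrE ?ltW// ltrBlDr ltrDl.
Qed.

Lemma powR2_lt (a b : R) : a < b -> 2 `^ a < 2 `^ b.
Proof. by move=> ab; rewrite /powR pnatr_eq0/= ltr_expR ltr_pM2r// ln_gt0// ltr1n. Qed.

(** Doubling the argument asymptotically costs 2^(-alpha), which exceeds 2^(-beta); the gap [k]
    absorbs the error. *)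
Lemma rv_double_ge (alpha beta : R) f : alpha < beta -> rv alpha f ->
  \forall x \near +oo, 0 < f x /\ 2 `^ (- beta) * f x <= f (2 * x).
Proof.
move=> ab [f0 H].
pose k := 2 `^ (- alpha) - 2 `^ (- beta) : R.
have k0 : 0 < k by rewrite subr_gt0 powR2_lt// ltrN2.
near=> x; split; first by near: x.
have : `|f (2 * x) - 2 `^ (- alpha) * f x| <= k * f x by near: x; exact: H.
rewrite ler_distl => /andP[+ _]; apply: le_trans.
by rewrite /k mulrBl; lra.
Unshelve. all: by end_near. Qed.

(** Potter's bound: a power that loses more than f at each doubling ends up below it. *)
Lemma potter_lower (alpha beta : R) f : 0 < beta -> alpha < beta -> rv alpha f ->
  {homo f : x y / x <= y >-> y <= x} ->
  exists2 C, 0 < C & \forall x \near +oo, x `^ (- beta) <= C * f x.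
Proof.
move=> b0 ab rvf fmono.
have [x0 x00 hx0] := near_threshold (rv_double_ge ab rvf).
(* On the first block the largest value of the power is compared with the smallest value of f, by
   monotonicity. *)
pose C := x0 `^ (- beta) / f (2 * x0).
have f20 : 0 < f (2 * x0) by apply: (hx0 _ _).1; rewrite ler_peMl// ?ler1n// ltW.
have C0 : 0 < C by rewrite divr_gt0// powR_gt0.
exists C => //; apply: filterS (near_ge x0).
apply: (@dyadic_le (fun x => x `^ (- beta)) f C x0) => // x xx0.
  move=> x2; apply: (@le_trans _ _ (x0 `^ (- beta))).
    have xp : 0 < x by exact: lt_le_trans xx0.
    rewrite !powRN lef_pV2 ?posrE ?powR_gt0//.
    by rewrite ge0_ler_powR// ?nnegrE ?ltW.
  rewrite /C mulrAC -mulrA ler_peMr ?powR_ge0// ler_pdivlMr// mul1r.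
  exact: fmono.
move=> IH; have [fx f2] := hx0 _ xx0.
rewrite powRM// ?(le_trans (ltW x00))//.
apply: (@le_trans _ _ (2 `^ (- beta) * (C * f x))); first by rewrite ler_wpM2l// powR_ge0.
by rewrite mulrCA ler_wpM2l// ltW.
Unshelve. all: by end_near. Qed.

Lemma potter_upper (alpha beta : R) f : 0 < beta -> beta < alpha -> rv alpha f ->
  {homo f : x y / x <= y >-> y <= x} ->
  exists2 C, 0 < C & \forall x \near +oo, f x <= C * x `^ (- beta).
Proof.
move=> b0 ab [f0 H] fmono.
pose k := 2 `^ (- beta) - 2 `^ (- alpha) : R.
have k0 : 0 < k.
  by rewrite subr_gt0 powR2_lt// ltrN2.
have [x0 x00 hx0] : exists2 x0, 0 < x0 & forall x, x0 <= x ->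
    0 < f x /\ f (2 * x) <= 2 `^ (- beta) * f x.
  apply: near_threshold; near=> x; split; first by near: x.
  have : `|f (2 * x) - 2 `^ (- alpha) * f x| <= k * f x by near: x; exact: H.
  rewrite ler_distl => /andP[_ /le_trans]; apply.
  by rewrite /k mulrBl; lra.
pose C := f x0 / (2 * x0) `^ (- beta).
have x20 : 0 < 2 * x0 by rewrite mulr_gt0.
have C0 : 0 < C by rewrite divr_gt0// ?powR_gt0// (hx0 _ _).1.
exists C => //; apply: filterS (near_ge x0).
apply: (@dyadic_le f (fun x => x `^ (- beta)) C x0) => // x xx0.
  move=> x2; have xp : 0 < x by exact: lt_le_trans xx0.
  apply: (@le_trans _ _ (f x0)); first exact: fmono.
  rewrite /C mulrAC -mulrA ler_peMr ?(ltW (hx0 _ _).1)// ler_pdivlMr ?powR_gt0// mul1r.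
  rewrite !powRN lef_pV2 ?posrE ?powR_gt0//.
  by rewrite ge0_ler_powR// ?nnegrE ?ltW.
move=> IH; have [fx f2] := hx0 _ xx0.
rewrite powRM// ?(le_trans (ltW x00))//; apply: (le_trans f2).
by rewrite mulrCA ler_wpM2l// powR_ge0.
Unshelve. all: by end_near. Qed.

End regular_variation.

(** * Errors negligible with respect to a reference tail *)

Section negligible.
Context {R : realType} (alpha : R) (F : R -> R).
Hypotheses (alpha1 : 1 <= alpha) (rvF : rv alpha F)
  (Fmono : {homo F : x y / x <= y >-> y <= x}) (F0 : F x @[x --> +oo] --> 0).
Implicit Types (f g h : R -> R) (q k x y : R).

Definition negl f := forall k, 0 < k -> \forall x \near +oo, `|f x| <= k * F x.

(* [h] varies regularly up to an error negligible with respect to [F], and may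
   itself be negligible. *)
Definition scaling h :=
  (exists2 C, 0 < C & \forall x \near +oo, `|h x| <= C * F x) /\
  forall q, 0 < q -> negl (fun x => h (q * x) - q `^ (- alpha) * h x).

Lemma negl0 : negl (fun=> 0).
Proof.
move=> k k0; case: rvF => F_gt0 _; near=> x.
by rewrite normr0 mulr_ge0// ltW//; near: x.
Unshelve. all: by end_near. Qed.

Lemma neglD f g : negl f -> negl g -> negl (fun x => f x + g x).
Proof.
move=> nf ng k k0; have k2 : 0 < k / 2 by rewrite divr_gt0.
near=> x; apply: (le_trans (ler_normD _ _)).
have h1 : `|f x| <= k / 2 * F x by near: x; exact: nf.
have h2 : `|g x| <= k / 2 * F x by near: x; exact: ng.
by have -> : k * F x = k / 2 * F x + k / 2 * F x; [field|exact: lerD].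
Unshelve. all: by end_near. Qed.

Lemma neglZ (c : R) f : negl f -> negl (fun x => c * f x).
Proof.
move=> nf k k0; have h : 0 < `|c| + 1 by rewrite ltr_wpDl.
near=> x; rewrite normrM.
have h1 : `|f x| <= k / (`|c| + 1) * F x by near: x; apply: nf; rewrite divr_gt0.
have h0 : 0 <= k / (`|c| + 1) * F x by exact: le_trans h1.
apply: (@le_trans _ _ ((`|c| + 1) * (k / (`|c| + 1) * F x))).
  by apply: ler_pM => //; rewrite lerDl.
by rewrite le_eqVlt; apply/orP; left; apply/eqP; field; exact: lt0r_neq0.
Unshelve. all: by end_near. Qed.

Lemma negl_eq f g : negl f -> (\forall x \near +oo, f x = g x) -> negl g.
Proof.
by move=> nf fg k k0; near=> x; rewrite -(near fg x)//; near: x; exact: nf.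
Unshelve. all: by end_near. Qed.

Lemma negl_dilation f q : 0 < q -> negl f -> negl (fun x => f (q * x)).
Proof.
move=> q0 nf k k0; have F2 := rv_dilation_le rvF q0.
pose c := q `^ (- alpha) + 1; have c0 : 0 < c by rewrite ltr_wpDl// powR_ge0.
have kc : 0 < k / c by rewrite divr_gt0.
near=> x; apply: (@le_trans _ _ (k / c * F (q * x))).
  by near: x; apply: (near_dilation q0) (nf _ kc).
apply: (@le_trans _ _ (k / c * (c * F x))).
  by rewrite ler_wpM2l// ?(ltW kc)//; near: x.
by rewrite le_eqVlt; apply/orP; left; apply/eqP; field; exact: lt0r_neq0.
Unshelve. all: by end_near. Qed.

(* A product of two quantities of order [F] is negligible since [F] vanishes at
   infinity. *)
Lemma negl_mul f g (C D : R) : (\forall x \near +oo, `|f x| <= C * F x) ->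
  (\forall x \near +oo, `|g x| <= D * F x) -> negl (fun x => f x * g x).
Proof.
move=> fC gD k k0; case: rvF => F_gt0 _.
have e0 : 0 < k / (`|C| * `|D| + 1) by rewrite divr_gt0// ltr_wpDl// mulr_ge0.
have /cvgrPdist_le/(_ _ e0) F_small := F0.
near=> x; have Fx : 0 < F x by near: x.
have hF : F x <= k / (`|C| * `|D| + 1).
  have : `|0 - F x| <= k / (`|C| * `|D| + 1) by near: x.
  by rewrite sub0r normrN gtr0_norm.
have h1 : `|f x| <= `|C| * F x.
  apply: le_trans (_ : C * F x <= _); first by near: x.
  by rewrite ler_wpM2r ?(ltW Fx)// ler_norm.
have h2 : `|g x| <= `|D| * F x.
  apply: le_trans (_ : D * F x <= _); first by near: x.
  by rewrite ler_wpM2r ?(ltW Fx)// ler_norm.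
rewrite normrM; apply: (le_trans (ler_pM _ _ h1 h2)) => //.
rewrite ler_pdivlMr in hF; last by rewrite ltr_wpDl// mulr_ge0.
rewrite mulrACA mulrA ler_wpM2r ?(ltW Fx)//; apply: le_trans hF.
by rewrite mulrC ler_wpM2l ?(ltW Fx)// lerDl.
Unshelve. all: by end_near. Qed.

Lemma scalingZ (c : R) h : scaling h -> scaling (fun x => c * h x).
Proof.
move=> [[C C0 hC] H]; split.
  exists ((`|c| + 1) * C); first by rewrite mulr_gt0// ltr_wpDl.
  near=> x; rewrite normrM -mulrA; apply: ler_pM => //; first by rewrite lerDl.
  by near: x.
move=> q q0; apply: (negl_eq (neglZ c (H q q0))).
by near=> x; rewrite mulrBr; congr (_ - _); rewrite mulrCA.
Unshelve. all: by end_near. Qed.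

Lemma scalingD f h : scaling f -> scaling h -> scaling (fun x => f x + h x).
Proof.
move=> [[C C0 fC] H] [[D D0 hD] K]; split.
  exists (C + D); first by rewrite addr_gt0.
  near=> x; rewrite mulrDl; apply: (le_trans (ler_normD _ _)).
  by apply: lerD; near: x.
move=> q q0; apply: (negl_eq (neglD (H q q0) (K q q0))).
by near=> x; rewrite mulrDr opprD addrACA.
Unshelve. all: by end_near. Qed.

Lemma scaling_rv f (C : R) : rv alpha f -> 0 < C ->
  (\forall x \near +oo, f x <= C * F x) -> scaling f.
Proof.
move=> [f0 H] C0 fC; split.
  by exists C => //; near=> x; rewrite gtr0_norm; near: x.
move=> q q0 k k0; have kC : 0 < k / C by rewrite divr_gt0.
near=> x; apply: (@le_trans _ _ (k / C * f x)); first by near: x; exact: H.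
have -> : k * F x = k / C * (C * F x) by field; exact: lt0r_neq0.
by rewrite ler_wpM2l ?(ltW kC)//; near: x.
Unshelve. all: by end_near. Qed.

Lemma scaling0 : scaling (fun=> 0).
Proof.
have scF : scaling F.
  by apply: (scaling_rv rvF ltr01); near=> x; rewrite mul1r.
have := scalingZ 0 scF; by under eq_fun do rewrite mul0r.
Unshelve. all: by end_near. Qed.

Lemma negl_bounded f h : negl (fun x => f x - h x) -> scaling h ->
  exists2 C, 0 < C & \forall x \near +oo, `|f x| <= C * F x.
Proof.
move=> n [[C C0 hC] _]; exists (1 + C); first by rewrite addr_gt0.
near=> x; rewrite -(subrK (h x) (f x)) mulrDl.
apply: (le_trans (ler_normD _ _)); apply: lerD; last by near: x.
by near: x; exact: n.
Unshelve. all: by end_near. Qed.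

Lemma negl_dilation_equiv f h q : 0 < q -> negl (fun x => f x - h x) -> scaling h ->
  negl (fun x => f (q * x) - q `^ (- alpha) * h x).
Proof.
move=> q0 n [_ H]; apply: (negl_eq (neglD (negl_dilation q0 n) (H q q0))).
by near=> x; rewrite addrA subrK.
Unshelve. all: by end_near. Qed.

(** Events are later compared at the levels x and q x; this bound and the next make the change of
    level cost an arbitrarily small multiple of [F]. *)
Lemma dilation_upper f h k : negl (fun x => f x - h x) -> scaling h -> 0 < k ->
  exists q, [/\ 0 < q, q < 1 & \forall x \near +oo, f (q * x) <= h x + k * F x].
Proof.
move=> n sh k0; have [[C C0 hC] _] := sh.
have k2 : 0 < k / 2 by rewrite divr_gt0.
have [q [q0 q1 qE]] := @powR_lt1_ratio R alpha (k / 2 / C) (lt_le_trans ltr01 alpha1) (divr_gt0 k2 C0).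
exists q; split => //.
have H := negl_dilation_equiv q0 n sh; near=> x.
have : `|f (q * x) - q `^ (- alpha) * h x| <= k / 2 * F x by near: x; exact: H.
rewrite ler_distl => /andP[_] /le_trans; apply.
have hx : `|h x| <= C * F x by near: x.
rewrite qE mulrDl mul1r -addrA lerD2l.
have -> : k * F x = k / 2 / C * (C * F x) + k / 2 * F x by field; exact: lt0r_neq0.
rewrite lerD2r ler_wpM2l//; last exact: le_trans (ler_norm _) hx.
by rewrite !divr_ge0// ltW.
Unshelve. all: by end_near. Qed.

Lemma dilation_lower f h k : negl (fun x => f x - h x) -> scaling h -> 0 < k ->
  exists q, 1 < q /\ \forall x \near +oo, h x - k * F x <= f (q * x).
Proof.
move=> n sh k0; have [[C C0 hC] _] := sh.
have k2 : 0 < k / 2 by rewrite divr_gt0.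
(* The cap 1/2 keeps 1 - e positive, so that it is a value of q^(-alpha) with q > 1. *)
pose e := Num.min (k / 2 / C) 2^-1.
have e0 : 0 < e < 1.
  rewrite lt_min divr_gt0//= invr_gt0 ltr0n/= gt_min; apply/orP; right.
  by rewrite invf_lt1// ltr1n.
have [q [q1 qE]] := @powR_gt1_ratio R alpha e (lt_le_trans ltr01 alpha1) e0.
have q0 : 0 < q by exact: lt_trans q1.
exists q; split => //.
have H := negl_dilation_equiv q0 n sh; near=> x.
have : `|f (q * x) - q `^ (- alpha) * h x| <= k / 2 * F x by near: x; exact: H.
rewrite ler_distl => /andP[+ _]; apply: le_trans.
have hx : `|h x| <= C * F x by near: x.
rewrite qE mulrBl mul1r -addrA lerD2l.
have -> : k * F x = k / 2 / C * (C * F x) + k / 2 * F x by field; exact: lt0r_neq0.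
rewrite opprD lerD2r lerN2; have /andP[e00 _] := e0.
apply: (@le_trans _ _ (e * (C * F x))).
  by rewrite ler_wpM2l ?(ltW e00)//; exact: le_trans (ler_norm _) hx.
by rewrite ler_wpM2r ?(le_trans _ hx)// ge_min lexx.
Unshelve. all: by end_near. Qed.

End negligible.

(** * Independence and discrete random variables *)

Section discrete_measurability.
Context {T : Type} {S : set (set T)} (sS : sigma_algebra setT S).

(** All variables have countably many values, so every set of values may be tested. [S] stays
    abstract in order to cover both the ambient sigma-algebra and those generated by a group of
    variables. *)
Definition meas_in {I : Type} (V : T -> I) := forall B : set I, S (V @^-1` B).

Lemma sigma_setC (A : set T) : S A -> S (~` A).
Proof. by case: sS => _ h _ /h; rewrite setTD. Qed.

Lemma sigma_setT : S setT.
Proof. by case: sS => h0 _ _; rewrite -setC0; exact: sigma_setC. Qed.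

Lemma sigma_bigcup (A : (set T)^nat) : (forall n, S (A n)) -> S (\bigcup_n A n).
Proof. by case: sS => _ _; apply. Qed.

Lemma sigma_setI (A B : set T) : S A -> S B -> S (A `&` B).
Proof.
move=> SA SB; rewrite -(setCK (A `&` B)) setCI; apply: sigma_setC.
rewrite -bigcup2E; apply: sigma_bigcup => n; rewrite /bigcup2.
case: ifP => _; first exact: sigma_setC.
by case: ifP => _; [exact: sigma_setC|case: sS].
Qed.

Lemma meas_in_cst {I : Type} (i : I) : meas_in (fun=> i).
Proof.
move=> B; case: (pselect (B i)) => Bi.
  rewrite (_ : _ @^-1` _ = setT); first exact: sigma_setT.
  by apply/seteqP; split.
rewrite (_ : _ @^-1` _ = set0); first by case: sS.
by apply/seteqP; split.
Qed.

Lemma meas_in_comp {I J : Type} (f : I -> J) (V : T -> I) :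
  meas_in V -> meas_in (f \o V).
Proof. by move=> mV B; exact: (mV (f @^-1` B)). Qed.

(** Split over the countably many values of [V]. This handles sums whose number of terms is
    random. *)
Lemma meas_in_dep {I : countType} {J : Type} (V : T -> I) (W : I -> T -> J) :
  meas_in V -> (forall i, meas_in (W i)) -> meas_in (fun w => W (V w) w).
Proof.
move=> mV mW B.
pose F n := if pickle_inv n is Some i then (V @^-1` [set i]) `&` (W i @^-1` B)
            else set0.
rewrite (_ : _ @^-1` _ = \bigcup_n F n).
  apply: sigma_bigcup => n; rewrite /F; case: pickle_inv => [i|]; last by case: sS.
  by apply: sigma_setI; [exact: mV|exact: mW].
apply/seteqP; split=> w /=.
  by move=> BW; exists (pickle (V w)) => //; rewrite /F pickleK_inv.
by case=> n _; rewrite /F; case: pickle_inv => // i [/= ->].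
Qed.

Lemma meas_in_pair {I J : countType} (V : T -> I) (W : T -> J) :
  meas_in V -> meas_in W -> meas_in (fun w => (V w, W w)).
Proof.
move=> mV mW; apply: (@meas_in_dep _ _ V (fun i w => (i, W w))) => // i.
exact: (@meas_in_comp _ _ (pair i) W).
Qed.

Lemma meas_in_add (V W : T -> nat) :
  meas_in V -> meas_in W -> meas_in (fun w => V w + W w)%N.
Proof.
move=> mV mW.
have := meas_in_comp (fun p : nat * nat => p.1 + p.2)%N (meas_in_pair mV mW).
by [].
Qed.

Lemma meas_in_sum (V : nat -> T -> nat) n : (forall i, (i < n)%N -> meas_in (V i)) ->
  meas_in (fun w => \sum_(0 <= i < n) V i w)%N.
Proof.
elim: n => [_|n IH mV].
  by under eq_fun do rewrite big_nil; exact: meas_in_cst.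
under eq_fun do rewrite big_nat_recr//=.
apply: meas_in_add; last exact: mV.
by apply: IH => i /ltnW; exact: mV.
Qed.

End discrete_measurability.
Arguments meas_in {T} S {I} V.

Lemma pr_fin d (T : measurableType d) (R : realType) (P : probability T R)
  (A : set T) : measurable A -> P A = (pr P A)%:E.
Proof. by move=> mA; rewrite fineK// fin_num_measure. Qed.

Lemma pr_ge0 d (T : measurableType d) (R : realType) (P : probability T R)
  (A : set T) : 0 <= pr P A.
Proof. exact: fine_ge0. Qed.

Lemma pr_le d (T : measurableType d) (R : realType) (P : probability T R)
  (A B : set T) : measurable A -> measurable B -> A `<=` B -> pr P A <= pr P B.
Proof.
move=> mA mB AB; rewrite -lee_fin -!pr_fin//.
by apply: le_measure => //; rewrite inE.
Qed.

Lemma pr_le1 d (T : measurableType d) (R : realType) (P : probability T R)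
  (A : set T) : measurable A -> pr P A <= 1.
Proof. by move=> mA; rewrite -lee_fin -pr_fin// probability_le1. Qed.

Lemma pr_leU d (T : measurableType d) (R : realType) (P : probability T R)
  (A B : set T) : measurable A -> measurable B -> pr P (A `|` B) <= pr P A + pr P B.
Proof.
move=> mA mB; rewrite -lee_fin EFinD -!pr_fin//; last exact: measurableU.
exact: measureU2.
Qed.

Definition indep_sigma d (T : measurableType d) (R : realType)
  (P : probability T R) (S1 S2 : set (set T)) :=
  forall A B, S1 A -> S2 B -> P (A `&` B) = (P A * P B)%E.

(** * Independence of disjoint groups of variables *)

Section grouping.
Context d (T : measurableType d) (R : realType) (P : probability T R).
Context (I : eqType) (Z : I -> T -> nat).
Hypothesis mZ : forall i, nat_measurable (Z i).
Hypothesis iZ : mutually_independent P Z.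

(** These are the events for which [mutually_independent] gives a product formula; being stable
    under intersection, they form a pi-system. *)
Definition cylinder (J : set I) : set (set T) :=
  [set A | exists s B, [/\ uniq s, forall i, i \in s -> J i &
    A = \bigcap_(i in [set` s]) (Z i @^-1` B i)]].

Definition sigma_of (J : set I) := <<s cylinder J >>.

Lemma sigma_of_sigma (J : set I) : sigma_algebra setT (sigma_of J).
Proof. exact: smallest_sigma_algebra. Qed.

Lemma measurable_cylinder (J : set I) : cylinder J `<=` measurable.
Proof.
move=> _ [s [B [_ _ ->]]]; apply: fin_bigcap_measurable => //.
by move=> i _; exact: mZ.
Qed.

Lemma measurable_sigma_of (J : set I) : sigma_of J `<=` measurable.
Proof.
apply: smallest_sub; [exact: sigma_algebra_measurable|exact: measurable_cylinder].
Qed.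

Lemma sigma_of_mono (J K : set I) : J `<=` K -> sigma_of J `<=` sigma_of K.
Proof.
move=> JK; apply: smallest_sub; first exact: sigma_of_sigma.
apply: subset_trans (@sub_gen_smallest _ _ _).
by move=> _ [s [B [us sJ ->]]]; exists s, B; split => // i /sJ /JK.
Qed.

Lemma meas_in_sigma_of (J : set I) i : J i -> meas_in (sigma_of J) (Z i).
Proof.
move=> Ji B; apply: sub_gen_smallest; exists [:: i], (fun=> B); split => //.
  by move=> j; rewrite inE => /eqP ->.
apply/seteqP; split => w /=; first by move=> Bw j /=; rewrite inE => /eqP ->.
by apply; rewrite /= inE.
Qed.

Lemma cylinderI (J : set I) : setI_closed (cylinder J).
Proof.
move=> _ _ [s [B [us sJ ->]]] [t [C [ut tJ ->]]].
exists (undup (s ++ t)), (fun i => (if i \in s then B i else setT) `&`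
  (if i \in t then C i else setT)); split; first exact: undup_uniq.
  by move=> i; rewrite mem_undup mem_cat => /orP[/sJ|/tJ].
apply/seteqP; split => w /=.
  move=> [Bw Cw] i /=; rewrite mem_undup mem_cat => _; split; case: ifPn => // h.
    exact: Bw.
  exact: Cw.
move=> h; split => i /= hi.
  by have := h i; rewrite /= mem_undup mem_cat hi => /(_ isT)[].
by have := h i; rewrite /= mem_undup mem_cat hi orbT => /(_ isT)[].
Qed.

Lemma cylinderT (J : set I) : cylinder J setT.
Proof.
exists [::], (fun=> setT); split => //.
by apply/seteqP; split.
Qed.

Lemma indep_cylinder (J K : set I) A C : J `&` K = set0 ->
  cylinder J A -> cylinder K C -> P (A `&` C) = (P A * P C)%E.
Proof.
move=> JK cA cC.
have mA := measurable_cylinder cA; have mC := measurable_cylinder cC.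
rewrite !pr_fin//; last exact: measurableI.
rewrite -EFinM; congr EFin.
move: cA cC => [s [B [us sJ EA]]] [t [D [ut tK EC]]].
have st i : i \in s -> i \notin t.
  move=> /sJ Ji; apply/negP => /tK Ki.
  by have : (J `&` K) i by []; rewrite JK.
pose BD i := if i \in s then B i else D i.
have -> : A `&` C = \bigcap_(i in [set` (s ++ t)]) (Z i @^-1` BD i).
  rewrite EA EC; apply/seteqP; split => w.
    move=> [Bw Dw] i; rewrite /= mem_cat /BD; case: ifP => // si; first by move=> _; exact: Bw.
    by move=> /= it; exact: Dw.
  move=> h; split => i /= hi.
    by have := h i; rewrite /= mem_cat hi /BD hi => /(_ isT).
  have := h i; rewrite /= mem_cat hi orbT /BD => /(_ isT).
  by case: ifPn => // /st; rewrite hi.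
rewrite iZ; last first.
  rewrite cat_uniq us ut andbT/=; apply/hasPn => i it; apply/negP => /st.
  by rewrite it.
rewrite big_cat /= EA EC !iZ//; congr (_ * _); apply: eq_big_seq => i hi.
  by rewrite /BD hi.
by rewrite /BD; case: ifP => // /st; rewrite hi.
Qed.

(** Dynkin's uniqueness argument, used twice: it extends the product formula from cylinders to the
    generated sigma-algebra in one argument, then in the other. *)
Lemma indep_sigma_of (J K : set I) : J `&` K = set0 ->
  indep_sigma P (sigma_of J) (sigma_of K).
Proof.
move=> JK A C sA sC.
have mA := measurable_sigma_of sA; have mC := measurable_sigma_of sC.
have step (L : set I) (E : set T) (mE : measurable E) :
    (forall D, cylinder L D -> P (D `&` E) = (P D * P E)%E) ->
    forall D, sigma_of L D -> P (D `&` E) = (P D * P E)%E.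
  move=> H D sD.
  (* The finite measures A -> P(A and E) and A -> P(E) P(A) agree on the pi-system of cylinders. *)
  have : mrestr P mE D = mscale (NngNum (pr_ge0 P E)) P D.
    apply: (@g_sigma_algebra_measure_unique _ _ _ (cylinder L) _ (fun=> setT)) => //.
    - exact: measurable_cylinder.
    - by move=> _; exact: cylinderT.
    - by rewrite bigcup_const.
    - exact: cylinderI.
    - move=> D' cD'; by rewrite /= /mrestr /mscale/= H// (pr_fin P mE) muleC.
    - by move=> _ /=; rewrite /mrestr setTI (le_lt_trans (probability_le1 _ _))// ltry.
  by rewrite /mrestr /mscale/= => ->; rewrite (pr_fin P mE) muleC.
apply: (step J C mC) => // D cD.
rewrite setIC muleC; apply: (step K D (measurable_cylinder cD)) => // D' cD'.
by rewrite setIC muleC; exact: (indep_cylinder JK).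
Qed.

End grouping.

(** * Expectations and conditioning for discrete variables *)

Section discrete_integrals.
Context d (T : measurableType d) (R : realType) (P : probability T R).
Local Open Scope ereal_scope.

Lemma measurable_discrete {I : Type} (V : T -> I) d' (U : sigmaRingType d')
  (g : I -> U) (D : set T) :
  measurable D -> meas_in measurable V -> measurable_fun D (fun w => g (V w)).
Proof.
move=> mD mV _ B _; apply: measurableI => //.
exact: (mV (g @^-1` B)).
Qed.

Lemma discrete_partition (V : T -> nat) (D : set T) :
  D = \bigcup_k (D `&` V @^-1` [set k]).
Proof. by apply/seteqP; split => w /=; [move=> Dw; exists (V w)|case=> k _ []]. Qed.

Lemma trivIset_partition (V : T -> nat) (D : set T) :
  trivIset setT (fun k => D `&` V @^-1` [set k]).
Proof. by move=> i j _ _ [w [[_ /= <-] [_ <-]]]. Qed.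

Lemma integral_discrete (V : T -> nat) (g : nat -> \bar R) (D : set T) :
  measurable D -> meas_in measurable V -> (forall k, 0 <= g k) ->
  \int[P]_(w in D) g (V w) = \sum_(k <oo) g k * P (D `&` V @^-1` [set k]).
Proof.
move=> mD mV g0; rewrite {1}(discrete_partition V D).
have mk k : measurable (D `&` V @^-1` [set k]) by exact: measurableI.
rewrite ge0_integral_bigcup//.
- apply: eq_eseriesr => k _.
  rewrite -integral_cst//; apply: eq_integral => w; rewrite inE => -[_ /= ->] //.
- exact: measurable_discrete (bigcup_measurable _) mV.
- exact: trivIset_partition.
Qed.

Lemma integral_indep (V : T -> nat) (g : nat -> \bar R) (D : set T) :
  measurable D -> meas_in measurable V -> (forall k, 0 <= g k) ->
  (forall k, P (D `&` V @^-1` [set k]) = P D * P (V @^-1` [set k])) ->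
  \int[P]_(w in D) g (V w) = P D * \int[P]_w g (V w).
Proof.
move=> mD mV g0 H; rewrite !integral_discrete//.
rewrite pr_fin// -nneseriesZl; last by move=> k _; exact: mule_ge0.
by apply: eq_eseriesr => k _; rewrite H setTI (pr_fin P mD) muleCA.
Qed.

Lemma integral_indep2 (V W : T -> nat) (f g : nat -> \bar R) :
  meas_in measurable V -> meas_in measurable W ->
  (forall k, 0 <= f k) -> (forall k, 0 <= g k) ->
  (forall j k, P (V @^-1` [set j] `&` W @^-1` [set k]) =
     P (V @^-1` [set j]) * P (W @^-1` [set k])) ->
  \int[P]_w (f (V w) * g (W w)) = \int[P]_w f (V w) * \int[P]_w g (W w).
Proof.
move=> mV mW f0 g0 H.
rewrite {1}(discrete_partition V setT).
have mk k : measurable ([set: T] `&` V @^-1` [set k]) by exact: measurableI.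
rewrite ge0_integral_bigcup//; first last.
- exact: trivIset_partition.
- by move=> w _; exact: mule_ge0.
- have mU : measurable (\bigcup_k ([set: T] `&` V @^-1` [set k])).
    exact: bigcup_measurable.
  by apply: emeasurable_funM; exact: measurable_discrete.
rewrite integral_discrete// muleC.
have I0 : 0 <= \int[P]_w g (W w) by apply: integral_ge0.
transitivity (\sum_(k <oo) (\int[P]_w g (W w) * (f k * P (V @^-1` [set k])))).
  apply: eq_eseriesr => k _; rewrite setTI.
  transitivity (\int[P]_(w in V @^-1` [set k]) (f k * g (W w))).
    by apply: eq_integral => w; rewrite inE /= => ->.
  rewrite ge0_integralZl//; last exact: measurable_discrete.
  by rewrite (integral_indep (D := V @^-1` [set k]))// muleA muleC.
under [in RHS]eq_eseriesr do rewrite setTI.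
have h k : 0 <= f k * P (V @^-1` [set k]) by exact: mule_ge0.
case: (\int[P]_w g (W w)) I0 => [r||] // r0; first by rewrite nneseriesZl.
pose u k := f k * P (V @^-1` [set k]).
change (\sum_(k <oo) (+oo * u k) = +oo * \sum_(k <oo) u k).
have [u0|/existsNP[k uk]] := pselect (forall k, u k = 0).
  rewrite [X in +oo * X]eseries0 ?mule0; last by move=> *; exact: u0.
  by rewrite eseries0// => k _ _; rewrite -/(u k) u0 mule0.
have uk0 : 0 < u k by rewrite lt_neqAle h andbT eq_sym; apply/eqP.
have le1 (v : nat -> \bar R) : (forall k, 0 <= v k) -> v k <= \sum_(i <oo) v i.
  move=> v0; apply: le_trans (nneseries_lim_ge k.+1 _) => //.
  by rewrite big_nat_recr//= leeDr// sume_ge0.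
have S0 : 0 < \sum_(i <oo) u i by exact: lt_le_trans uk0 (le1 _ h).
rewrite [RHS]gt0_mulye//; apply/eqP; rewrite -leye_eq.
apply: le_trans (le1 (fun k => +oo * u k) _); first by rewrite gt0_mulye.
by move=> i; apply: mule_ge0 => //; exact: h.
Qed.

(** Conditioning on [V]: the event splits over the values of [V], which are moved to naturals by
    [pickle] so that the union becomes a series. *)
Lemma disintegration (I : countType) (V : T -> I) (E : I -> set T) :
  meas_in measurable V -> (forall i, measurable (E i)) ->
  (forall i, P (V @^-1` [set i] `&` E i) = P (V @^-1` [set i]) * P (E i)) ->
  P [set w | E (V w) w] = \int[P]_w P (E (V w)).
Proof.
move=> mV mE H.
pose E' n := if pickle_inv n is Some i then E i else set0.
have E'V w : E' (pickle (V w)) = E (V w) by rewrite /E' pickleK_inv.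
have mV' : meas_in measurable (fun w => pickle (V w)) by exact: (meas_in_comp pickle).
have mE' n : measurable (E' n) by rewrite /E'; case: pickle_inv.
transitivity (\int[P]_w P (E' (pickle (V w)))); last first.
  by apply: eq_integral => w _; rewrite E'V.
rewrite (@integral_discrete (fun w => pickle (V w)) (fun n => P (E' n)))//.
have -> : [set w | E (V w) w] =
    \bigcup_n ((fun w => pickle (V w)) @^-1` [set n] `&` E' n).
  apply/seteqP; split => w /=; first by move=> Ew; exists (pickle (V w)) => //=; rewrite E'V.
  by case=> n _ [<-]; rewrite E'V.
rewrite measure_bigcup//; last 2 first.
- by move=> n _; apply: measurableI => //; exact: mV'.
- by move=> i j _ _ [w [[/= <- _] [<- _]]].
under eq_eseriesl do rewrite in_setT.
apply: eq_eseriesr => n _; rewrite setTI muleC.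
rewrite /E'; case: (pickle_inv n) (@pickle_invK I n) => [i /= <-|_].
  have -> : (fun w => pickle (V w)) @^-1` [set pickle i] = V @^-1` [set i].
    apply/seteqP; split => w /=; last by move=> ->.
    exact: (pcan_inj pickleK).
  exact: H.
by rewrite setI0 !measure0 mule0.
Qed.

End discrete_integrals.

Section discrete_expectation.
Context d (T : measurableType d) (R : realType) (P : probability T R).
Local Open Scope ereal_scope.

(** A finite expectation is a convergent series, whose remainders tend to 0. *)
Lemma integral_discrete_tail (V : T -> nat) (g : nat -> \bar R) :
  meas_in measurable V -> (forall k, 0 <= g k) -> \int[P]_w g (V w) < +oo ->
  forall e : R, (0 < e)%R -> exists K : nat,
    \int[P]_(w in [set w | (K <= V w)%N]) g (V w) <= e%:E.
Proof.
move=> mV g0 goo e e0.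
pose u k := g k * P (V @^-1` [set k]).
have u0 k : 0 <= u k by exact: mule_ge0.
have goo' : \sum_(k <oo) u k < +oo.
  move: goo; rewrite (integral_discrete P measurableT mV g0).
  by under eq_eseriesr do rewrite setTI.
have := nneseries_tail_cvg goo' (fun k _ => u0 k).
move/fine_cvgP => [_ /cvgrPdist_le/(_ _ e0)[K _ HK]].
exists K; have mK : measurable [set w | (K <= V w)%N] by exact: (mV [set k | (K <= k)%N]).
rewrite (integral_discrete P mK mV g0).
have -> : \sum_(k <oo) g k * P ([set w | (K <= V w)%N] `&` V @^-1` [set k]) =
    \sum_(K <= k <oo) u k.
  rewrite [RHS]eseries_cond [RHS]eseries_mkcond; apply: eq_eseriesr => k _ /=.
  case: ifPn => Kk.
    congr (_ * P _); apply/seteqP; split => w /=; first by case.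
    by move=> Vk; split => //; rewrite Vk.
  rewrite (_ : _ `&` _ = set0) ?measure0 ?mule0//.
  apply/seteqP; split => w //= -[KV Vk]; move: Kk.
  by rewrite -Vk KV.
have fin : \sum_(K <= k <oo) u k \is a fin_num.
  rewrite ge0_fin_numE; last by apply: nneseries_ge0.
  apply: le_lt_trans goo'.
  rewrite [leRHS](nneseries_split 0 K)//= add0n leeDr//.
  by apply: sume_ge0.
have := HK K (leqnn K); rewrite sub0r normrN /= => h.
rewrite -(fineK fin) lee_fin; exact: le_trans (ler_norm _) h.
Qed.

Lemma integral_law (V W : T -> nat) (g : nat -> \bar R) :
  meas_in measurable V -> meas_in measurable W -> (forall k, 0 <= g k) ->
  (forall B, P (V @^-1` B) = P (W @^-1` B)) ->
  \int[P]_w g (V w) = \int[P]_w g (W w).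
Proof.
move=> mV mW g0 VW; rewrite !integral_discrete//.
by apply: eq_eseriesr => k _; rewrite !setTI VW.
Qed.

(** Wald's identity, with [W k] playing the role of the sum of k terms of mean [c]. *)
Lemma integral_random_index (V : T -> nat) (W : nat -> T -> nat) (c : R) :
  meas_in measurable V -> (forall k, meas_in measurable (W k)) ->
  (0 <= c)%R ->
  (forall k j, P (V @^-1` [set k] `&` W k @^-1` [set j]) =
     P (V @^-1` [set k]) * P (W k @^-1` [set j])) ->
  (forall k, \int[P]_w ((W k w)%:R : R)%:E = (k%:R * c)%:E) ->
  \int[P]_w ((W (V w) w)%:R : R)%:E = (\int[P]_w ((V w)%:R : R)%:E) * c%:E.
Proof.
move=> mV mW c0 ind EW.
have mU : meas_in measurable (fun w => W (V w) w).
  by apply: meas_in_dep => //; exact: sigma_algebra_measurable.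
rewrite {1}(discrete_partition V setT).
have mk k : measurable ([set: T] `&` V @^-1` [set k]) by exact: measurableI.
rewrite ge0_integral_bigcup//; last 2 first.
- have mB : measurable (\bigcup_k ([set: T] `&` V @^-1` [set k])).
    exact: bigcup_measurable.
  exact: (measurable_discrete (fun k => (k%:R : R)%:E) mB mU).
- exact: trivIset_partition.
rewrite (integral_discrete (g := fun k => (k%:R : R)%:E) P measurableT mV)//.
rewrite muleC -nneseriesZl; last by move=> k _; exact: mule_ge0.
apply: eq_eseriesr => k _; rewrite setTI.
transitivity (\int[P]_(w in V @^-1` [set k]) ((W k w)%:R : R)%:E).
  by apply: eq_integral => w; rewrite inE /= => ->.
have mVk : measurable (V @^-1` [set k]) by exact: mV.
rewrite (integral_indep (g := fun k => (k%:R : R)%:E) mVk (mW k))// EW EFinM.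
by rewrite muleC -muleA muleCA.
Qed.

End discrete_expectation.

Section discrete_expectation_algebra.
Context d (T : measurableType d) (R : realType) (P : probability T R).
Context (I : Type) (V : T -> I).
Hypothesis mV : meas_in measurable V.
Implicit Types f g : I -> R.

Lemma measurable_discreteE f (D : set T) : measurable D ->
  measurable_fun D (fun w => (f (V w))%:E).
Proof. by move=> mD; exact: (measurable_discrete (fun i => (f i)%:E) mD mV). Qed.

Lemma integral_discrete_le f g : (forall i, 0 <= f i) -> (forall i, f i <= g i) ->
  (\int[P]_w (f (V w))%:E <= \int[P]_w (g (V w))%:E)%E.
Proof.
move=> f0 fg; apply: ge0_le_integral => //.
- by move=> w _; rewrite lee_fin.
- exact: measurable_discreteE.
- exact: measurable_discreteE.
- by move=> w _; rewrite lee_fin.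
Qed.

Lemma integral_discreteD f g : (forall i, 0 <= f i) -> (forall i, 0 <= g i) ->
  (\int[P]_w (f (V w) + g (V w))%:E = \int[P]_w (f (V w))%:E + \int[P]_w (g (V w))%:E)%E.
Proof.
move=> f0 g0; under eq_integral do rewrite EFinD.
rewrite ge0_integralD//.
- by move=> w _; rewrite lee_fin.
- exact: measurable_discreteE.
- by move=> w _; rewrite lee_fin.
- exact: measurable_discreteE.
Qed.

Lemma integral_discreteZ (c : R) f : 0 <= c -> (forall i, 0 <= f i) ->
  (\int[P]_w (c * f (V w))%:E = c%:E * \int[P]_w (f (V w))%:E)%E.
Proof.
move=> c0 f0; under eq_integral do rewrite EFinM.
rewrite ge0_integralZl_EFin//; first by move=> w _; rewrite lee_fin.
exact: measurable_discreteE.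
Qed.

Lemma integral_prob_cst (c : R) : (\int[P]_w c%:E = c%:E)%E.
Proof.
transitivity (c%:E * P setT)%E; first exact: integral_cst.
by rewrite probability_setT mule1.
Qed.

Lemma integral_discrete_indic (A : set I) :
  (\int[P]_w (\1_A (V w))%:E = P (V @^-1` A))%E.
Proof.
transitivity (P (V @^-1` A `&` setT)); last by rewrite setIT.
by rewrite -integral_indic//; exact: mV.
Qed.

End discrete_expectation_algebra.

(** * Chernoff bounds for independent summands *)

Section chernoff.
Context d (T : measurableType d) (R : realType) (P : probability T R).

Lemma meas_in_partial_sum (Z : nat -> T -> nat) m :
  (forall i, meas_in measurable (Z i)) ->
  meas_in measurable (fun w => \sum_(0 <= i < m) Z i w)%N.
Proof.
by move=> mZ; apply: meas_in_sum => //; exact: sigma_algebra_measurable.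
Qed.

Definition indep_rv (I J : Type) (V : T -> I) (W : T -> J) := forall B C,
  P (V @^-1` B `&` W @^-1` C) = (P (V @^-1` B) * P (W @^-1` C))%E.

(** The map [f] is there for the truncations, to which the Chernoff bounds are applied. *)
Definition past_indep (Z : nat -> T -> nat) := forall (f : nat -> nat) m,
  indep_rv (fun w => \sum_(0 <= i < m) f (Z i w))%N (fun w => f (Z m w)).

Context (z : T -> nat) (Z : nat -> T -> nat).
Hypotheses (mz : meas_in measurable z) (mZ : forall i, meas_in measurable (Z i))
  (lawZ : forall i B, P (Z i @^-1` B) = P (z @^-1` B)) (indZ : past_indep Z).

Lemma exp_moment_sum (f : nat -> nat) (s k : R) m :
  (\int[P]_w (expR (s * (f (z w))%:R))%:E <= (expR k)%:E)%E ->
  (\int[P]_w (expR (s * (\sum_(0 <= i < m) f (Z i w))%N%:R))%:E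
    <= (expR (m%:R * k))%:E)%E.
Proof.
move=> H; elim: m => [|m IH].
  under eq_integral do rewrite big_nil mulr0 expR0.
  by rewrite mul0r expR0 (integral_cst P measurableT 1%E) mul1e probability_le1.
under eq_integral do rewrite big_nat_recr//= natrD mulrDr expRD EFinM.
have mf i : meas_in measurable (fun w => f (Z i w)) by exact: meas_in_comp (mZ i).
have g0 k0 : (0%R <= (expR (s * k0%:R))%:E :> \bar R)%E by rewrite lee_fin expR_ge0.
rewrite (@integral_indep2 _ _ _ P (fun w => \sum_(0 <= i < m) f (Z i w))%N
  (fun w => f (Z m w)) (fun k => (expR (s * k%:R))%:E)
  (fun k => (expR (s * k%:R))%:E))//; last 2 first.
- exact: (meas_in_partial_sum m mf).
- by move=> j l; exact: (indZ f m [set j] [set l]).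
rewrite -natr1 mulrDl mul1r expRD EFinM; apply: lee_pmul => //.
- by apply: integral_ge0.
- by apply: integral_ge0.
rewrite (@integral_law _ _ _ P (Z m) z (fun k => (expR (s * (f k)%:R))%:E))//.
Qed.

(** Markov's inequality for the exponential. The sign of [s] is free: positive for upward
    deviations, negative for downward ones. *)
Lemma sum_chernoff (f : nat -> nat) (s k t : R) m :
  (\int[P]_w (expR (s * (f (z w))%:R))%:E <= (expR k)%:E)%E ->
  pr P [set w | t <= s * (\sum_(0 <= i < m) f (Z i w))%N%:R] <=
    expR (m%:R * k - t).
Proof.
move=> /(@exp_moment_sum f s k m) H.
have mf i : meas_in measurable (fun w => f (Z i w)) by exact: meas_in_comp (mZ i).
have mS := meas_in_partial_sum m mf.
set E := [set w | _].
have mE : measurable E by exact: (mS [set k | t <= s * k%:R]).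
rewrite expRD expRN ler_pdivlMr ?expR_gt0// -lee_fin EFinM -pr_fin//.
apply: le_trans H; rewrite muleC -integral_cst//.
apply: (@le_trans _ _ (\int[P]_(w in E) (expR (s * (\sum_(0 <= i < m) f (Z i w))%N%:R))%:E)%E).
  apply: ge0_le_integral => //.
  - by move=> w _; rewrite lee_fin expR_ge0.
  - exact: (measurable_discrete (fun k => (expR (s * k%:R))%:E) _ mS).
  - by move=> w Ew; rewrite lee_fin ler_expR.
apply: ge0_subset_integral => //; first exact: (measurable_discrete (fun k => (expR (s * k%:R))%:E) _ mS).
Qed.

End chernoff.

(** * Truncated and exponential moments *)

(** From exp(-u) >= 1 - u one gets exp u <= 1 + u exp u; inserting this bound into its own
    right-hand side gives the claim. *)
Lemma expR_le_quad (R : realType) (u : R) : 0 <= u -> expR u <= 1 + u + u ^+ 2 * expR u.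
Proof.
move=> u0; have h : expR u <= 1 + u * expR u.
  have := expR_ge1Dx (- u); rewrite expRN -[leRHS]div1r ler_pdivlMr ?expR_gt0//.
  by rewrite mulrDl mul1r mulNr lerBlDr.
by have := ler_wpM2l u0 h; rewrite mulrDr mulr1 expr2 -mulrA; lra.
Qed.

Lemma expRN_le_quad (R : realType) (u : R) : 0 <= u -> expR (- u) + u <= 1 + u ^+ 2.
Proof.
move=> u0; rewrite -lerBrDr expRN; have u1 : 0 < 1 + u by rewrite ltr_pwDl.
apply: (@le_trans _ _ (1 + u)^-1).
  by rewrite lef_pV2 ?posrE ?expR_gt0// expR_ge1Dx.
rewrite -div1r ler_pdivrMr//.
have -> : (1 + u ^+ 2 - u) * (1 + u) = 1 + u ^+ 3 by ring.
by rewrite lerDl exprn_ge0.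
Qed.

Section tails.
Context d (T : measurableType d) (R : realType) (P : probability T R).
Context (z : T -> nat).
Hypothesis mz : meas_in measurable z.

Lemma measurable_tail (x : R) : measurable [set w | x < (z w)%:R].
Proof. exact: (mz [set k : nat | x < k%:R]). Qed.

Lemma tail_mono : {homo tail P z : x y / x <= y >-> y <= x}.
Proof.
move=> x y xy; apply: pr_le; [exact: measurable_tail|exact: measurable_tail|].
by move=> w /=; exact: le_lt_trans.
Qed.

Lemma tail_ge0 x : 0 <= tail P z x. Proof. exact: pr_ge0. Qed.

(** Markov's inequality on the event z > x only, where the expectation of z is a vanishing
    remainder. At index 1 regular variation alone would not give this decay. *)
Lemma tail_small (mu : R) : mean P z = mu%:E -> forall e, 0 < e ->
  \forall x \near +oo, x * tail P z x <= e.
Proof.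
move=> mE e e0.
have [||K HK] := @integral_discrete_tail _ _ _ P z (fun k => (k%:R : R)%:E) mz _ _ e e0.
- by move=> k; rewrite lee_fin.
- by rewrite -/(mean P z) mE ltry.
near=> x; have x0 : 0 <= x by near: x; exact: near_ge.
have Kx : K%:R <= x by near: x; exact: near_ge.
rewrite /tail -lee_fin EFinM -pr_fin; last exact: measurable_tail.
apply: le_trans HK; rewrite -integral_cst; last exact: measurable_tail.
have mK : measurable [set w | (K <= z w)%N] by exact: (mz [set k | (K <= k)%N]).
apply: (@le_trans _ _ (\int[P]_(w in [set w | (x < (z w)%:R)%R]) ((z w)%:R : R)%:E)%E).
  apply: ge0_le_integral.
  - exact: measurable_tail.
  - by move=> w _; rewrite lee_fin.
  - exact: measurable_cst.
  - exact: (measurable_discreteE mz (fun k => k%:R) (measurable_tail x)).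
  - by move=> w /= /ltW; rewrite lee_fin.
apply: ge0_subset_integral => //.
- exact: measurable_tail.
- exact: (measurable_discreteE mz (fun k => k%:R) mK).
- by move=> w /= /ltW h; rewrite -(ler_nat R) (le_trans Kx).
Unshelve. all: by end_near. Qed.

(** Capping at y, instead of discarding the values above y, makes the moment easy to compare between
    y and 2 y. *)
Definition trunc_moment (y : R) : R :=
  fine (\int[P]_w ((Num.min (z w)%:R y) ^+ 2)%:E)%E.

Lemma trunc_momentE y : 0 <= y ->
  (\int[P]_w ((Num.min (z w)%:R y) ^+ 2)%:E)%E = (trunc_moment y)%:E.
Proof.
move=> y0; rewrite fineK// ge0_fin_numE; last first.
  by apply: integral_ge0 => w _; rewrite lee_fin sqr_ge0.
apply: (@le_lt_trans _ _ (\int[P]_w (y ^+ 2)%:E)%E).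
  apply: (integral_discrete_le P mz (f := fun k => (Num.min k%:R y) ^+ 2) (g := fun=> y ^+ 2)).
    by move=> k; exact: sqr_ge0.
  by move=> k; rewrite ler_pXn2r// ?nnegrE// ?le_min ?y0 ?ler0n// ge_min lexx orbT.
by rewrite integral_prob_cst ltry.
Qed.

Lemma trunc_moment_ge0 y : 0 <= trunc_moment y.
Proof. by apply: fine_ge0; apply: integral_ge0 => w _; rewrite lee_fin sqr_ge0. Qed.

Lemma trunc_moment_mono x y : 0 <= x -> x <= y -> trunc_moment x <= trunc_moment y.
Proof.
move=> x0 xy; have y0 := le_trans x0 xy.
rewrite -lee_fin -!trunc_momentE//.
apply: (integral_discrete_le P mz (f := fun k => (Num.min k%:R x) ^+ 2)
  (g := fun k => (Num.min k%:R y) ^+ 2)) => k; first exact: sqr_ge0.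
rewrite ler_pXn2r ?nnegrE ?le_min ?ler0n ?x0 ?y0//.
by rewrite !ge_min lexx xy orbT.
Qed.

(** Raising the cap changes the integrand only where z > y, and there it is at most (2 y)^2. *)
Lemma trunc_moment_double y : 0 <= y ->
  trunc_moment (2 * y) <= trunc_moment y + 4 * y ^+ 2 * tail P z y.
Proof.
move=> y0; have y20 : 0 <= 2 * y by rewrite mulr_ge0.
have c0 : 0 <= 4 * y ^+ 2 by rewrite mulr_ge0// sqr_ge0.
rewrite -lee_fin EFinD EFinM -!trunc_momentE//.
have -> : ((tail P z y)%:E = \int[P]_w (\1_([set k : nat | y < k%:R]) (z w))%:E)%E.
  by rewrite integral_discrete_indic// /tail -pr_fin//; exact: measurable_tail.
rewrite -(integral_discreteZ P mz (f := fun k => \1_([set k : nat | y < k%:R]) k))//.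
rewrite -(integral_discreteD P mz (f := fun k => (Num.min k%:R y) ^+ 2)
  (g := fun k => 4 * y ^+ 2 * \1_([set k : nat | y < k%:R]) k)); last 2 first.
- by move=> k; exact: sqr_ge0.
- by move=> k; rewrite mulr_ge0.
apply: (integral_discrete_le P mz (f := fun k => (Num.min k%:R (2 * y)) ^+ 2)
  (g := fun k => (Num.min k%:R y) ^+ 2 + 4 * y ^+ 2 * \1_([set k : nat | y < k%:R]) k)) => k.
  exact: sqr_ge0.
have [ky|ky] := leP k%:R y.
  rewrite (min_idPl _); last by rewrite (le_trans ky)// ler_peMl// ler1n.
  by rewrite lerDl mulr_ge0.
rewrite indicE mem_set//= mulr1; apply: (@le_trans _ _ ((2 * y) ^+ 2)).
  by rewrite ler_pXn2r ?nnegrE ?le_min ?y20 ?ler0n// ge_min lexx orbT.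
by rewrite exprMn -natrX lerDr sqr_ge0.
Qed.

(** An upper bound of Karamata type: since b < 2, the profile x^2 g(x) grows at each doubling by a
    factor at least 2^(2 - b) > 1, which absorbs the increment of the moment. *)
Lemma trunc_moment_le (g : R -> R) (b C x0 : R) : 0 < x0 -> 0 < b -> b < 2 -> 0 < C ->
  (forall x, x0 <= x -> 0 < g x) ->
  (forall x y, x0 <= x -> x <= y -> g y <= g x) ->
  (forall x, x0 <= x -> tail P z x <= C * g x) ->
  (forall x, x0 <= x -> 2 `^ (- b) * g x <= g (2 * x)) ->
  exists2 D, 0 < D & forall x, x0 <= x -> trunc_moment x <= D * (x ^+ 2 * g x).
Proof.
move=> x00 b0 b2 C0 gpos gmono tg g2.
have c4 : 2 `^ b < 4.
  have -> : 4 = 2 `^ 2 :> R by rewrite powR_mulrn// -natrX.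
  exact: powR2_lt.
have c1 : 0 < 4 - 2 `^ b by rewrite subr_gt0.
have x20 : x0 <= 2 * x0 by rewrite ler_peMl ?ler1n// ltW.
have c2 : 0 < 2 `^ b :> R by rewrite powR_gt0.
(* [D1] solves (D + 4 C) 2^b = 4 D, which closes the doubling step; [D2] takes care of the first
   block. *)
pose D1 := 4 * C * 2 `^ b / (4 - 2 `^ b).
pose D2 := trunc_moment (2 * x0) / (x0 ^+ 2 * g (2 * x0)).
have den : 0 < x0 ^+ 2 * g (2 * x0) by rewrite mulr_gt0 ?exprn_gt0// gpos.
have D10 : 0 < D1 by rewrite divr_gt0// mulr_gt0// mulr_gt0.
have D20 : 0 <= D2 by rewrite divr_ge0 ?trunc_moment_ge0// ltW.
exists (D1 + D2); first by rewrite ltr_wpDr.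
apply: dyadic_le => // x xx0.
  move=> x2; have xp : 0 < x by exact: lt_le_trans xx0.
  apply: (@le_trans _ _ (trunc_moment (2 * x0))); first by rewrite trunc_moment_mono// ltW.
  apply: (@le_trans _ _ (D2 * (x0 ^+ 2 * g (2 * x0)))).
    by rewrite /D2 divfK// gt_eqF.
  apply: ler_pM => //; first exact: ltW.
    by rewrite lerDr ltW.
  apply: ler_pM => //; first by rewrite sqr_ge0.
  - by rewrite ltW// gpos.
  - by rewrite ler_pXn2r// ?nnegrE ltW.
  - exact: gmono.
move=> IH; have xp : 0 < x by exact: lt_le_trans xx0.
apply: (le_trans (trunc_moment_double (ltW xp))).
set D := D1 + D2 in IH *.
apply: (@le_trans _ _ ((D + 4 * C) * (x ^+ 2 * g x))).
  rewrite [leRHS]mulrDl; apply: lerD => //.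
  have -> : 4 * C * (x ^+ 2 * g x) = 4 * x ^+ 2 * (C * g x) by ring.
  by rewrite ler_wpM2l ?tg// mulr_ge0// sqr_ge0.
have h : (D + 4 * C) * 2 `^ b <= 4 * D.
  have e1 : D1 * (4 - 2 `^ b) = 4 * C * 2 `^ b by rewrite /D1 divfK// gt_eqF.
  have : 0 <= D2 * (4 - 2 `^ b) by rewrite mulr_ge0// ltW.
  by rewrite /D; nra.
have gx : g x <= 2 `^ b * g (2 * x).
  have := g2 _ xx0; rewrite powRN -(ler_pM2l c2) mulrA mulfV ?gt_eqF// mul1r //.
have D0 : 0 <= D + 4 * C by rewrite /D; nra.
apply: (@le_trans _ _ ((D + 4 * C) * (x ^+ 2 * (2 `^ b * g (2 * x))))).
  by rewrite ler_wpM2l// ler_wpM2l// sqr_ge0.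
have -> : (D + 4 * C) * (x ^+ 2 * (2 `^ b * g (2 * x))) =
  ((D + 4 * C) * 2 `^ b) * (x ^+ 2 * g (2 * x)) by ring.
have -> : D * ((2 * x) ^+ 2 * g (2 * x)) = 4 * D * (x ^+ 2 * g (2 * x)) by ring.
rewrite ler_wpM2r// mulr_ge0 ?sqr_ge0// ltW// gpos//.
by rewrite (le_trans xx0)// ler_peMl ?ler1n// ltW.
Qed.

(** The cap bounds the exponential inside the quadratic term of [expR_le_quad] by exp(s y), leaving
    the truncated second moment; the linear term keeps the full mean. *)
Lemma exp_moment_upper (mu s y : R) : mean P z = mu%:E -> 0 <= s -> 0 <= y ->
  (\int[P]_w (expR (s * (minn (z w) (Num.truncn y))%:R))%:E
   <= (expR (s * mu + s ^+ 2 * expR (s * y) * trunc_moment y))%:E)%E.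
Proof.
move=> mE s0 y0.
apply: (@le_trans _ _ (\int[P]_w (1 + (s * (z w)%:R +
    s ^+ 2 * expR (s * y) * (Num.min (z w)%:R y) ^+ 2))%:E)%E).
  apply: (integral_discrete_le P mz (f := fun k => expR (s * (minn k (Num.truncn y))%:R))
    (g := fun k => 1 + (s * k%:R + s ^+ 2 * expR (s * y) * (Num.min k%:R y) ^+ 2))) => k.
    exact: expR_ge0.
  pose u := s * Num.min k%:R y.
  have m0 : 0 <= Num.min k%:R y by rewrite le_min ler0n y0.
  have u0 : 0 <= u by rewrite mulr_ge0.
  apply: (@le_trans _ _ (expR u)).
    rewrite ler_expR ler_wpM2l// natr_min le_min !ge_min lexx/=.
    by rewrite truncn_le y0 orbT.
  apply: (le_trans (expR_le_quad u0)); rewrite -addrA lerD2l lerD//.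
    by rewrite ler_wpM2l// ge_min lexx.
  rewrite /u exprMn mulrAC; rewrite ler_wpM2r ?sqr_ge0// ler_wpM2l ?sqr_ge0//.
  by rewrite ler_expR ler_wpM2l// ge_min lexx orbT.
have c0 : 0 <= s ^+ 2 * expR (s * y) by rewrite mulr_ge0 ?sqr_ge0// expR_ge0.
rewrite (integral_discreteD P mz (f := fun=> 1)
  (g := fun k => s * k%:R + s ^+ 2 * expR (s * y) * (Num.min k%:R y) ^+ 2))//; last first.
  by move=> k; rewrite addr_ge0// mulr_ge0// sqr_ge0.
rewrite (integral_discreteD P mz (f := fun k => s * k%:R)
  (g := fun k => s ^+ 2 * expR (s * y) * (Num.min k%:R y) ^+ 2)); last 2 first.
- by move=> k; rewrite mulr_ge0.
- by move=> k; rewrite mulr_ge0// sqr_ge0.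
rewrite (integral_discreteZ P mz (f := fun k => k%:R))//.
rewrite (integral_discreteZ P mz (f := fun k => (Num.min k%:R y) ^+ 2))//; last first.
  by move=> k; exact: sqr_ge0.
rewrite integral_prob_cst -/(mean P z) mE trunc_momentE// -!EFinM -!EFinD lee_fin.
exact: expR_ge1Dx.
Qed.

(** For negative exponents a fixed cap [K] is enough: capping only lowers the sum, and the
    second-order term is then at most (s K)^2. *)
Lemma exp_moment_lower (muK s : R) (K : nat) :
  (\int[P]_w ((minn (z w) K)%:R : R)%:E = muK%:E)%E -> 0 <= s ->
  (\int[P]_w (expR (- s * (minn (z w) K)%:R))%:E
   <= (expR (- s * muK + (s * K%:R) ^+ 2))%:E)%E.
Proof.
move=> mE s0.
apply: (@le_trans _ _ (1 + (s * K%:R) ^+ 2 - s * muK)%:E); last first.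
  rewrite lee_fin; apply: le_trans (expR_ge1Dx _); rewrite mulNr; lra.
rewrite EFinB leeBrDr// EFinM -mE -(integral_discreteZ P mz (f := fun k => (minn k K)%:R))//.
rewrite -(integral_discreteD P mz (f := fun k => expR (- s * (minn k K)%:R))
  (g := fun k => s * (minn k K)%:R)); last 2 first.
- by move=> k; exact: expR_ge0.
- by move=> k; rewrite mulr_ge0.
rewrite -[leRHS](integral_prob_cst P).
apply: (integral_discrete_le P mz (f := fun k => expR (- s * (minn k K)%:R) + s * (minn k K)%:R)
  (g := fun=> 1 + (s * K%:R) ^+ 2)) => k.
  by rewrite addr_ge0 ?expR_ge0// mulr_ge0.
have u0 : 0 <= s * (minn k K)%:R by rewrite mulr_ge0.
rewrite mulNr; apply: (le_trans (expRN_le_quad u0)); rewrite lerD2l.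
rewrite ler_pXn2r ?nnegrE// ?mulr_ge0// ler_wpM2l// ler_nat; exact: geq_minr.
Qed.

End tails.

(** * Large deviations of partial sums *)

Section truncated_mean.
Context d (T : measurableType d) (R : realType) (P : probability T R).
Context (z : T -> nat).
Hypothesis mz : meas_in measurable z.

Lemma integral_tail_indic (g : nat -> R) : (forall k, 0 <= g k) ->
  (\int[P]_w (g (z w))%:E < +oo)%E -> forall e, 0 < e -> exists K : nat,
  (\int[P]_w (g (z w) * \1_([set k | (K <= k)%N]) (z w))%:E <= e%:E)%E.
Proof.
move=> g0 goo e e0.
have g0' k : (0 <= (g k)%:E)%E by rewrite lee_fin.
have [K HK] := integral_discrete_tail mz g0' goo e0.
exists K; apply: le_trans HK; rewrite [leRHS]integral_mkcond.
rewrite le_eqVlt; apply/orP; left; apply/eqP; apply: eq_integral => w _.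
rewrite patchE indicE; case: ifPn => [|] h.
  by rewrite mem_set ?mulr1//; move: h; rewrite inE.
rewrite memNset ?mulr0// => h'; move/negP: h; apply; rewrite inE.
exact: h'.
Qed.

Lemma truncated_mean (mu e : R) : mean P z = mu%:E -> 0 < e -> exists (K : nat) (muK : R),
  (\int[P]_w ((minn (z w) K)%:R : R)%:E = muK%:E)%E /\ mu - muK <= e.
Proof.
move=> mE e0.
have [||K HK] := @integral_tail_indic (fun k => k%:R) _ _ e e0.
- by [].
- by rewrite -/(mean P z) mE ltry.
have K0 : (0 <= \int[P]_w ((minn (z w) K)%:R : R)%:E)%E.
  by apply: integral_ge0 => w _; rewrite lee_fin.
have fK : (\int[P]_w ((minn (z w) K)%:R : R)%:E)%E \is a fin_num.
  rewrite ge0_fin_numE//; apply: le_lt_trans (ltry mu); rewrite -mE.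
  apply: (integral_discrete_le P mz (f := fun k => (minn k K)%:R) (g := fun k => k%:R)) => k//.
  by rewrite ler_nat geq_minl.
exists K, (fine (\int[P]_w ((minn (z w) K)%:R : R)%:E)%E); rewrite fineK//; split => //.
rewrite lerBlDl -lee_fin EFinD fineK// -mE.
apply: le_trans (leeD2l _ HK).
rewrite -(integral_discreteD P mz (f := fun k => (minn k K)%:R)
   (g := fun k => k%:R * \1_([set k | (K <= k)%N]) k))//.
apply: (integral_discrete_le P mz (f := fun k => k%:R)
   (g := fun k => (minn k K)%:R + k%:R * \1_([set k | (K <= k)%N]) k)) => k//.
have [kK|kK] := leqP k K; first by rewrite lerDl mulr_ge0.
by rewrite indicE mem_set/= ?mulr1 ?lerDr//; exact: ltnW.
Qed.

End truncated_mean.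

Lemma powR_small (R : realType) (b e : R) : 0 < b -> 0 < e ->
  \forall x \near +oo, x `^ (- b) <= e.
Proof.
move=> b0 e0; near=> x.
have hx : e `^ (- b^-1) <= x by near: x; exact: near_ge.
have p0 : 0 < e `^ (- b^-1) by exact: powR_gt0.
have x0 : 0 < x by exact: lt_le_trans hx.
rewrite powRN invf_ple ?posrE ?powR_gt0//.
have -> : e^-1 = (e `^ (- b^-1)) `^ b.
  by rewrite -powRrM mulNr mulVf ?gt_eqF// powR_inv1// ltW.
by rewrite ge0_ler_powR ?nnegrE// ltW.
Unshelve. all: by end_near. Qed.

Section deviations.
Context d (T : measurableType d) (R : realType) (P : probability T R).
Context (z : T -> nat) (Z : nat -> T -> nat).
Hypotheses (mz : meas_in measurable z) (mZ : forall i, meas_in measurable (Z i))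
  (lawZ : forall i B, P (Z i @^-1` B) = P (z @^-1` B)) (indZ : past_indep P Z).

Local Notation S m w := (\sum_(0 <= i < m) Z i w)%N.

Lemma some_jumpE (y : R) m :
  [set w | exists2 i, (i < m)%N & y < (Z i w)%:R] =
  \big[setU/set0]_(i < m) [set w | y < (Z i w)%:R].
Proof.
rewrite -(bigcup_mkord m (fun i => [set w | y < (Z i w)%:R])).
by apply/seteqP; split => w [i im yi]; exists i.
Qed.

Lemma measurable_some_jump (y : R) m :
  measurable [set w | exists2 i, (i < m)%N & y < (Z i w)%:R].
Proof.
rewrite some_jumpE; apply: bigsetU_measurable => i _.
exact: (mZ i [set k : nat | y < k%:R]).
Qed.

Lemma some_jump_le (y : R) m :
  pr P [set w | exists2 i, (i < m)%N & y < (Z i w)%:R] <= m%:R * tail P z y.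
Proof.
have mU := measurable_some_jump y m.
have mE i : measurable [set w | y < (Z i w)%:R] by exact: (mZ i [set k : nat | y < k%:R]).
rewrite some_jumpE in mU *.
rewrite -lee_fin -pr_fin//.
apply: (le_trans (Boole_inequality P
  (A := fun i => [set w | (y < (Z i w)%:R)%R]) (n := m) _)) => //.
have lawE i : P [set w | y < (Z i w)%:R] = P [set w | y < (z w)%:R].
  exact: (lawZ i [set k : nat | y < k%:R]).
rewrite (eq_bigr (fun=> P [set w | y < (z w)%:R])); last by move=> i _; exact: lawE.
rewrite big_const_ord /tail EFinM -pr_fin; last exact: measurable_tail.
rewrite le_eqVlt; apply/orP; left; apply/eqP.
elim: m {mU} => [|m IH]; first by rewrite mul0e.
by rewrite iterS IH -natr1 EFinD ge0_muleDl ?lee_fin// mul1e addeC.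
Qed.

(** A Fuk-Nagaev inequality: either a summand exceeds theta x, or the capped sum makes the
    deviation. The number [p] of factors of [q] is half the ratio of the deviation to the truncation
    level, so a low truncation buys a high power. *)
Lemma ld_core (mu gamma theta q x : R) (p m : nat) : mean P z = mu%:E ->
  0 < theta -> 0 < x -> gamma = 2 * p%:R * theta -> 0 < q -> q < 1 ->
  m%:R * trunc_moment P z (theta * x) <= q * (theta * x) ^+ 2 ->
  pr P [set w | m%:R * mu + gamma * x < (S m w)%:R]
    <= m%:R * tail P z (theta * x) + expR 2 * q ^+ p.
Proof.
move=> mE th0 x0 gE q0 q1 mG.
set y := theta * x in mG *; have y0 : 0 < y by rewrite mulr_gt0.
(* With [expR (2 * L) = q^-1] and [L ^+ 2 <= 2 * expR L], the quadratic term of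
   the exponent is at most 2. *)
pose L := - ln q / 2; have L0 : 0 < L by rewrite divr_gt0// oppr_gt0 ln_lt0// q0.
pose s := L / y; have s0 : 0 < s by rewrite divr_gt0.
have syE : s * y = L by rewrite /s divfK// gt_eqF.
set t := m%:R * mu + gamma * x.
pose n := Num.truncn y.
have mf i : meas_in measurable (fun w => minn (Z i w) n) by exact: (meas_in_comp (minn ^~ n) (mZ i)).
have mS' := meas_in_partial_sum m mf.
have mA := measurable_some_jump y m.
pose B := [set w | s * t <= s * (\sum_(0 <= i < m) minn (Z i w) n)%N%:R].
have mB : measurable B by exact: (mS' [set k | s * t <= s * k%:R]).
(* Without a jump above y the capped sum is the sum itself. *)
apply: (@le_trans _ _ (pr P ([set w | exists2 i, (i < m)%N & y < (Z i w)%:R] `|` B))).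
  apply: pr_le => //; last 2 first.
  - exact: measurableU.
  - move=> w /= tS; have [[i im yi]|H] := pselect (exists2 i, (i < m)%N & y < (Z i w)%:R).
      by left; exists i.
    right; rewrite /B/= ler_pM2l//.
    suff -> : (\sum_(0 <= i < m) minn (Z i w) n = S m w)%N by exact: ltW.
    apply: eq_big_nat => i /andP[_ im]; apply/minn_idPl.
    rewrite truncn_ge_nat ?(ltW y0)// leNgt; apply/negP => yi; apply: H.
    by exists i.
  have mS := meas_in_partial_sum m mZ.
  exact: (mS [set k : nat | t < k%:R]).
apply: (le_trans (pr_leU P mA mB)); apply: lerD; first exact: some_jump_le.
have := @sum_chernoff _ _ _ P z Z mz mZ lawZ indZ (minn ^~ n) s _ (s * t) m
  (exp_moment_upper mz mE (ltW s0) (ltW y0)).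
move=> /le_trans; apply.
have -> : q ^+ p = expR (p%:R * ln q).
  by rewrite mulrC -powR_mulrn ?(ltW q0)// /powR gt_eqF// mulrC.
rewrite -expRD ler_expR syE.
have -> : m%:R * (s * mu + s ^+ 2 * expR L * trunc_moment P z y) - s * t =
    s ^+ 2 * expR L * (m%:R * trunc_moment P z y) - s * (gamma * x).
  by rewrite /t; ring.
apply: lerD; last first.
  have -> : s * (gamma * x) = 2 * p%:R * (s * y) by rewrite gE /y; ring.
  rewrite syE /L.
  by rewrite le_eqVlt; apply/orP; left; apply/eqP; field.
apply: (@le_trans _ _ (s ^+ 2 * expR L * (q * y ^+ 2))).
  by rewrite ler_wpM2l// mulr_ge0 ?sqr_ge0// expR_ge0.
have -> : s ^+ 2 * expR L * (q * y ^+ 2) = q * (expR L * L ^+ 2).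
  by rewrite -syE; ring.
have L2 : L ^+ 2 <= 2 * expR L.
  have := @expR_ge1Dxn R L 1 (ltW L0).
  by rewrite -[_`!]/2%N; have := expR_ge0 L; lra.
apply: (@le_trans _ _ (q * (expR L * (2 * expR L)))).
  by rewrite ler_wpM2l ?(ltW q0)// ler_wpM2l// expR_ge0.
have -> : q * (expR L * (2 * expR L)) = 2 * (q * expR (L + L)) by rewrite expRD; ring.
have -> : L + L = - ln q by rewrite /L; field.
by rewrite expRN lnK ?posrE// divff ?mulr1// gt_eqF.
Qed.

(* The profile [g] of the truncated second moment is the tail itself when
   [alpha < 2], and [y^(-3/2)] otherwise. *)
Lemma ld_upper_profile (alpha mu gamma theta c D x0 E : R) (g : R -> R) (p : nat) :
  mean P z = mu%:E -> rv alpha (tail P z) -> 0 < c -> 0 < theta ->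
  gamma = 2 * p.+1%:R * theta -> 0 < gamma -> 0 < D -> 0 < E ->
  (forall y, x0 <= y -> 0 < g y) ->
  (forall y, x0 <= y -> trunc_moment P z y <= D * (y ^+ 2 * g y)) ->
  (\forall x \near +oo, c * x * (D * g (theta * x)) < 1) ->
  (\forall x \near +oo, g (theta * x) * (c * x * (D * g (theta * x))) ^+ p <= E * tail P z x) ->
  exists2 C, 0 < C & \forall x \near +oo, forall m : nat, m%:R <= c * x ->
    pr P [set w | m%:R * mu + gamma * x < (S m w)%:R] <= C * (m%:R * tail P z x).
Proof.
move=> mE rvz c0 th0 gE g0 D0 E0 gpos gG H1 H2.
pose C1 := theta `^ (- alpha) + 1.
have C10 : 0 < C1 by rewrite ltr_wpDl// powR_ge0.
exists (C1 + expR 2 * (D * E)).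
  by rewrite addr_gt0// mulr_gt0 ?expR_gt0// mulr_gt0.
have HT := rv_dilation_le rvz th0.
near=> x => m mx.
have xp : 0 < x by near: x; exact: near_gt.
have hth : x0 <= theta * x by near: x; exact: (near_dilation th0 (near_ge x0)).
(* An empty sum is set apart because [ld_core] takes the logarithm of a positive [q]. *)
have [->|m0] := eqVneq m 0%N.
  rewrite (_ : [set w | _] = set0).
    by rewrite /pr measure0 mul0r mulr0.
  apply/seteqP; split => w //=; rewrite big_geq// mul0r add0r.
  by rewrite ltNge ltW// mulr_gt0.
have gp := gpos _ hth.
pose q := m%:R * (D * g (theta * x)).
have mp : 0 < m%:R :> R by rewrite ltr0n lt0n.
have q0 : 0 < q by rewrite mulr_gt0// mulr_gt0.
have qle : q <= c * x * (D * g (theta * x)).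
  by rewrite ler_wpM2r// ltW// mulr_gt0.
have q1 : q < 1 by apply: (le_lt_trans qle); near: x.
have := @ld_core mu gamma theta q x p.+1 m mE th0 xp gE q0 q1.
rewrite /q -!mulrA ler_pM2l// => H; apply: (le_trans (H _)).
  by apply: (le_trans (gG _ hth)); rewrite mulrCA -!mulrA (mulrC (g _)) mulrA mulrCA; nra.
rewrite mulrDl; apply: lerD.
  by rewrite mulrCA ler_wpM2l//; near: x.
rewrite -mulrA ler_wpM2l ?expR_ge0// exprS -/q.
(* One factor [q] keeps its m, for a bound linear in m; in the other p factors m is replaced by its
   maximum c x. *)
apply: (@le_trans _ _ (q * (c * x * (D * g (theta * x))) ^+ p)).
  by rewrite ler_wpM2l ?(ltW q0)// lerXn2r ?nnegrE ?(ltW q0)// (le_trans (ltW q0)).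
have -> : q * (c * x * (D * g (theta * x))) ^+ p =
   D * m%:R * (g (theta * x) * (c * x * (D * g (theta * x))) ^+ p) by rewrite /q; ring.
have -> : D * E * (m%:R * tail P z x) = D * m%:R * (E * tail P z x) by ring.
rewrite ler_wpM2l//; last by near: x.
by rewrite mulr_ge0// ltW.
Unshelve. all: by end_near. Qed.

(** Below index 2 the truncated moment at y is of order y^2 P(z > y), so [q] is itself m times a
    tail and one factor suffices. From index 2 on it is only bounded through y^(-3/2), and many
    factors compensate. *)
Lemma ld_upper (alpha mu gamma c : R) : 1 <= alpha ->
  mean P z = mu%:E -> rv alpha (tail P z) -> 0 < c -> 0 < gamma ->
  exists2 C, 0 < C & \forall x \near +oo, forall m : nat, m%:R <= c * x ->
    pr P [set w | m%:R * mu + gamma * x < (S m w)%:R] <= C * (m%:R * tail P z x).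
Proof.
move=> a1 mE rvz c0 g0; have [z0 Hz] := rvz.
have a0 : 0 < alpha by exact: lt_le_trans a1.
have [a2|a2] := ltP alpha 2.
  (* Strictly between alpha, for the doubling bound, and 2, for the truncated moment. *)
  pose b := (alpha + 2) / 2.
  have b0 : 0 < b by rewrite /b; lra.
  have ba : alpha < b by rewrite /b; lra.
  have b2 : b < 2 by rewrite /b; lra.
  have [x0 x00 hx0] := near_threshold (rv_double_ge ba rvz).
  have [||||D D0 HD] := @trunc_moment_le _ _ _ P z mz (tail P z) b 1 x0 x00 b0 b2 ltr01.
  - by move=> x /hx0[].
  - by move=> x y _; exact: tail_mono.
  - by move=> x _; rewrite mul1r.
  - by move=> x /hx0[].
  have th0 : 0 < gamma / 2 by rewrite divr_gt0.
  have E0 : 0 < (gamma / 2) `^ (- alpha) + 1 by rewrite ltr_wpDl// powR_ge0.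
  apply: (ld_upper_profile (p := 0%N) mE rvz c0 th0 _ g0 D0 E0 _ HD).
  - by field.
  - by move=> x /hx0[].
  - have e0 : 0 < gamma / 2 / (2 * (c * D)) by rewrite divr_gt0// !mulr_gt0.
    have hs := near_dilation th0 (tail_small mz mE e0).
    near=> x; have h : gamma / 2 * x * tail P z (gamma / 2 * x) <= gamma / 2 / (2 * (c * D)) by near: x.
    have -> : c * x * (D * tail P z (gamma / 2 * x)) =
      (gamma / 2)^-1 * (c * D) * (gamma / 2 * x * tail P z (gamma / 2 * x)).
      by field; exact: lt0r_neq0.
    apply: (@le_lt_trans _ _ ((gamma / 2)^-1 * (c * D) * (gamma / 2 / (2 * (c * D))))).
      by rewrite ler_wpM2l// mulr_ge0// ?invr_ge0 ?(ltW th0)// mulr_ge0// ltW.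
    have -> : (gamma / 2)^-1 * (c * D) * (gamma / 2 / (2 * (c * D))) = 1 / 2.
      by field; rewrite !lt0r_neq0.
    by lra.
  - by under eq_near do rewrite expr0 mulr1; exact: rv_dilation_le.
(* Each of the [p] extra factors decays like x^(-1/2), so more than 2 alpha of them beat the
   tail. *)
pose p := (Num.truncn (2 * alpha)).+1.
have pa : 2 * alpha < p%:R by rewrite truncnS_gt.
pose theta := gamma / (2 * p.+1%:R).
have th0 : 0 < theta by rewrite divr_gt0// mulr_gt0.
(* Less than 2 and than alpha, as the moment and Potter bounds require, yet above 1, so that x times
   x^(-b) decays. *)
pose b := 3 / 2 : R.
have b0 : 0 < b by rewrite /b; lra.
have ba : b < alpha by rewrite /b; lra.
have [Cu Cu0 HCu] := potter_upper b0 ba rvz (@tail_mono _ _ _ P z mz).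
have [x1 x10 hx1] := near_threshold HCu.
have [|||||D D0 HD] := @trunc_moment_le _ _ _ P z mz (fun y => y `^ (- b)) b Cu x1 x10 b0 _ Cu0.
- by rewrite /b; lra.
- by move=> x xx; rewrite powR_gt0//; exact: lt_le_trans xx.
- move=> x y xx xy; have xp := lt_le_trans x10 xx; have yp := lt_le_trans xp xy.
  rewrite !powRN lef_pV2 ?posrE ?powR_gt0//.
  by rewrite ge0_ler_powR// ?nnegrE ?(ltW b0) ?ltW.
- exact: hx1.
- move=> x xx; have xp := lt_le_trans x10 xx.
  by rewrite powRM// ltW.
pose K := c * (D * theta `^ (- b)).
have K0 : 0 < K by rewrite mulr_gt0// mulr_gt0// powR_gt0.
have KE x : 0 < x -> c * x * (D * (theta * x) `^ (- b)) = K * x `^ (- (1 / 2)).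
  move=> xp; rewrite powRM ?(ltW th0) ?(ltW xp)//.
  have -> : x `^ (- (1 / 2)) = x * x `^ (- b).
    rewrite -{2}(powRr1 (ltW xp)) -powRD; last by rewrite (gt_eqF xp) implybT.
    by congr (_ `^ _); rewrite /b; field.
  by rewrite /K; ring.
pose beta := b + p%:R / 2.
have beta0 : 0 < beta by rewrite /beta ltr_wpDr// divr_ge0.
have abeta : alpha < beta by rewrite /beta /b; lra.
have [Cl Cl0 HCl] := potter_lower beta0 abeta rvz (@tail_mono _ _ _ P z mz).
have E0 : 0 < theta `^ (- b) * K ^+ p * Cl by rewrite !mulr_gt0 ?exprn_gt0// powR_gt0.
apply: (ld_upper_profile (p := p) mE rvz c0 th0 _ g0 D0 E0 _ HD).
- by rewrite /theta mulrC divfK// lt0r_neq0// mulr_gt0.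
- by move=> y yy; rewrite powR_gt0//; exact: lt_le_trans yy.
- have e0 : 0 < 1 / (2 * K) by rewrite divr_gt0// mulr_gt0.
  have h12 : 0 < 1 / 2 :> R by rewrite divr_gt0.
  have hs := powR_small h12 e0.
  near=> x; have xp : 0 < x by near: x; exact: near_gt.
  rewrite KE//; apply: (@le_lt_trans _ _ (K * (1 / (2 * K)))).
    by rewrite ler_wpM2l ?(ltW K0)//; near: x.
  have -> : K * (1 / (2 * K)) = 1 / 2 by field; exact: lt0r_neq0.
  by lra.
- near=> x; have xp : 0 < x by near: x; exact: near_gt.
  rewrite KE// powRM ?(ltW th0) ?(ltW xp)// exprMn
    -(powR_mulrn p (powR_ge0 x (- (1 / 2)))) -powRrM.
  have h : x `^ (- beta) <= Cl * tail P z x by near: x.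
  have -> : theta `^ (- b) * x `^ (- b) * (K ^+ p * x `^ (- (1 / 2) * p%:R)) =
    theta `^ (- b) * K ^+ p * x `^ (- beta).
    have -> : - beta = - b + - (1 / 2) * p%:R by rewrite /beta; field.
    by rewrite powRD ?(gt_eqF xp) ?implybT//; ring.
  by rewrite -[leRHS]mulrA ler_wpM2l// mulr_ge0 ?powR_ge0// exprn_ge0// ltW.
Unshelve. all: by end_near. Qed.

(** A law of large numbers uniform over m <= c y. Only the lower side is claimed, so the summands
    may be capped and no second moment is involved. *)
Lemma lln_lower (mu delta c kappa : R) : mean P z = mu%:E ->
  0 < delta -> 0 < c -> 0 < kappa ->
  \forall y \near +oo, forall m : nat, m%:R <= c * y ->
    pr P [set w | (S m w)%:R <= m%:R * mu - delta * y] <= kappa.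
Proof.
move=> mE d0 c0 k0.
(* Of the allowance delta y, a quarter pays for the mean lost by capping and a quarter for the
   quadratic term; the remaining half drives the exponent below ln kappa. *)
have e0 : 0 < delta / (4 * c) by rewrite divr_gt0// mulr_gt0.
have [K [muK [EK muKe]]] := truncated_mean mz mE e0.
have [s s0 sK] : exists2 s, 0 < s & c * s * K%:R ^+ 2 <= delta / 4.
  have den : 0 < c * K%:R ^+ 2 + 1 by rewrite ltr_wpDl// mulr_ge0 ?sqr_ge0// ltW.
  exists (delta / (4 * (c * K%:R ^+ 2 + 1))); first by rewrite divr_gt0// mulr_gt0.
  have -> : c * (delta / (4 * (c * K%:R ^+ 2 + 1))) * K%:R ^+ 2 =
    delta / 4 * (c * K%:R ^+ 2 / (c * K%:R ^+ 2 + 1)) by field; exact: lt0r_neq0.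
  by rewrite ler_piMr ?divr_ge0 ?(ltW d0)// ler_pdivrMr// mul1r lerDl.
near=> y => m my.
have yp : 0 < y by near: y; exact: near_gt.
pose f k := minn k K.
have mf i : meas_in measurable (fun w => f (Z i w)) by exact: (meas_in_comp f (mZ i)).
have mS' := meas_in_partial_sum m mf.
have mS := meas_in_partial_sum m mZ.
pose t := m%:R * mu - delta * y.
apply: (@le_trans _ _ (pr P [set w | - s * t <= - s * (\sum_(0 <= i < m) f (Z i w))%N%:R])).
  apply: pr_le.
  - exact: (mS [set k : nat | k%:R <= t]).
  - exact: (mS' [set k : nat | - s * t <= - s * k%:R]).
  move=> w /= h; rewrite !mulNr lerN2 ler_pM2l//; apply: le_trans h.
  by rewrite ler_nat leq_sum// => i _; exact: geq_minl.
apply: (le_trans (@sum_chernoff _ _ _ P z Z mz mZ lawZ indZ f (- s) _ (- s * t) m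
  (exp_moment_lower mz EK (ltW s0)))).
have hy : - 2 * ln kappa / (s * delta) <= y by near: y; exact: near_ge.
rewrite ler_pdivrMr ?mulr_gt0// in hy.
rewrite -ler_ln ?posrE ?expR_gt0// expRK.
have -> : m%:R * (- s * muK + (s * K%:R) ^+ 2) - - s * t =
  s * (m%:R * (mu - muK) + m%:R * s * K%:R ^+ 2 - delta * y) by rewrite /t; ring.
have h1 : m%:R * (mu - muK) <= delta / 4 * y.
  apply: (@le_trans _ _ (m%:R * (delta / (4 * c)))); first by rewrite ler_wpM2l.
  apply: (@le_trans _ _ (c * y * (delta / (4 * c)))); first by rewrite ler_wpM2r// ltW.
  by rewrite le_eqVlt; apply/orP; left; apply/eqP; field; exact: lt0r_neq0.
have h2 : m%:R * s * K%:R ^+ 2 <= delta / 4 * y.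
  apply: (@le_trans _ _ (c * y * s * K%:R ^+ 2)).
    by rewrite ler_wpM2r ?sqr_ge0// ler_wpM2r// ltW.
  have -> : c * y * s * K%:R ^+ 2 = c * s * K%:R ^+ 2 * y by ring.
  by rewrite ler_wpM2r// ltW.
apply: (@le_trans _ _ (s * (- (delta / 2) * y))); last by nra.
by rewrite ler_wpM2l ?(ltW s0)//; lra.
Unshelve. all: by end_near. Qed.

End deviations.

(** * A single big jump *)

Lemma prD_UI d (T : measurableType d) (R : realType) (P : probability T R)
  (A B : set T) : measurable A -> measurable B ->
  pr P A + pr P B = pr P (A `|` B) + pr P (A `&` B).
Proof.
move=> mA mB.
have Aoo : (P A < +oo)%E by rewrite pr_fin// ltry.
have : P (A `|` B) = (P A + P B - P (A `&` B))%E := measureUfinl mA mB Aoo.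
rewrite (pr_fin P mA) (pr_fin P mB) (pr_fin P (measurableI _ _ mA mB)).
rewrite (pr_fin P (measurableU _ _ mA mB)) => /(congr1 fine)/= ->.
by rewrite subrK.
Qed.

Lemma near_forall_lt (R : realType) (Q : nat -> R -> Prop) (K : nat) :
  (forall m, \forall x \near +oo, Q m x) ->
  \forall x \near +oo, forall m, (m < K)%N -> Q m x.
Proof.
move=> H; elim: K => [|K IH]; first by near=> x.
near=> x.
have HK : Q K x by near: x; exact: H.
have Hlt : forall m, (m < K)%N -> Q m x by near: x; exact: IH.
by move=> m; rewrite ltnS leq_eqVlt => /predU1P[->|/Hlt].
Unshelve. all: by end_near. Qed.

Section real_tails.
Context d (T : measurableType d) (R : realType) (P : probability T R).
Context (alpha : R) (F : R -> R).
Hypotheses (alpha1 : 1 <= alpha) (rvF : rv alpha F) (F0 : F x @[x --> +oo] --> 0).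

Definition rtail (Y : T -> R) (x : R) : R := pr P [set w | x < Y w].

Lemma rtail_dilation_bounded (f h : R -> R) (q : R) : 0 < q ->
  negl F (fun x => f x - h x) -> scaling alpha F h ->
  exists2 C, 0 < C & \forall x \near +oo, `|f (q * x)| <= C * F x.
Proof.
move=> q0 n sh; have n' := negl_dilation_equiv rvF q0 n sh.
exact: (negl_bounded n' (scalingZ (q `^ (- alpha)) sh)).
Qed.

(** The single big jump principle for two terms. The lower bound is inclusion-exclusion on the
    events that one term alone exceeds x; two simultaneous large values cost a product of tails. *)
Lemma rtail_add (Y1 Y2 : T -> R) (H1 H2 : R -> R) :
  (forall x, measurable [set w | x < Y1 w]) ->
  (forall x, measurable [set w | x < Y2 w]) ->
  (forall x, measurable [set w | x < Y1 w + Y2 w]) ->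
  (forall w, 0 <= Y1 w) -> (forall w, 0 <= Y2 w) ->
  (forall s t, P ([set w | s < Y1 w] `&` [set w | t < Y2 w]) =
     (P [set w | (s < Y1 w)%R] * P [set w | (t < Y2 w)%R])%E) ->
  scaling alpha F H1 -> scaling alpha F H2 ->
  negl F (fun x => rtail Y1 x - H1 x) -> negl F (fun x => rtail Y2 x - H2 x) ->
  negl F (fun x => rtail (fun w => Y1 w + Y2 w) x - (H1 x + H2 x)).
Proof.
move=> m1 m2 m12 p1 p2 ind s1 s2 n1 n2 k k0.
have k4 : 0 < k / 4 by rewrite divr_gt0.
have indr s t : pr P ([set w | s < Y1 w] `&` [set w | t < Y2 w]) = rtail Y1 s * rtail Y2 t.
  apply: EFin_inj; rewrite EFinM /rtail -!pr_fin//; exact: measurableI.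
have [q1 [q10 q11 U1]] := dilation_upper alpha1 rvF n1 s1 k4.
have [q2 [q20 q21 U2]] := dilation_upper alpha1 rvF n2 s2 k4.
pose q := Num.max q1 q2.
have q0 : 0 < q by rewrite lt_max q10.
have q1' : q < 1 by rewrite gt_max q11 q21.
have d0 : 0 < 1 - q by rewrite subr_gt0.
have [C1 C10 B1] := rtail_dilation_bounded d0 n1 s1.
have [C2 C20 B2] := rtail_dilation_bounded d0 n2 s2.
have N := negl_mul rvF F0 B1 B2.
have [D1 D10 E1] := rtail_dilation_bounded ltr01 n1 s1.
have [D2 D20 E2] := rtail_dilation_bounded ltr01 n2 s2.
have M := negl_mul rvF F0 E1 E2.
near=> x; have x0 : 0 <= x by near: x; exact: near_ge.
have kF : 0 <= k / 4 * F x.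
  by rewrite mulr_ge0 ?(ltW k4)// ltW//; near: x; case: rvF.
rewrite ler_distl; apply/andP; split.
  have h1 : `|rtail Y1 x - H1 x| <= k / 4 * F x by near: x; exact: n1.
  have h2 : `|rtail Y2 x - H2 x| <= k / 4 * F x by near: x; exact: n2.
  have h3 : `|rtail Y1 (1 * x) * rtail Y2 (1 * x)| <= k / 4 * F x by near: x; exact: M.
  rewrite ler_distl in h1; rewrite ler_distl in h2; move: h1 h2 => /andP[h1 _] /andP[h2 _].
  have {}h3 := le_trans (ler_norm _) h3; rewrite !mul1r in h3.
  have h4 : pr P ([set w | x < Y1 w] `|` [set w | x < Y2 w]) <=
      rtail (fun w => Y1 w + Y2 w) x.
    apply: pr_le => //; first exact: measurableU.
    move=> w [/=|/=] h; first by rewrite ltr_wpDr.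
    by rewrite ltr_wpDl.
  have h5 := prD_UI P (m1 x) (m2 x); rewrite indr -/(rtail Y1 x) -/(rtail Y2 x) in h5.
  by lra.
have u1 : rtail Y1 (q1 * x) <= H1 x + k / 4 * F x by near: x.
have u2 : rtail Y2 (q2 * x) <= H2 x + k / 4 * F x by near: x.
have u3 : `|rtail Y1 ((1 - q) * x) * rtail Y2 ((1 - q) * x)| <= k / 4 * F x by near: x; exact: N.
have {}u3 := le_trans (ler_norm _) u3.
have mono1 : rtail Y1 (q * x) <= rtail Y1 (q1 * x).
  apply: pr_le => // w /=; apply: le_lt_trans.
  by rewrite ler_wpM2r// le_max lexx.
have mono2 : rtail Y2 (q * x) <= rtail Y2 (q2 * x).
  apply: pr_le => // w /=; apply: le_lt_trans.
  by rewrite ler_wpM2r// le_max lexx orbT.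
have mI := measurableI _ _ (m1 ((1 - q) * x)) (m2 ((1 - q) * x)).
have mU := measurableU _ _ (m1 (q * x)) (m2 (q * x)).
(* If neither term passes q x, each must exceed (1 - q) x for the sum to pass x. *)
have : rtail (fun w => Y1 w + Y2 w) x <= pr P (([set w | q * x < Y1 w] `|` [set w | q * x < Y2 w]) `|`
    ([set w | (1 - q) * x < Y1 w] `&` [set w | (1 - q) * x < Y2 w])).
  apply: pr_le => //; first exact: measurableU.
  move=> w /= h; have [h1|h1] := ltP (q * x) (Y1 w); first by left; left.
  have [h2|h2] := ltP (q * x) (Y2 w); first by left; right.
  by right; split; lra.
move=> /le_trans/(_ (pr_leU P mU mI)).
have := pr_leU P (m1 (q * x)) (m2 (q * x)).
rewrite indr -/(rtail Y1 (q * x)) -/(rtail Y2 (q * x)).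
by lra.
Unshelve. all: by end_near. Qed.

(** A constant is an independent variable whose tail eventually vanishes. *)
Lemma rtail_addC (Y : T -> R) (H : R -> R) (c : R) :
  (forall x, measurable [set w | x < Y w]) -> (forall w, 0 <= Y w) -> 0 <= c ->
  scaling alpha F H -> negl F (fun x => rtail Y x - H x) ->
  negl F (fun x => rtail (fun w => Y w + c) x - H x).
Proof.
move=> mY Y0 c0 sH nH.
have mc x : measurable [set w : T | x < c].
  have [xc|xc] := ltP x c.
    by rewrite (_ : [set _ | _] = setT)//; apply/seteqP; split.
  by rewrite (_ : [set _ | _] = set0)//; apply/seteqP; split.
have n0 : negl F (fun x => rtail (fun=> c) x - 0).
  apply: (negl_eq (negl0 rvF)); near=> x.
  rewrite subr0 /rtail (_ : [set _ | _] = set0) ?/pr ?measure0//.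
  apply/seteqP; split => w //=; rewrite ltNge; move/negP; apply.
  by near: x; exact: near_ge.
have ind s t : P ([set w | s < Y w] `&` [set w | t < c]) =
     (P [set w | (s < Y w)%R] * P [set w | (t < c)%R])%E.
  have [tc|/negP] := pselect (is_true (t < c)).
    rewrite (_ : [set w : T | s < Y w] `&` [set w : T | t < c] = [set w | s < Y w]); last first.
      by apply/seteqP; split => w //= -[].
    rewrite (_ : [set w : T | (t < c)%R] = setT); last by apply/seteqP; split.
    by rewrite probability_setT mule1.
  rewrite -leNgt => tc.
  rewrite (_ : [set w : T | s < Y w] `&` [set w : T | t < c] = set0); last first.
    by apply/seteqP; split => w //= [_]; rewrite ltNge tc.
  rewrite (_ : [set w : T | (t < c)%R] = set0); last first.
    by apply/seteqP; split => w //=; rewrite ltNge tc.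
  by rewrite measure0 mule0.
have mYc x : measurable [set w | x < Y w + c].
  by rewrite (_ : [set _ | _] = [set w | x - c < Y w])//; apply/seteqP; split => w /=; rewrite ltrBlDr.
have := @rtail_add Y (fun=> c) H (fun=> 0) mY mc mYc Y0 (fun=> c0) ind sH (scaling0 rvF) nH n0.
by move=> h; apply: (negl_eq h); near=> x; rewrite addr0.
Unshelve. all: by end_near. Qed.

Lemma rtail_scale (Y : T -> R) (H : R -> R) (a : R) : 0 < a ->
  scaling alpha F H -> negl F (fun x => rtail Y x - H x) ->
  negl F (fun x => rtail (fun w => a * Y w) x - a `^ alpha * H x).
Proof.
move=> a0 sH nH; have ai : 0 < a^-1 by rewrite invr_gt0.
apply: (negl_eq (negl_dilation_equiv rvF ai nH sH)); near=> x.
have -> : a^-1 `^ (- alpha) = a `^ alpha.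
  by rewrite -powR_inv1 ?(ltW a0)// -powRrM mulN1r opprK.
congr (_ - _); rewrite /rtail; congr (pr P _); apply/seteqP; split => w /=.
  by rewrite mulrC ltr_pdivrMr// mulrC.
by move=> h; rewrite mulrC ltr_pdivrMr// mulrC.
Unshelve. all: by end_near. Qed.

End real_tails.

(** * One generation of the process *)

Section one_step.
Context d (T : measurableType d) (R : realType) (P : probability T R).
Context (alpha : R) (F : R -> R).
Hypotheses (alpha1 : 1 <= alpha) (rvF : rv alpha F) (F0 : F x @[x --> +oo] --> 0).
Context (zx ze : T -> nat) (X E : nat -> T -> nat) (eps : T -> nat) (mu nu : R).
Hypotheses (mzx : meas_in measurable zx) (mze : meas_in measurable ze)
  (mX : forall i, meas_in measurable (X i)) (mE : forall i, meas_in measurable (E i))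
  (meps : meas_in measurable eps)
  (lawX : forall i B, P (X i @^-1` B) = P (zx @^-1` B))
  (lawE : forall i B, P (E i @^-1` B) = P (ze @^-1` B))
  (indX : past_indep P X) (indE : past_indep P E)
  (meanX : mean P zx = mu%:E) (meanE : mean P ze = nu%:E)
  (mu0 : 0 < mu) (nu0 : 0 < nu)
  (rvX : rv alpha (tail P zx)) (rvE : rv alpha (tail P ze)).
Context (cX cE : R).
Hypotheses (cX0 : 0 < cX) (cE0 : 0 < cE)
  (XF : \forall x \near +oo, tail P zx x <= cX * F x)
  (EF : \forall x \near +oo, tail P ze x <= cE * F x)
  (epsF : negl F (tail P eps)).

Local Notation SX m w := (\sum_(0 <= i < m) X i w)%N.
Local Notation SE n w := (\sum_(0 <= i < n) E i w)%N.
Let D m n w := (SX m w + SE n w + eps w)%N.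

Hypotheses
  (indXE : forall m n, indep_rv P (fun w => SX m w) (fun w => SE n w))
  (indeps : forall m n, indep_rv P (fun w => SX m w + SE n w)%N eps).

Let mSX m : meas_in measurable (fun w => SX m w).
Proof. exact: meas_in_partial_sum. Qed.
Let mSE m : meas_in measurable (fun w => SE m w).
Proof. exact: meas_in_partial_sum. Qed.
Let mSXE m n : meas_in measurable (fun w => SX m w + SE n w)%N.
Proof. by apply: meas_in_add => //; exact: sigma_algebra_measurable. Qed.
Let mD m n : meas_in measurable (D m n).
Proof. by apply: meas_in_add => //; exact: sigma_algebra_measurable. Qed.

Let scX : scaling alpha F (tail P zx). Proof. exact: (scaling_rv rvX cX0). Qed.
Let scE : scaling alpha F (tail P ze). Proof. exact: (scaling_rv rvE cE0). Qed.

Lemma tail_add_indep (V W : T -> nat) (H1 H2 : R -> R) :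
  meas_in measurable V -> meas_in measurable W -> indep_rv P V W ->
  scaling alpha F H1 -> scaling alpha F H2 ->
  negl F (fun x => tail P V x - H1 x) -> negl F (fun x => tail P W x - H2 x) ->
  negl F (fun x => tail P (fun w => V w + W w)%N x - (H1 x + H2 x)).
Proof.
move=> mV mW ind s1 s2 n1 n2.
have eqD : tail P (fun w => V w + W w)%N = rtail P (fun w => (V w)%:R + (W w)%:R).
  by apply/funext => x; rewrite /tail /rtail; under eq_fun do rewrite natrD.
rewrite eqD.
apply: (rtail_add alpha1 rvF F0 _ _ _ _ _ _ s1 s2 n1 n2) => //.
- by move=> x; exact: measurable_tail.
- by move=> x; exact: measurable_tail.
- move=> x; under eq_fun do rewrite -natrD.
  by apply: measurable_tail; apply: meas_in_add => //; exact: sigma_algebra_measurable.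
- by move=> s t; exact: (ind [set k | s < k%:R] [set k | t < k%:R]).
Qed.

Lemma partial_sum_tail (z : T -> nat) (Z : nat -> T -> nat) m :
  (forall i, meas_in measurable (Z i)) -> past_indep P Z ->
  (forall i B, P (Z i @^-1` B) = P (z @^-1` B)) -> scaling alpha F (tail P z) ->
  negl F (fun x => tail P (fun w => \sum_(0 <= i < m) Z i w)%N x - m%:R * tail P z x).
Proof.
move=> mZ iZ lZ sz; elim: m => [|m IH].
  apply: (negl_eq (negl0 rvF)); near=> x.
  rewrite mul0r subr0 /tail (_ : [set _ | _] = set0) ?/pr ?measure0//.
  apply/seteqP; split => w //=; rewrite big_nil ltNge; move/negP; apply.
  by near: x; exact: near_ge.
have lawm x : tail P (Z m) x = tail P z x.
  by rewrite /tail /pr; congr fine; exact: (lZ m [set k : nat | x < k%:R]).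
have n1 : negl F (fun x => tail P (Z m) x - tail P z x).
  by apply: (negl_eq (negl0 rvF)); near=> x; rewrite lawm subrr.
have := tail_add_indep (meas_in_partial_sum m mZ) (mZ m) (iZ id m) (scalingZ m%:R sz) sz IH n1.
move=> h; apply: (negl_eq h); near=> x; congr (_ - _); last by rewrite -natr1 mulrDl mul1r.
by congr (tail P _ x); apply/funext => w; rewrite big_nat_recr.
Unshelve. all: by end_near. Qed.

Let J m n x : R := m%:R * tail P zx x + n%:R * tail P ze x.

Let scJ m n : scaling alpha F (J m n).
Proof. by apply: scalingD; exact: scalingZ. Qed.

Lemma tail_fixed m n : negl F (fun x => tail P (D m n) x - J m n x).
Proof.
have h1 := partial_sum_tail m mX indX lawX scX.
have h2 := partial_sum_tail n mE indE lawE scE.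
have h3 := tail_add_indep (mSX m) (mSE n) (indXE m n) (scalingZ m%:R scX)
  (scalingZ n%:R scE) h1 h2.
have e0 : negl F (fun x => tail P eps x - 0).
  by apply: (negl_eq epsF); near=> x; rewrite subr0.
have h4 := tail_add_indep (mSXE m n) meps (indeps m n) (scJ m n) (scaling0 rvF) h3 e0.
by apply: (negl_eq h4); near=> x; rewrite addr0.
Unshelve. all: by end_near. Qed.

Context (a b : R).
Hypotheses (a0 : 0 < a) (b0 : 0 <= b).

(** With m and n individuals in the last two generations, [W] is the new combination, [Y] its mean
    apart from immigration, and [h] its conditional tail. *)
Let W m n w : R := a * (D m n w)%:R + b * m%:R.
Let Y m n : R := (a * mu + b) * m%:R + a * nu * n%:R.
Let h x m n := pr P [set w | x < W m n w].

Let mW x m n : measurable [set w | x < W m n w].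
Proof. exact: (mD m n [set k : nat | x < a * k%:R + b * m%:R]). Qed.

Let h_le1 x m n : h x m n <= 1.
Proof. by rewrite /h pr_le1. Qed.

Lemma jump_fixed m n : negl F (fun x => h x m n - a `^ alpha * J m n x).
Proof.
have nD : negl F (fun x => rtail P (fun w => (D m n w)%:R) x - J m n x) by exact: tail_fixed.
have nS := rtail_scale rvF a0 (scJ m n) nD.
apply: (@rtail_addC _ _ _ P alpha F alpha1 rvF F0 (fun w => a * (D m n w)%:R) _ (b * m%:R)) => //.
- by move=> x; exact: (mD m n [set k : nat | x < a * k%:R]).
- by move=> w; rewrite mulr_ge0 ?(ltW a0).
- by rewrite mulr_ge0.
- exact: scalingZ.
Qed.

Let Y_ge_m m n : a * mu * m%:R <= Y m n.
Proof.
rewrite /Y mulrDl -addrA lerDl addr_ge0 ?mulr_ge0// ltW//; exact: mulr_gt0.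
Qed.

Let Y_ge_n m n : a * nu * n%:R <= Y m n.
Proof.
by rewrite /Y lerDr mulr_ge0// addr_ge0// mulr_ge0// ltW.
Qed.

Let amu0 : 0 < a * mu. Proof. exact: mulr_gt0. Qed.
Let anu0 : 0 < a * nu. Proof. exact: mulr_gt0. Qed.

(** The gap (1 - q) x must be filled by one of two offspring sums or by immigration; a third each,
    divided by a, gives [delta]. Since Y <= q x also bounds m and n by multiples of x, [ld_upper]
    applies. *)
Lemma jump_domination q : 0 < q -> q < 1 -> exists2 C, 0 < C &
  \forall x \near +oo, forall m n, Y m n <= q * x -> h x m n <= C * (m%:R + n%:R + 1) * F x.
Proof.
move=> q0 q1; pose delta := (1 - q) / 3 / a.
have d0 : 0 < delta by rewrite !divr_gt0// subr_gt0.
have cx0 : 0 < (a * mu)^-1 by rewrite invr_gt0.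
have ce0 : 0 < (a * nu)^-1 by rewrite invr_gt0.
have [C1 C10 H1] := ld_upper mzx mX lawX indX alpha1 meanX rvX cx0 d0.
have [C2 C20 H2] := ld_upper mze mE lawE indE alpha1 meanE rvE ce0 d0.
have He := negl_dilation rvF d0 epsF ltr01.
pose C := C1 * cX + C2 * cE + 1.
have C1X : 0 < C1 * cX by exact: mulr_gt0.
have C2E : 0 < C2 * cE by exact: mulr_gt0.
exists C; first by rewrite !addr_gt0.
near=> x => m n Yq.
have x0 : 0 < x by near: x; exact: near_gt.
have Fx : 0 < F x by near: x; case: rvF.
have qx : q * x <= x by rewrite ler_piMl// ltW.
have mx : m%:R <= (a * mu)^-1 * x.
  by rewrite ler_pdivlMl// (le_trans (Y_ge_m m n))// (le_trans Yq).
have nx : n%:R <= (a * nu)^-1 * x.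
  by rewrite ler_pdivlMl// (le_trans (Y_ge_n m n))// (le_trans Yq).
pose B1 := [set w | m%:R * mu + delta * x < (SX m w)%:R].
pose B2 := [set w | n%:R * nu + delta * x < (SE n w)%:R].
pose B3 := [set w | delta * x < (eps w)%:R].
have mB1 : measurable B1 by exact: measurable_tail.
have mB2 : measurable B2 by exact: measurable_tail.
have mB3 : measurable B3 by exact: measurable_tail.
have hB : h x m n <= pr P (B1 `|` B2 `|` B3).
  apply: pr_le => //; first by apply: measurableU => //; exact: measurableU.
  move=> w; rewrite /W /D /= !natrD => xW.
  have [w1|w1] := pselect (B1 w); first by left; left.
  have [w2|w2] := pselect (B2 w); first by left; right.
  right; rewrite /B3 /= ltNge; apply/negP => w3.
  move/negP: w1; rewrite -leNgt => w1; move/negP: w2; rewrite -leNgt => w2.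
  have ad : a * delta = (1 - q) / 3 by rewrite /delta mulrC divfK// gt_eqF.
  have : a * ((SX m w)%:R + (SE n w)%:R + (eps w)%:R) <=
     a * ((m%:R * mu + delta * x) + (n%:R * nu + delta * x) + delta * x).
    by rewrite ler_pM2l// !lerD.
  have -> : a * ((m%:R * mu + delta * x) + (n%:R * nu + delta * x) + delta * x) =
    a * mu * m%:R + a * nu * n%:R + 3 * (a * delta) * x by ring.
  rewrite ad; move: Yq; rewrite /Y => Yq h1.
  by have : 3 * ((1 - q) / 3) * x = x - q * x by [field]; lra.
apply: (le_trans hB).
have := pr_leU P (measurableU _ _ mB1 mB2) mB3; have := pr_leU P mB1 mB2.
have : pr P B1 <= C1 * (m%:R * tail P zx x).
  have /(_ m mx) : forall m : nat, m%:R <= (a * mu)^-1 * x ->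
    pr P [set w | m%:R * mu + delta * x < (SX m w)%:R] <= C1 * (m%:R * tail P zx x).
    by near: x.
  by [].
have : pr P B2 <= C2 * (n%:R * tail P ze x).
  have /(_ n nx) : forall m : nat, m%:R <= (a * nu)^-1 * x ->
    pr P [set w | m%:R * nu + delta * x < (SE m w)%:R] <= C2 * (m%:R * tail P ze x).
    by near: x.
  by [].
have : pr P B3 <= 1 * F x.
  have : `|tail P eps (delta * x)| <= 1 * F x by near: x.
  exact: le_trans (ler_norm _).
have hX : tail P zx x <= cX * F x by near: x.
have hE : tail P ze x <= cE * F x by near: x.
have : C1 * (m%:R * tail P zx x) <= C1 * cX * F x * m%:R.
  have -> : C1 * cX * F x * m%:R = C1 * (m%:R * (cX * F x)) by ring.
  by rewrite ler_pM2l// ler_wpM2l.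
have : C2 * (n%:R * tail P ze x) <= C2 * cE * F x * n%:R.
  have -> : C2 * cE * F x * n%:R = C2 * (n%:R * (cE * F x)) by ring.
  by rewrite ler_pM2l// ler_wpM2l.
have -> : C * (m%:R + n%:R + 1) * F x = C1 * cX * F x * m%:R + C2 * cE * F x * n%:R +
   1 * F x + (C1 * cX * F x * (n%:R + 1) + C2 * cE * F x * (m%:R + 1) + F x * (m%:R + n%:R)).
  by rewrite /C; ring.
have : 0 <= C1 * cX * F x * (n%:R + 1) by rewrite !mulr_ge0 ?addr_ge0// ltW.
have : 0 <= C2 * cE * F x * (m%:R + 1) by rewrite !mulr_ge0 ?addr_ge0// ltW.
have : 0 <= F x * (m%:R + n%:R) by rewrite mulr_ge0 ?addr_ge0// ltW.
by lra.
Unshelve. all: by end_near. Qed.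

(** If each offspring sum falls short of its mean by less than delta Y, then W exceeds Y / q > x;
    this fixes [delta]. *)
Lemma jump_certain q k : 1 < q -> 0 < k ->
  \forall x \near +oo, forall m n, q * x < Y m n -> 1 - k <= h x m n.
Proof.
move=> q1 k0; have q0 : 0 < q by exact: lt_trans q1.
pose delta := (1 - q^-1) / (2 * a).
have d0 : 0 < delta by rewrite divr_gt0 ?mulr_gt0// subr_gt0 invf_lt1.
have k2 : 0 < k / 2 by rewrite divr_gt0.
have cx0 : 0 < (a * mu)^-1 by rewrite invr_gt0.
have ce0 : 0 < (a * nu)^-1 by rewrite invr_gt0.
have [y1 y10 H1] := near_threshold (lln_lower mzx mX lawX indX meanX d0 cx0 k2).
have [y2 y20 H2] := near_threshold (lln_lower mze mE lawE indE meanE d0 ce0 k2).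
near=> x => m n Yq.
have x0 : 0 < x by near: x; exact: near_gt.
have x1 : y1 <= x by near: x; exact: near_ge.
have x2 : y2 <= x by near: x; exact: near_ge.
have xY : x < Y m n by rewrite (le_lt_trans _ Yq)// ler_peMl// ltW.
(* Here [Y] may be far larger than x, so the law of large numbers is applied at the scale [y],
   beyond the same threshold. *)
set y := Y m n in Yq xY *.
have my : m%:R <= (a * mu)^-1 * y by rewrite ler_pdivlMl//; exact: Y_ge_m.
have ny : n%:R <= (a * nu)^-1 * y by rewrite ler_pdivlMl//; exact: Y_ge_n.
have {}H1 := H1 y (le_trans x1 (ltW xY)) m my.
have {}H2 := H2 y (le_trans x2 (ltW xY)) n ny.
pose B1 := [set w | (SX m w)%:R <= m%:R * mu - delta * y].
pose B2 := [set w | (SE n w)%:R <= n%:R * nu - delta * y].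
have mB1 : measurable B1 by exact: (mSX m [set k : nat | k%:R <= m%:R * mu - delta * y]).
have mB2 : measurable B2 by exact: (mSE n [set k : nat | k%:R <= n%:R * nu - delta * y]).
have mC := measurableC (mW x m n).
have hC : pr P (~` [set w | x < W m n w]) = 1 - h x m n.
  apply: EFin_inj; rewrite EFinB -!pr_fin//; exact: probability_setC.
have : pr P (~` [set w | x < W m n w]) <= pr P (B1 `|` B2).
  apply: pr_le => //; first exact: measurableU.
  move=> w; rewrite /W /D /= !natrD => /negP; rewrite -leNgt => xW.
  have [w1|w1] := pselect (B1 w); first by left.
  right; rewrite /B2 /= leNgt; apply/negP => w2.
  move/negP: w1; rewrite -ltNge => w1.
  have ad : a * delta = (1 - q^-1) / 2 by rewrite /delta; field; rewrite !lt0r_neq0.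
  have e0 : (0 : R) <= (eps w)%:R by [].
  have : a * ((m%:R * mu - delta * y) + (n%:R * nu - delta * y)) <
    a * ((SX m w)%:R + (SE n w)%:R + (eps w)%:R).
    by rewrite ltr_pM2l// ltr_wpDr// ltrD.
  have -> : a * ((m%:R * mu - delta * y) + (n%:R * nu - delta * y)) =
    a * mu * m%:R + a * nu * n%:R - 2 * (a * delta) * y by ring.
  rewrite ad => h1.
  have yE : y = a * mu * m%:R + b * m%:R + a * nu * n%:R by rewrite /y /Y mulrDl.
  have : 2 * ((1 - q^-1) / 2) * y = y - q^-1 * y by field; exact: lt0r_neq0.
  have : x < q^-1 * y by rewrite ltr_pdivlMl.
  by lra.
rewrite hC => /le_trans/(_ (pr_leU P mB1 mB2)).
rewrite -/B1 in H1; rewrite -/B2 in H2.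
by lra.
Unshelve. all: by end_near. Qed.

Context (A B : T -> nat) (eA eB : R) (H : R -> R).
Hypotheses (mA : meas_in measurable A) (mB : meas_in measurable B)
  (meanA : mean P A = eA%:E) (meanB : mean P B = eB%:E)
  (indAB : forall m n i j, forall C : set nat,
     P ((fun w => (A w, B w)) @^-1` [set (i, j)] `&` D m n @^-1` C) =
     (P ((fun w => (A w, B w)) @^-1` [set (i, j)]) * P (D m n @^-1` C))%E).

Let V w := (A w, B w).
Let mV : meas_in measurable V.
Proof. by apply: meas_in_pair => //; exact: sigma_algebra_measurable. Qed.

Lemma integral_linear (p c1 c2 : R) (S : set (nat * nat)) : 0 <= p -> 0 <= c1 -> 0 <= c2 ->
  (\int[P]_w (p * \1_S (V w) + (c1 * (A w)%:R + c2 * (B w)%:R))%:E =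
   (p * pr P (V @^-1` S) + (c1 * eA + c2 * eB))%:E)%E.
Proof.
move=> p0 c10 c20.
rewrite (integral_discreteD P mV (f := fun v => p * \1_S v)
  (g := fun v => c1 * v.1%:R + c2 * v.2%:R)); last 2 first.
- by move=> v; rewrite mulr_ge0.
- by move=> v; rewrite addr_ge0// mulr_ge0.
rewrite (integral_discreteD P mV (f := fun v => c1 * v.1%:R) (g := fun v => c2 * v.2%:R)); last 2 first.
- by move=> v; rewrite mulr_ge0.
- by move=> v; rewrite mulr_ge0.
rewrite (integral_discreteZ P mV (f := fun v => \1_S v))//.
rewrite (integral_discreteZ P mV (f := fun v => v.1%:R))//.
rewrite (integral_discreteZ P mV (f := fun v => v.2%:R))//.
rewrite integral_discrete_indic// -/(mean P A) -/(mean P B) meanA meanB.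
by rewrite pr_fin//; exact: mV.
Qed.

Let N w := (A w + B w)%N.
Let mN : meas_in measurable N.
Proof. by apply: meas_in_add => //; exact: sigma_algebra_measurable. Qed.

(** [K] is chosen before [c1] and [c2], since these will be multiples of [F x] and vary with the
    level. *)
Lemma integral_rest (e : R) : 0 < e -> exists K : nat, forall c1 c2, 0 <= c1 -> 0 <= c2 ->
  (\int[P]_w (c1 + c2 * (((N w)%:R + 1) * \1_([set k | (K <= k)%N]) (N w)))%:E
    <= (c1 + c2 * e)%:E)%E.
Proof.
move=> e0.
have NE : (\int[P]_w ((N w)%:R + 1)%:E < +oo)%E.
  have -> : (\int[P]_w ((N w)%:R + 1)%:E =
      \int[P]_w (1 * \1_setT (V w) + (1 * (A w)%:R + 1 * (B w)%:R))%:E)%E.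
    by apply: eq_integral => w _; rewrite indicT !mul1r /N natrD addrC.
  by rewrite integral_linear// ltry.
have [K HK] := integral_tail_indic mN (fun k => addr_ge0 (ler0n R k) ler01) NE e0.
exists K => c1 c2 c10 c20.
rewrite (integral_discreteD P mN (f := fun k => c1)
  (g := fun k => c2 * ((k%:R + 1) * \1_([set k | (K <= k)%N]) k)))//; last first.
  by move=> k; rewrite !mulr_ge0// addr_ge0.
rewrite (integral_discreteZ P mN (f := fun k => (k%:R + 1) * \1_([set k | (K <= k)%N]) k))//.
rewrite integral_prob_cst EFinD EFinM leeD2l// lee_wpmul2l//.
Qed.

Lemma total_probability x :
  (\int[P]_w (h x (A w) (B w))%:E =
   (rtail P (fun w => a * (D (A w) (B w) w)%:R + b * (A w)%:R) x)%:E)%E.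
Proof.
have mEv v : measurable [set w | x < W v.1 v.2 w] by exact: mW.
have := @disintegration _ _ _ P _ V (fun v => [set w | x < W v.1 v.2 w]) mV mEv.
have iV v : P (V @^-1` [set v] `&` [set w | x < W v.1 v.2 w]) =
    (P (V @^-1` [set v]) * P [set w | (x < W v.1 v.2 w)%R])%E.
  case: v => i j.
  exact: (indAB i j i j [set k : nat | x < a * k%:R + b * i%:R]).
move=> /(_ iV) => h1.
rewrite /rtail -pr_fin.
  rewrite [RHS]h1; apply: eq_integral => w _; rewrite /h -pr_fin//.
have m1 := meas_in_dep (@sigma_algebra_measurable d T) mV (fun v => mD v.1 v.2).
have m2 := meas_in_pair (@sigma_algebra_measurable d T) m1 mA.
exact: (m2 [set v : nat * nat | x < a * v.1%:R + b * v.2%:R]).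
Qed.

Hypotheses (sH : scaling alpha F H)
  (nH : negl F (fun x => rtail P (fun w => (a * mu + b) * (A w)%:R + a * nu * (B w)%:R) x - H x)).

Let rY x := rtail P (fun w => (a * mu + b) * (A w)%:R + a * nu * (B w)%:R) x.
Let G x := a `^ alpha * (eA * tail P zx x + eB * tail P ze x).
Let S x : set (nat * nat) := [set v | x < Y v.1 v.2].
(** Dominated convergence is made quantitative: [rest] is a uniform error plus the domination
    restricted to large populations, [lin] is the main term, and [h] is compared with them pointwise
    before integrating. *)
Let rest K c1 c2 m n : R := c1 + c2 * (((m + n)%N%:R + 1) * \1_([set k | (K <= k)%N]) (m + n)%N).
Let lin p x0 x m n : R := p * \1_(S x0) (m, n) +
  (a `^ alpha * tail P zx x * m%:R + a `^ alpha * tail P ze x * n%:R).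

Let jump_near K k : 0 < k -> \forall x \near +oo, forall m, (m < K)%N ->
  forall n, (n < K)%N -> `|h x m n - a `^ alpha * J m n x| <= k * F x.
Proof.
move=> k0; apply: near_forall_lt => m; apply: near_forall_lt => n.
exact: jump_fixed.
Qed.

Let rest_ge0 K c1 c2 m n : 0 <= c1 -> 0 <= c2 -> 0 <= rest K c1 c2 m n.
Proof. by move=> c10 c20; rewrite addr_ge0// !mulr_ge0// addr_ge0. Qed.

Let lin_ge0 p x0 x m n : 0 <= p -> 0 <= lin p x0 x m n.
Proof.
move=> p0; rewrite addr_ge0// ?mulr_ge0// addr_ge0// !mulr_ge0// ?powR_ge0//; exact: tail_ge0.
Qed.

Let restE K c1 c2 m n : rest K c1 c2 m n =
  if (K <= m + n)%N then c1 + c2 * (m%:R + n%:R + 1) else c1.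
Proof.
rewrite /rest indicE natrD; case: ifPn => Kmn; first by rewrite mem_set// mulr1.
by rewrite memNset ?mulr0 ?addr0//; exact/negP.
Qed.

Let linE p x0 x m n : lin p x0 x m n =
  (if x0 < Y m n then p else 0) + a `^ alpha * J m n x.
Proof.
rewrite /lin indicE; congr (_ + _); last by rewrite /J; ring.
case: ifPn => h0; first by rewrite mem_set// mulr1.
by rewrite memNset ?mulr0//; exact/negP.
Qed.

Let integral_lin p x0 x : 0 <= p ->
  (\int[P]_w (lin p x0 x (A w) (B w))%:E = (p * rY x0 + G x)%:E)%E.
Proof.
move=> p0; rewrite /lin (integral_linear (S x0) p0); last 2 first.
- by rewrite mulr_ge0 ?powR_ge0//; exact: tail_ge0.
- by rewrite mulr_ge0 ?powR_ge0//; exact: tail_ge0.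
by congr (_ + _)%:E; rewrite /G; ring.
Qed.

Lemma one_step_upper k : 0 < k -> \forall x \near +oo,
  rtail P (fun w => a * (D (A w) (B w) w)%:R + b * (A w)%:R) x <= H x + G x + k * F x.
Proof.
move=> k0; have k4 : 0 < k / 4 by rewrite divr_gt0.
have [q [q0 q1 U]] := dilation_upper alpha1 rvF nH sH k4.
have [C C0 HC] := jump_domination q0 q1.
have e0 : 0 < k / 4 / C by rewrite divr_gt0.
have [K HK] := integral_rest e0.
have HJ := jump_near K k4.
near=> x.
have Fx : 0 < F x by near: x; case: rvF.
have k4F : 0 <= k / 4 * F x by rewrite mulr_ge0// ltW.
have CF : 0 <= C * F x by rewrite mulr_ge0// ltW.
have Ux : rY (q * x) <= H x + k / 4 * F x by near: x.
have HCx : forall m n, Y m n <= q * x -> h x m n <= C * (m%:R + n%:R + 1) * F x by near: x.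
have HJx : forall m, (m < K)%N -> forall n, (n < K)%N ->
  `|h x m n - a `^ alpha * J m n x| <= k / 4 * F x by near: x.
have J0 m n : 0 <= a `^ alpha * J m n x.
  by rewrite mulr_ge0 ?powR_ge0// addr_ge0// mulr_ge0//; exact: tail_ge0.
(* Three regimes: Y above q x, where h <= 1 is covered by the indicator; a large population, covered
   by the domination; finitely many small pairs, covered by the asymptotics at fixed (m, n). *)
have pw m n : h x m n <= lin 1 (q * x) x m n + rest K (k / 4 * F x) (C * F x) m n.
  have r0 := rest_ge0 K m n k4F CF; rewrite linE.
  case: ifPn => [_|]; first by have := h_le1 x m n; have := J0 m n; lra.
  rewrite -leNgt add0r restE => Yq; case: ifPn => [Kmn|].
    by have := HCx _ _ Yq; have := J0 m n; lra.
  rewrite -ltnNge => Kmn.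
  have mK : (m < K)%N by exact: leq_ltn_trans (leq_addr _ _) Kmn.
  have nK : (n < K)%N by exact: leq_ltn_trans (leq_addl _ _) Kmn.
  have := HJx _ mK _ nK; rewrite ler_distl => /andP[_]; lra.
have : (\int[P]_w (h x (A w) (B w))%:E <=
   \int[P]_w (lin 1 (q * x) x (A w) (B w) + rest K (k / 4 * F x) (C * F x) (A w) (B w))%:E)%E.
  apply: (integral_discrete_le P mV (f := fun v => h x v.1 v.2)
    (g := fun v => lin 1 (q * x) x v.1 v.2 + rest K (k / 4 * F x) (C * F x) v.1 v.2)) => v //.
  exact: pr_ge0.
rewrite (integral_discreteD P mV (f := fun v => lin 1 (q * x) x v.1 v.2)
   (g := fun v => rest K (k / 4 * F x) (C * F x) v.1 v.2)); last 2 first.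
- by move=> v; exact: lin_ge0.
- by move=> v; exact: rest_ge0.
rewrite total_probability integral_lin//.
move=> /le_trans/(_ (leeD2l _ (HK _ _ k4F CF))).
rewrite -EFinD lee_fin mul1r => hh; apply: (le_trans hh).
have -> : C * F x * (k / 4 / C) = k / 4 * F x by field; exact: lt0r_neq0.
by lra.
Unshelve. all: by end_near. Qed.

Lemma one_step_lower k : 0 < k -> \forall x \near +oo,
  H x + G x - k * F x <= rtail P (fun w => a * (D (A w) (B w) w)%:R + b * (A w)%:R) x.
Proof.
move=> k0; have k4 : 0 < k / 4 by rewrite divr_gt0.
have k8 : 0 < k / 8 by rewrite divr_gt0.
have [q [q1 U]] := dilation_lower alpha1 rvF nH sH k8.
have q0 : 0 < q by exact: lt_trans q1.
have [C2 C20 HC2] := rtail_dilation_bounded rvF q0 nH sH.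
(* The loss [kap] weighs on an event of probability at most C2 F(x), hence costs at most k/8 F(x);
   the cap 1 keeps 1 - kap nonnegative. *)
pose kap := Num.min (k / 8 / C2) 1.
have kap0 : 0 < kap by rewrite lt_min ltr01 divr_gt0.
have kap1 : 0 <= 1 - kap by rewrite subr_ge0 ge_min lexx orbT.
have HC := jump_certain q1 kap0.
(* For large populations no jump is exhibited: the whole jump term, at most C F(x) (m + n + 1), is
   put into [rest]. *)
pose C := a `^ alpha * (cX + cE).
have C0 : 0 < C by rewrite mulr_gt0 ?powR_gt0// addr_gt0.
have e0 : 0 < k / 4 / C by rewrite divr_gt0.
have [K HK] := integral_rest e0.
have HJ := jump_near K k4.
near=> x.
have x0 : 0 < x by near: x; exact: near_gt.
have Fx : 0 < F x by near: x; case: rvF.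
have k4F : 0 <= k / 4 * F x by rewrite mulr_ge0// ltW.
have CF : 0 <= C * F x by rewrite mulr_ge0// ltW.
have Ux : H x - k / 8 * F x <= rY (q * x) by near: x.
have bx : `|rY (q * x)| <= C2 * F x by near: x.
have Kx : ((a * mu + b) + a * nu) * K%:R <= x by near: x; exact: near_ge.
have HCx : forall m n, q * x < Y m n -> 1 - kap <= h x m n by near: x.
have HJx : forall m, (m < K)%N -> forall n, (n < K)%N ->
  `|h x m n - a `^ alpha * J m n x| <= k / 4 * F x by near: x.
have hX : tail P zx x <= cX * F x by near: x.
have hE : tail P ze x <= cE * F x by near: x.
have Jle m n : a `^ alpha * J m n x <= C * F x * (m%:R + n%:R + 1).
  have -> : C * F x * (m%:R + n%:R + 1) =
    a `^ alpha * ((cX + cE) * F x * (m%:R + n%:R + 1)) by rewrite /C; ring.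
  rewrite ler_wpM2l ?powR_ge0//.
  have : m%:R * tail P zx x <= m%:R * (cX * F x) by rewrite ler_wpM2l.
  have : n%:R * tail P ze x <= n%:R * (cE * F x) by rewrite ler_wpM2l.
  have -> : (cX + cE) * F x * (m%:R + n%:R + 1) = m%:R * (cX * F x) + n%:R * (cE * F x) +
    (m%:R * (cE * F x) + n%:R * (cX * F x) + (cX + cE) * F x) by ring.
  have : 0 <= m%:R * (cE * F x) + n%:R * (cX * F x) + (cX + cE) * F x.
    by rewrite !addr_ge0// ?mulr_ge0// ?addr_ge0// ?mulr_ge0// ltW.
  by rewrite /J; lra.
have pw m n : lin (1 - kap) (q * x) x m n <= h x m n + rest K (k / 4 * F x) (C * F x) m n.
  have hp : 0 <= h x m n by exact: pr_ge0.
  rewrite linE restE; case: (leqP K (m + n)%N) => Kmn.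
    have := Jle m n; case: ifPn => [/HCx|_]; lra.
  have mK : (m < K)%N by exact: leq_ltn_trans (leq_addr _ _) Kmn.
  have nK : (n < K)%N by exact: leq_ltn_trans (leq_addl _ _) Kmn.
  (* For small populations Y is at most x, hence below q x, and the indicator vanishes. *)
  rewrite ifF; last first.
    apply/negbTE; rewrite -leNgt; apply: (@le_trans _ _ x); last by rewrite ler_peMl// ltW.
    apply: le_trans Kx; rewrite mulrDl /Y lerD//.
      by rewrite ler_wpM2l ?addr_ge0 ?(ltW amu0)// ler_nat ltnW.
    by rewrite ler_wpM2l ?(ltW anu0)// ler_nat ltnW.
  have := HJx _ mK _ nK; rewrite ler_distl => /andP[+ _]; lra.
have : (\int[P]_w (lin (1 - kap) (q * x) x (A w) (B w))%:E <=
   \int[P]_w (h x (A w) (B w) + rest K (k / 4 * F x) (C * F x) (A w) (B w))%:E)%E.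
  apply: (integral_discrete_le P mV (f := fun v => lin (1 - kap) (q * x) x v.1 v.2)
    (g := fun v => h x v.1 v.2 + rest K (k / 4 * F x) (C * F x) v.1 v.2)) => v //.
  exact: lin_ge0.
rewrite (integral_discreteD P mV (f := fun v => h x v.1 v.2)
   (g := fun v => rest K (k / 4 * F x) (C * F x) v.1 v.2)); last 2 first.
- by move=> v; exact: pr_ge0.
- by move=> v; exact: rest_ge0.
rewrite total_probability integral_lin//.
move=> /le_trans/(_ (leeD2l _ (HK _ _ k4F CF))).
rewrite -EFinD lee_fin.
have -> : C * F x * (k / 4 / C) = k / 4 * F x by field; exact: lt0r_neq0.
have : kap * rY (q * x) <= k / 8 * F x.
  have -> : k / 8 * F x = k / 8 / C2 * (C2 * F x) by field; exact: lt0r_neq0.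
  apply: ler_pM; [exact: ltW|exact: pr_ge0| |exact: le_trans (ler_norm _) bx].
  by rewrite ge_min lexx.
rewrite mulrBl mul1r.
have : 0 <= k / 8 * F x by rewrite mulr_ge0// ltW.
by lra.
Unshelve. all: by end_near. Qed.

Theorem one_step : negl F (fun x =>
  rtail P (fun w => a * (D (A w) (B w) w)%:R + b * (A w)%:R) x - (H x + G x)).
Proof.
move=> k k0; have hu := one_step_upper k0; have hl := one_step_lower k0.
by near=> x; rewrite ler_distl; apply/andP; split; near: x.
Unshelve. all: by end_near. Qed.

End one_step.

(** * The Galton--Watson process *)

Section process.
Context d (T : measurableType d) (R : realType) (P : probability T R).
Context (Xm1 X0 : T -> nat) (xi eta : nat -> nat -> T -> nat) (eps : nat -> T -> nat).
Hypothesis HS : SOGWI P Xm1 X0 xi eta eps.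

Let Z := gw_family Xm1 X0 xi eta eps.
Let X k i := xi k.+1 i.+1.
Let E k i := eta k.+1 i.+1.
Local Notation gwp := (gw Xm1 X0 xi eta eps).

Let mZ i : nat_measurable (Z i). Proof. by case: HS => h _ _ _ _; exact: h. Qed.
Let iZ : mutually_independent P Z. Proof. by case: HS. Qed.

Definition xi_index (k i : nat) : gw_index := inl (inl (inr (k, i))).
Definition eta_index (k i : nat) : gw_index := inl (inr (k, i)).
Definition eps_index (k : nat) : gw_index := inr k.

(** Offspring and immigration indices are shifted by one, so that generation 0 consists of the two
    initial values only. *)
Definition generation (i : gw_index) : nat :=
  match i with
  | inl (inl (inl _)) => 0
  | inl (inl (inr (n, _))) => n.+1
  | inl (inr (n, _)) => n.+1
  | inr n => n.+1
  end.

Let past k := [set i | (generation i <= k)%N].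

Let mX k i : meas_in measurable (X k i). Proof. exact: (mZ (xi_index k i)). Qed.
Let mE k i : meas_in measurable (E k i). Proof. exact: (mZ (eta_index k i)). Qed.
Let meps k : meas_in measurable (eps k.+1). Proof. exact: (mZ (eps_index k)). Qed.

Let sX (J : set gw_index) k i : J (xi_index k i) -> meas_in (sigma_of Z J) (X k i).
Proof. by move=> Ji B; exact: (@meas_in_sigma_of _ _ _ Z J (xi_index k i) Ji B). Qed.
Let sE (J : set gw_index) k i : J (eta_index k i) -> meas_in (sigma_of Z J) (E k i).
Proof. by move=> Ji B; exact: (@meas_in_sigma_of _ _ _ Z J (eta_index k i) Ji B). Qed.
Let seps (J : set gw_index) k : J (eps_index k) -> meas_in (sigma_of Z J) (eps k.+1).
Proof. by move=> Ji B; exact: (@meas_in_sigma_of _ _ _ Z J (eps_index k) Ji B). Qed.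

Let SX k m w := (\sum_(0 <= i < m) X k i w)%N.
Let SE k n w := (\sum_(0 <= i < n) E k i w)%N.
Let D k m n w := (SX k m w + SE k n w + eps k.+1 w)%N.

Lemma indep_rv_sigma (J K : set gw_index) (I1 I2 : Type) (V : T -> I1) (W : T -> I2) :
  J `&` K = set0 -> meas_in (sigma_of Z J) V -> meas_in (sigma_of Z K) W ->
  indep_rv P V W.
Proof. by move=> JK mV mW B C; exact: (indep_sigma_of mZ iZ JK (mV B) (mW C)). Qed.

Lemma gw_stepE k w : gwp k.+2 w = D k (gwp k.+1 w) (gwp k w) w.
Proof. by rewrite /= !big_add1. Qed.

Lemma sigma_SX (J : set gw_index) k m : (forall i, J (xi_index k i)) ->
  meas_in (sigma_of Z J) (SX k m).
Proof.
move=> Ji; apply: meas_in_sum; first exact: sigma_of_sigma.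
by move=> i _; exact: sX.
Qed.

Lemma sigma_SE (J : set gw_index) k m : (forall i, J (eta_index k i)) ->
  meas_in (sigma_of Z J) (SE k m).
Proof.
move=> Ji; apply: meas_in_sum; first exact: sigma_of_sigma.
by move=> i _; exact: sE.
Qed.

Lemma sigma_D (J : set gw_index) k m n : (forall i, J (xi_index k i)) ->
  (forall i, J (eta_index k i)) -> J (eps_index k) ->
  meas_in (sigma_of Z J) (D k m n).
Proof.
move=> J1 J2 J3; apply: meas_in_add; first exact: sigma_of_sigma.
  apply: meas_in_add; [exact: sigma_of_sigma|exact: sigma_SX|exact: sigma_SE].
exact: seps.
Qed.

Lemma meas_in_mono (S1 S2 : set (set T)) (I : Type) (V : T -> I) :
  S1 `<=` S2 -> meas_in S1 V -> meas_in S2 V.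
Proof. by move=> S12 mV B; apply: S12; exact: mV. Qed.

(** Because of the shift, [gwp k.+1] is X_k. The induction carries two generations since the
    recursion has order two. *)
Lemma sigma_gw k : meas_in (sigma_of Z (past k)) (gwp k.+1) /\
  meas_in (sigma_of Z (past k)) (gwp k).
Proof.
elim: k => [|k [IH1 IH2]].
  by split => B; [exact: (@meas_in_sigma_of _ _ _ Z (past 0) (inl (inl (inl true))) _ B)|
    exact: (@meas_in_sigma_of _ _ _ Z (past 0) (inl (inl (inl false))) _ B)].
have sub : sigma_of Z (past k) `<=` sigma_of Z (past k.+1).
  by apply: sigma_of_mono => i /=; rewrite /past/= => /leqW.
have sS := sigma_of_sigma Z (past k.+1).
have {}IH1 := meas_in_mono sub IH1; have {}IH2 := meas_in_mono sub IH2.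
split => //.
have -> : gwp k.+2 = fun w => D k (gwp k.+1 w) (gwp k w) w.
  by apply/funext => w; rewrite gw_stepE.
have mp := meas_in_pair sS IH1 IH2.
apply: (meas_in_dep sS (W := fun v : nat * nat => D k v.1 v.2) mp) => v.
by apply: sigma_D => //= *; rewrite /past/=.
Qed.

Lemma measurable_gw k : meas_in measurable (gwp k).
Proof. exact: (meas_in_mono (@measurable_sigma_of _ _ _ Z mZ (past k)) (sigma_gw k).2). Qed.

Lemma past_indep_xi k : past_indep P (X k).
Proof.
move=> f m; apply: (@indep_rv_sigma [set i | exists2 j, (j < m)%N & i = xi_index k j]
  [set xi_index k m]).
- apply/seteqP; split => // i [[j jm ->]] [jE].
  by rewrite jE ltnn in jm.
- apply: meas_in_sum; first exact: sigma_of_sigma.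
  by move=> i im; apply: (meas_in_comp f); apply: sX; exists i.
- by apply: (meas_in_comp f); exact: sX.
Qed.

Lemma past_indep_eta k : past_indep P (E k).
Proof.
move=> f m; apply: (@indep_rv_sigma [set i | exists2 j, (j < m)%N & i = eta_index k j]
  [set eta_index k m]).
- apply/seteqP; split => // i [[j jm ->]] [jE].
  by rewrite jE ltnn in jm.
- apply: meas_in_sum; first exact: sigma_of_sigma.
  by move=> i im; apply: (meas_in_comp f); apply: sE; exists i.
- by apply: (meas_in_comp f); exact: sE.
Qed.

Lemma indep_xi_eta k m n : indep_rv P (SX k m) (SE k n).
Proof.
apply: (@indep_rv_sigma [set i | exists j, i = xi_index k j]
  [set i | exists j, i = eta_index k j]).
- by apply/seteqP; split => // i [[j ->]] [j'].
- by apply: sigma_SX => i; exists i.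
- by apply: sigma_SE => i; exists i.
Qed.

Lemma indep_offspring_eps k m n :
  indep_rv P (fun w => SX k m w + SE k n w)%N (eps k.+1).
Proof.
apply: (@indep_rv_sigma [set i | exists j, i = xi_index k j \/ i = eta_index k j]
  [set eps_index k]).
- by apply/seteqP; split => // i [[j [->|->]]].
- apply: meas_in_add; first exact: sigma_of_sigma.
    by apply: sigma_SX => i; exists i; left.
  by apply: sigma_SE => i; exists i; right.
- exact: seps.
Qed.

Lemma indep_rv_initial : indep_rv P X0 Xm1.
Proof.
apply: (@indep_rv_sigma [set inl (inl (inl true)) : gw_index]
  [set inl (inl (inl false)) : gw_index]).
- by apply/seteqP; split => // i [->].
- by move=> B; exact: (@meas_in_sigma_of _ _ _ Z _ (inl (inl (inl true))) _ B).
- by move=> B; exact: (@meas_in_sigma_of _ _ _ Z _ (inl (inl (inl false))) _ B).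
Qed.

(** The offspring of step k + 1 uses only indices of generation k + 1, disjoint from the past. *)
Lemma indep_past k (I1 : Type) (V : T -> I1) m n :
  meas_in (sigma_of Z (past k)) V ->
  [/\ indep_rv P V (D k m n), indep_rv P V (SX k m) & indep_rv P V (SE k n)].
Proof.
move=> mV.
have JK : past k `&` [set i | generation i = k.+1] = set0.
  by apply/seteqP; split => // i; rewrite /past/= => -[h gi]; move: h; rewrite gi ltnn.
by split; apply: (indep_rv_sigma JK mV);
  [exact: sigma_D|exact: sigma_SX|exact: sigma_SE].
Qed.

Let law_of (V W : T -> nat) : meas_in measurable V -> meas_in measurable W ->
  (forall B, pr P (V @^-1` B) = pr P (W @^-1` B)) ->
  forall B, P (V @^-1` B) = P (W @^-1` B).
Proof. by move=> mV mW H B; rewrite (pr_fin P (mV B)) (pr_fin P (mW B)) H. Qed.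

Lemma law_xi k i B : P (X k i @^-1` B) = P (xi 1%N 1%N @^-1` B).
Proof.
apply: law_of; [exact: mX|exact: (mX 0 0)|move=> C].
by case: HS => _ _ h _ _; exact: h.
Qed.

Lemma law_eta k i B : P (E k i @^-1` B) = P (eta 1%N 1%N @^-1` B).
Proof.
apply: law_of; [exact: mE|exact: (mE 0 0)|move=> C].
by case: HS => _ _ _ h _; exact: h.
Qed.

Lemma law_eps k B : P (eps k.+1 @^-1` B) = P (eps 1%N @^-1` B).
Proof.
apply: law_of; [exact: meps|exact: (meps 0)|move=> C].
by case: HS => _ _ _ _ h; exact: h.
Qed.

Lemma mean_partial_sum (z : T -> nat) (W : nat -> T -> nat) (c : R) m :
  meas_in measurable z -> (forall i, meas_in measurable (W i)) ->
  (forall i B, P (W i @^-1` B) = P (z @^-1` B)) -> mean P z = c%:E ->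
  mean P (fun w => \sum_(0 <= i < m) W i w)%N = (m%:R * c)%:E.
Proof.
move=> mz mW lW mc; elim: m => [|m IH].
  rewrite /mean; under eq_integral do rewrite big_nil.
  by rewrite mul0r integral_prob_cst.
rewrite /mean; under eq_integral do rewrite big_nat_recr//= natrD.
have mS := meas_in_partial_sum m mW.
have mp := meas_in_pair (@sigma_algebra_measurable d T) mS (mW m).
rewrite (integral_discreteD P mp (f := fun v => v.1%:R) (g := fun v => v.2%:R))//=.
rewrite -/(mean P _) IH.
rewrite (@integral_law _ _ _ P (W m) z (fun k => (k%:R : R)%:E))//.
by rewrite -/(mean P z) mc -EFinD -natr1 mulrDl mul1r.
Qed.

(** Wald's identity for each offspring sum, whose random length belongs to the past. *)
Lemma mean_gw_step (mu nu me e1 e0 : R) k :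
  mean P (xi 1%N 1%N) = mu%:E -> mean P (eta 1%N 1%N) = nu%:E ->
  mean P (eps 1%N) = me%:E -> 0 <= mu -> 0 <= nu ->
  mean P (gwp k.+1) = e1%:E -> mean P (gwp k) = e0%:E ->
  mean P (gwp k.+2) = (mu * e1 + nu * e0 + me)%:E.
Proof.
move=> hmu hnu hme mu0 nu0 h1 h0.
have mg1 := measurable_gw k.+1; have mg0 := measurable_gw k.
have sm := @sigma_algebra_measurable d T.
have [s1 s0] := sigma_gw k.
have mSX m : meas_in measurable (SX k m) by exact: meas_in_partial_sum.
have mSE m : meas_in measurable (SE k m) by exact: meas_in_partial_sum.
have mUX : meas_in measurable (fun w => SX k (gwp k.+1 w) w) by exact: meas_in_dep.
have mUE : meas_in measurable (fun w => SE k (gwp k w) w) by exact: meas_in_dep.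
have EX : mean P (fun w => SX k (gwp k.+1 w) w) = (mu * e1)%:E.
  rewrite /mean (integral_random_index (W := SX k) mg1 mSX mu0).
  - by rewrite -/(mean P _) h1 -EFinM mulrC.
  - by move=> i j; have [_ h _] := indep_past i 0 s1; exact: h.
  - by move=> m; exact: (mean_partial_sum m (mX 0 0) (mX k) (law_xi k) hmu).
have EE : mean P (fun w => SE k (gwp k w) w) = (nu * e0)%:E.
  rewrite /mean (integral_random_index (W := SE k) mg0 mSE nu0).
  - by rewrite -/(mean P _) h0 -EFinM mulrC.
  - by move=> i j; have [_ _ h] := indep_past 0 i s0; exact: h.
  - by move=> m; exact: (mean_partial_sum m (mE 0 0) (mE k) (law_eta k) hnu).
have Ee : mean P (eps k.+1) = me%:E.
  rewrite -hme /mean (@integral_law _ _ _ P (eps k.+1) (eps 1%N) (fun k => (k%:R : R)%:E))//.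
  exact: law_eps.
rewrite /mean; under eq_integral do rewrite gw_stepE /D !natrD.
have mv1 := meas_in_pair sm mUX mUE.
have mv2 := meas_in_pair sm mv1 (meps k).
have -> : (mu * e1 + nu * e0 + me)%:E = (mean P (fun w => SX k (gwp k.+1 w) w) +
    mean P (fun w => SE k (gwp k w) w) + mean P (eps k.+1))%E by rewrite EX EE Ee -!EFinD.
rewrite -(integral_discreteD P mv1 (f := fun v => v.1%:R) (g := fun v => v.2%:R))//.
exact: (integral_discreteD P mv2 (f := fun v : nat * nat * nat => v.1.1%:R + v.1.2%:R)
  (g := fun v => v.2%:R)).
Qed.

End process.

(** * The leading coefficients *)

Section moment_tail.
Context d (T : measurableType d) (R : realType) (P : probability T R).
Context (z : T -> nat) (r : R).
Hypotheses (mz : meas_in measurable z)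
  (moment : (\int[P]_w (((z w)%:R : R) `^ r)%:E < +oo)%E).

Lemma mean_of_moment : 1 <= r -> (mean P z < +oo)%E.
Proof.
move=> r1; apply: le_lt_trans moment.
apply: (integral_discrete_le P mz (f := fun k => k%:R) (g := fun k => k%:R `^ r)) => // k.
case: k => [|k]; first exact: powR_ge0.
by rewrite le1r_powR// ler1n.
Qed.

(** Markov's inequality gives decay x^(-r), while by Potter [F] decays no faster than x^(-beta) for
    any beta above alpha; beta is taken midway between alpha and r. *)
Lemma negl_of_moment (alpha : R) (F : R -> R) : 0 < alpha -> alpha < r -> rv alpha F ->
  {homo F : x y / x <= y >-> y <= x} -> negl F (tail P z).
Proof.
move=> al0 ar rvF Fmono k k0.
have r0 : 0 < r by exact: lt_trans ar.
have int0 : (0 <= \int[P]_w (((z w)%:R : R) `^ r)%:E)%E.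
  by apply: integral_ge0 => w _; rewrite lee_fin powR_ge0.
pose M := fine (\int[P]_w (((z w)%:R : R) `^ r)%:E)%E.
have ME : (\int[P]_w (((z w)%:R : R) `^ r)%:E)%E = M%:E by rewrite fineK// ge0_fin_numE.
have M0 : 0 <= M by exact: fine_ge0.
pose beta := (alpha + r) / 2.
have beta0 : 0 < beta by rewrite /beta; lra.
have ab : alpha < beta by rewrite /beta; lra.
have rb : 0 < r - beta by rewrite /beta; lra.
have [C C0 HC] := potter_lower beta0 ab rvF Fmono.
have M1 : 0 < M + 1 by rewrite ltr_wpDl.
have k1 : 0 < k / ((M + 1) * C) by rewrite divr_gt0// mulr_gt0.
have Hs := powR_small rb k1.
near=> x; have x0 : 0 < x by near: x; exact: near_gt.
have Fx : 0 < F x by near: x; case: rvF.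
rewrite ger0_norm; last exact: tail_ge0.
have h1 : x `^ r * tail P z x <= M.
  rewrite -lee_fin EFinM /tail -pr_fin; last exact: measurable_tail.
  rewrite -integral_cst; last exact: measurable_tail.
  rewrite -ME; apply: (@le_trans _ _ (\int[P]_(w in [set w | (x < (z w)%:R)%R]) (((z w)%:R : R) `^ r)%:E)%E).
    apply: ge0_le_integral.
    - exact: measurable_tail.
    - by move=> w _; rewrite lee_fin powR_ge0.
    - exact: measurable_cst.
    - exact: (measurable_discreteE mz (fun k => k%:R `^ r) (measurable_tail mz x)).
    - move=> w /= /ltW h; rewrite lee_fin ge0_ler_powR ?nnegrE ?(ltW r0)// ltW//.
  apply: ge0_subset_integral => //.
  - exact: measurable_tail.
  - exact: (measurable_discreteE mz (fun k => k%:R `^ r) measurableT).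
have xr : 0 < x `^ r by exact: powR_gt0.
have h2 : x `^ (- beta) <= C * F x by near: x.
have h3 : x `^ (- (r - beta)) <= k / ((M + 1) * C) by near: x.
have xE : (x `^ r)^-1 = x `^ (- beta) * x `^ (- (r - beta)).
  rewrite -powRD ?(gt_eqF x0) ?implybT// -powRN; congr (_ `^ _).
  by ring.
apply: (@le_trans _ _ (M * (x `^ r)^-1)).
  by rewrite ler_pdivlMr// mulrC.
rewrite xE; apply: (@le_trans _ _ ((M + 1) * (C * F x * (k / ((M + 1) * C))))).
  apply: ler_pM => //.
  - by rewrite mulr_ge0// powR_ge0.
  - by rewrite lerDl.
  - by apply: ler_pM => //; exact: powR_ge0.
by rewrite le_eqVlt; apply/orP; left; apply/eqP; field; rewrite !lt0r_neq0.
Unshelve. all: by end_near. Qed.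

End moment_tail.

(** The lower bound c F <= H converts additive errors o(F) back into relative ones, for f / H and
    for the ratios of f. *)
Lemma equiv_of_negl (R : realType) (alpha c : R) (F f H : R -> R) : rv alpha F -> 0 < c ->
  negl F (fun x => f x - H x) -> scaling alpha F H ->
  (\forall x \near +oo, c * F x <= H x) -> asymp_equiv f H /\ rv alpha f.
Proof.
move=> rvF c0 nf sH HF.
have c2 : 0 < c / 2 by rewrite divr_gt0.
split.
  apply/cvgrPdist_le => e e0; have ec : 0 < e * c by exact: mulr_gt0.
  near=> x; have Fx : 0 < F x by near: x; case: rvF.
  have Hx : c * F x <= H x by near: x.
  have H0 : 0 < H x by apply: lt_le_trans Hx; exact: mulr_gt0.
  have -> : 1 - f x / H x = - (f x - H x) / H x by field; exact: lt0r_neq0.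
  rewrite normrM normrN normfV (gtr0_norm H0) ler_pdivrMr//.
  apply: (@le_trans _ _ (e * c * F x)); first by near: x; exact: nf.
  by rewrite -mulrA ler_pM2l.
have fF : \forall x \near +oo, c / 2 * F x <= f x.
  near=> x; have Hx : c * F x <= H x by near: x.
  have : `|f x - H x| <= c / 2 * F x by near: x; exact: nf.
  by rewrite ler_distl => /andP[+ _]; lra.
split.
  near=> x; have fx : c / 2 * F x <= f x by near: x.
  apply: lt_le_trans fx; rewrite mulr_gt0//; near: x; by case: rvF.
move=> q q0 k k0.
have kc : 0 < k * (c / 2) by exact: mulr_gt0.
have n := neglD (negl_dilation_equiv rvF q0 nf sH) (neglZ (- q `^ (- alpha)) nf).
near=> x; have fx : c / 2 * F x <= f x by near: x.
apply: (@le_trans _ _ (k * (c / 2) * F x)); last by rewrite -mulrA ler_pM2l.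
have -> : f (q * x) - q `^ (- alpha) * f x =
  f (q * x) - q `^ (- alpha) * H x + - q `^ (- alpha) * (f x - H x) by ring.
by near: x; exact: n.
Unshelve. all: by end_near. Qed.

(** * The sequence m_k and its recurrence *)

Section mean_offspring.
Context {R : realType} (mu nu : R).
Hypotheses (mu0 : 0 < mu) (nu0 : 0 < nu).

Let disc := mu ^+ 2 + 4 * nu.
Let disc0 : 0 < disc. Proof. by rewrite addr_gt0// ?exprn_gt0// mulr_gt0. Qed.

Lemma lambda_diff : lambda_plus mu nu - lambda_minus mu nu != 0.
Proof.
rewrite /lambda_plus /lambda_minus -/disc.
have -> : (mu + Num.sqrt disc) / 2 - (mu - Num.sqrt disc) / 2 = Num.sqrt disc by field.
by rewrite gt_eqF// sqrtr_gt0.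
Qed.

Lemma m_seqE k : m_seq mu nu k =
  (lambda_plus mu nu ^+ k.+1 - lambda_minus mu nu ^+ k.+1) /
  (lambda_plus mu nu - lambda_minus mu nu).
Proof. by case: k => [|k] //=; rewrite !expr1 divff// lambda_diff. Qed.

Lemma lambda_plus_sqr : lambda_plus mu nu ^+ 2 = mu * lambda_plus mu nu + nu.
Proof.
have := sqr_sqrtr (ltW disc0); rewrite /lambda_plus -/disc => h.
have -> : ((mu + Num.sqrt disc) / 2) ^+ 2 =
  (mu ^+ 2 + 2 * mu * Num.sqrt disc + Num.sqrt disc ^+ 2) / 4 by field.
by rewrite h /disc; field.
Qed.

Lemma lambda_minus_sqr : lambda_minus mu nu ^+ 2 = mu * lambda_minus mu nu + nu.
Proof.
have := sqr_sqrtr (ltW disc0); rewrite /lambda_minus -/disc => h.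
have -> : ((mu - Num.sqrt disc) / 2) ^+ 2 =
  (mu ^+ 2 - 2 * mu * Num.sqrt disc + Num.sqrt disc ^+ 2) / 4 by field.
by rewrite h /disc; field.
Qed.

Lemma m_seq1 : m_seq mu nu 1 = mu.
Proof.
rewrite m_seqE lambda_plus_sqr lambda_minus_sqr.
have -> : mu * lambda_plus mu nu + nu - (mu * lambda_minus mu nu + nu) =
  mu * (lambda_plus mu nu - lambda_minus mu nu) by ring.
by rewrite mulfK// lambda_diff.
Qed.

Lemma m_seq_rec k : m_seq mu nu k.+2 = m_seq mu nu k.+1 * mu + m_seq mu nu k * nu.
Proof.
rewrite !m_seqE.
have -> n : lambda_plus mu nu ^+ n.+3 =
    lambda_plus mu nu ^+ n.+2 * mu + lambda_plus mu nu ^+ n.+1 * nu.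
  by rewrite -addn2 exprD lambda_plus_sqr !exprS; ring.
have -> n : lambda_minus mu nu ^+ n.+3 =
    lambda_minus mu nu ^+ n.+2 * mu + lambda_minus mu nu ^+ n.+1 * nu.
  by rewrite -addn2 exprD lambda_minus_sqr !exprS; ring.
by field; exact: lambda_diff.
Qed.

(** Positivity is read off the recurrence; in the closed form the root [lambda_minus] is
    negative. *)
Lemma m_seq_gt0 k : 0 < m_seq mu nu k.
Proof.
suff : 0 < m_seq mu nu k /\ 0 < m_seq mu nu k.+1 by case.
elim: k => [|k [h1 h2]]; first by rewrite m_seq1.
by split => //; rewrite m_seq_rec addr_gt0// mulr_gt0.
Qed.

End mean_offspring.

(** * From iterated steps to the matrix formula *)

Section profile.
Context {R : realType} (alpha mu nu me : R).

Fixpoint gw_mean (e1 e0 : R) (k : nat) : R :=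
  match k with
  | 0 => e0
  | 1 => e1
  | S ((S k') as k1) => mu * gw_mean e1 e0 k1 + nu * gw_mean e1 e0 k' + me
  end.

(* [profile e t1 t0 tx te k a b] is the leading term of the tail of
   [a X_k + b X_(k-1)], where [t1], [t0], [tx], [te] stand for the tails of
   [X_0], [X_(-1)], [xi], [eta] and [e i] for the mean of [X_(i-1)]. *)
Fixpoint profile (e : nat -> R) (t1 t0 tx te : R) (k : nat) (a b : R) : R :=
  if k is k'.+1 then
    profile e t1 t0 tx te k' (a * mu + b) (a * nu) + a `^ alpha * (e k'.+1 * tx + e k' * te)
  else a `^ alpha * t1 + b `^ alpha * t0.

(** The coefficient b reached from (1, 0) after k steps, so 0 at the start. *)
Definition delayed (m : nat -> R) (k : nat) : R := if k is k'.+1 then m k' * nu else 0.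

(** One step sends (m_j, [delayed] m_j) to the same pair at j + 1; the offset [j] lets the induction
    follow this move. *)
Lemma profileE (m : nat -> R) e t1 t0 tx te n j :
  (forall k, m k * mu + delayed m k = m k.+1) ->
  profile e t1 t0 tx te n (m j) (delayed m j) =
  \sum_(k < n) m (j + k)%N `^ alpha * (e (n - k)%N * tx + e (n - k - 1)%N * te)
  + m (j + n)%N `^ alpha * t1 + delayed m (j + n)%N `^ alpha * t0.
Proof.
move=> mrec; elim: n j => [|n IH] j /=; first by rewrite big_ord0 add0r addn0.
rewrite mrec (IH j.+1) big_ord_recl /= addn0 subn0 subn1 /= addSnnS.
have -> : \sum_(i < n) m (j + bump 0 i)%N `^ alpha *
    (e (n.+1 - bump 0 i)%N * tx + e (n.+1 - bump 0 i - 1)%N * te) =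
    \sum_(k < n) m (j.+1 + k)%N `^ alpha * (e (n - k)%N * tx + e (n - k - 1)%N * te).
  by apply: eq_bigr => i _; rewrite /bump leq0n add1n addnS addSn subSS.
have -> : delayed m (j + n.+1)%N = m (j + n)%N * nu by rewrite addnS.
by rewrite addrC !addrA.
Qed.

Let M := M_mat mu nu.

Lemma row_pairing (v u : 'cV[R]_2) :
  (v^T *m u) 0 0 = v 0 0 * u 0 0 + v 1 0 * u 1 0.
Proof.
rewrite mxE big_ord_recl big_ord1 !mxE.
by have -> : lift ord0 ord0 = 1 :> 'I_2 by apply/val_inj.
Qed.

(** Variation of constants: each immigration mean is transported by [M] from its time of arrival. *)
Lemma gw_mean_vec e1 e0 l : vec2 (gw_mean e1 e0 l.+1) (gw_mean e1 e0 l) =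
  M ^+ l *m vec2 e1 e0 + \sum_(1 <= i < l.+1) M ^+ (l - i) *m vec2 me 0.
Proof.
elim: l => [|l IH].
  by rewrite expr0 mul1mx big_geq// addr0.
have -> : vec2 (gw_mean e1 e0 l.+2) (gw_mean e1 e0 l.+1) =
    M *m vec2 (gw_mean e1 e0 l.+1) (gw_mean e1 e0 l) + vec2 me 0.
  apply/matrixP => i j; rewrite !mxE big_ord_recl big_ord1 !mxE /=.
  case: i => -[|[|//]] i2 /=; first by [].
  by rewrite mul1r mul0r !addr0.
rewrite IH mulmxDr mulmxA -[M *m M ^+ l]exprS -addrA; congr (_ + _).
rewrite mulmx_sumr [RHS]big_nat_recr//= subnn expr0 mul1mx; congr (_ + _).
apply: eq_big_nat => i /andP[_ il].
by rewrite mulmxA -[M *m M ^+ _]exprS subSn.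
Qed.

Lemma matrix_profile (c : nat -> R) e1 e0 tx te n :
  ((vec2 e1 e0)^T *m (\sum_(k < n) c k *: (M ^+ (n - k - 1))^T) *m vec2 tx te) 0 0 +
  ((vec2 me 0)^T *m (\sum_(1 <= i < n) \sum_(j < n - i) c j *: (M ^+ (n - i - j - 1))^T)
    *m vec2 tx te) 0 0 =
  \sum_(k < n) c k * (gw_mean e1 e0 (n - k)%N * tx + gw_mean e1 e0 (n - k - 1)%N * te).
Proof.
pose u := vec2 tx te; pose psi (v : 'cV[R]_2) l := ((M ^+ l *m v)^T *m u) 0 0.
have psiZ v (a : R) l : (v^T *m (a *: (M ^+ l)^T) *m u) 0 0 = a * psi v l.
  by rewrite -scalemxAr -scalemxAl mxE /psi trmx_mul.
rewrite mulmx_sumr mulmx_suml summxE.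
rewrite (eq_bigr (fun k : 'I_n => c k * psi (vec2 e1 e0) (n - k - 1)%N)); last first.
  by move=> k _; rewrite psiZ.
rewrite mulmx_sumr mulmx_suml summxE.
rewrite (eq_bigr (fun i => \sum_(0 <= j < n | (j < n - i)%N)
    c j * psi (vec2 me 0) (n - i - j - 1)%N)); last first.
  move=> i _; rewrite mulmx_sumr mulmx_suml summxE.
  rewrite -(big_mkord xpredT (fun j =>
    ((vec2 me 0)^T *m (c j *: (M ^+ (n - i - j - 1))^T) *m vec2 tx te) 0 0)).
  rewrite (big_nat_widen _ _ n) ?leq_subr//=; apply: eq_bigr => j _; exact: psiZ.
(* The triangle i + j < n becomes a rectangle with a condition, so that the two sums can be
   exchanged. *)
under [X in _ + X = _]eq_bigr do rewrite big_mkcond/=.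
rewrite exchange_big_nat/= big_mkord -big_split/=; apply: eq_bigr => k _.
have kn : (n - k = (n - k - 1).+1)%N by rewrite subn1 prednK// subn_gt0.
rewrite {2}kn -big_mkcond/=.
have -> : \sum_(1 <= i < n | (k < n - i)%N) c k * psi (vec2 me 0) (n - i - k - 1)%N =
    \sum_(1 <= i < (n - k - 1).+1) c k * psi (vec2 me 0) (n - k - 1 - i)%N.
  rewrite (big_nat_widen _ (n - k - 1).+1 n); last by rewrite -kn leq_subr.
  apply: eq_big => [i|i _] /=; first by rewrite -kn; apply/idP/idP; lia.
  by congr (_ * psi _ _); lia.
rewrite -mulr_sumr -mulrDr; congr (_ * _).
have := gw_mean_vec e1 e0 (n - k - 1).
set l := (n - k - 1)%N => hv.
have -> : gw_mean e1 e0 l.+1 * tx + gw_mean e1 e0 l * te =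
    ((vec2 (gw_mean e1 e0 l.+1) (gw_mean e1 e0 l))^T *m u) 0 0.
  by rewrite row_pairing !mxE.
rewrite hv linearD mulmxDl mxE; congr (_ + _).
by rewrite linear_sum mulmx_suml summxE.
Qed.

End profile.

(** * Tails along the process *)

Section process_tail.
Context d (T : measurableType d) (R : realType) (P : probability T R).
Context (Xm1 X0 : T -> nat) (xi eta : nat -> nat -> T -> nat) (eps : nat -> T -> nat).
Context (alpha mu nu me e1 e0 : R) (F : R -> R).
Hypotheses (HS : SOGWI P Xm1 X0 xi eta eps) (alpha1 : 1 <= alpha)
  (rvF : rv alpha F) (F0 : F x @[x --> +oo] --> 0)
  (sc1 : scaling alpha F (tail P X0)) (sc0 : scaling alpha F (tail P Xm1))
  (rvX : rv alpha (tail P (xi 1%N 1%N))) (rvE : rv alpha (tail P (eta 1%N 1%N)))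
  (mean1 : mean P X0 = e1%:E) (mean0 : mean P Xm1 = e0%:E)
  (meanX : mean P (xi 1%N 1%N) = mu%:E) (meanE : mean P (eta 1%N 1%N) = nu%:E)
  (meane : mean P (eps 1%N) = me%:E) (mu0 : 0 < mu) (nu0 : 0 < nu).
Context (cX cE : R).
Hypotheses (cX0 : 0 < cX) (cE0 : 0 < cE)
  (XF : \forall x \near +oo, tail P (xi 1%N 1%N) x <= cX * F x)
  (EF : \forall x \near +oo, tail P (eta 1%N 1%N) x <= cE * F x)
  (epsF : negl F (tail P (eps 1%N))).

Local Notation gwp := (gw Xm1 X0 xi eta eps).
Let e := gw_mean mu nu me e1 e0.

Lemma mean_gw k : mean P (gwp k) = (e k)%:E.
Proof.
suff : mean P (gwp k) = (e k)%:E /\ mean P (gwp k.+1) = (e k.+1)%:E by case.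
elim: k => [|k [h0 h1]]; first by split.
by split => //; rewrite (mean_gw_step HS meanX meanE meane (ltW mu0) (ltW nu0) h1 h0).
Qed.

Definition leading (k : nat) (a b x : R) : R :=
  profile alpha mu nu e (tail P X0 x) (tail P Xm1 x)
    (tail P (xi 1%N 1%N) x) (tail P (eta 1%N 1%N) x) k a b.

Lemma scaling_leading k a b : scaling alpha F (leading k a b).
Proof.
elim: k a b => [|k IH] a b.
  by apply: scalingD; exact: scalingZ.
apply: (@scalingD _ _ _ (leading k (a * mu + b) (a * nu))); first exact: IH.
apply: scalingZ; apply: scalingD; apply: scalingZ.
  exact: (scaling_rv rvX cX0).
exact: (scaling_rv rvE cE0).
Qed.

(** The coefficients stay general because each step back changes them; the base case is the sum of
    two independent initial values. *)
Lemma rtail_gw k a b : 0 < a -> 0 <= b ->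
  negl F (fun x => rtail P (fun w => a * (gwp k.+1 w)%:R + b * (gwp k w)%:R) x -
    leading k a b x).
Proof.
elim: k a b => [|k IH] a b a0 b0.
  have [mXm1 mX0] : meas_in measurable Xm1 /\ meas_in measurable X0.
    by split; [exact: (measurable_gw HS 0)|exact: (measurable_gw HS 1)].
  have n1 : negl F (fun x => rtail P (fun w => a * (X0 w)%:R) x - a `^ alpha * tail P X0 x).
    apply: (rtail_scale rvF a0 sc1); apply: (negl_eq (negl0 rvF)).
    by near=> x; rewrite /rtail /tail subrr.
  have n0 : negl F (fun x => rtail P (fun w => b * (Xm1 w)%:R) x - b `^ alpha * tail P Xm1 x).
    (* Scaling needs a positive factor; for b = 0 both terms vanish, as 0 to the power alpha is 0
       for alpha > 0. *)
    have [<-|bN0] := eqVneq 0 b.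
      apply: (negl_eq (negl0 rvF)); near=> x.
      rewrite powR0 ?mul0r ?subr0 ?gt_eqF ?(lt_le_trans ltr01)//.
      rewrite /rtail (_ : [set _ | _] = set0) ?/pr ?measure0//.
      apply/seteqP; split => w //=; rewrite mul0r ltNge; move/negP; apply.
      by near: x; exact: near_ge.
    apply: (rtail_scale rvF _ sc0); first by rewrite lt_neqAle bN0.
    by apply: (negl_eq (negl0 rvF)); near=> x; rewrite /rtail /tail subrr.
  apply: (rtail_add alpha1 rvF F0 _ _ _ _ _ _ (scalingZ _ sc1) (scalingZ _ sc0) n1 n0).
  - by move=> x; exact: (mX0 [set k : nat | x < a * k%:R]).
  - by move=> x; exact: (mXm1 [set k : nat | x < b * k%:R]).
  - move=> x; have mp := meas_in_pair (@sigma_algebra_measurable d T) mX0 mXm1.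
    exact: (mp [set v : nat * nat | x < a * v.1%:R + b * v.2%:R]).
  - by move=> w; rewrite mulr_ge0// ltW.
  - by move=> w; rewrite mulr_ge0.
  - move=> s t; apply: (@indep_rv_initial _ _ _ _ _ _ _ _ _ HS
      [set k : nat | s < a * k%:R] [set k : nat | t < b * k%:R]).
have a1 : 0 < a * mu + b by rewrite ltr_wpDr// mulr_gt0.
have b1 : 0 <= a * nu by rewrite ltW// mulr_gt0.
have step := @one_step _ _ _ P alpha F alpha1 rvF F0 (xi 1%N 1%N) (eta 1%N 1%N)
  (fun i => xi k.+1 i.+1) (fun i => eta k.+1 i.+1) (eps k.+1) mu nu.
have [mx [me' mep]] : (forall i, meas_in measurable (xi k.+1 i.+1)) /\
   (forall i, meas_in measurable (eta k.+1 i.+1)) /\ meas_in measurable (eps k.+1).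
  case: HS => h _ _ _ _; split; first by move=> i; exact: (h (xi_index k i)).
  by split; [move=> i; exact: (h (eta_index k i))|exact: (h (eps_index k))].
have [mx1 [me1 mep1]] : meas_in measurable (xi 1%N 1%N) /\ meas_in measurable (eta 1%N 1%N) /\
    meas_in measurable (eps 1%N).
  case: HS => h _ _ _ _; split; first exact: (h (xi_index 0 0)).
  by split; [exact: (h (eta_index 0 0))|exact: (h (eps_index 0))].
have epsk : negl F (tail P (eps k.+1)).
  apply: (negl_eq epsF); near=> x.
  by rewrite /tail /pr; congr fine; rewrite (law_eps HS k [set j : nat | x < j%:R]).
have ind m n i j (C : set nat) :=
  let: And3 h _ _ := indep_past HS m n
    (meas_in_pair (sigma_of_sigma _ _) (sigma_gw _ _ _ _ _ k).1 (sigma_gw _ _ _ _ _ k).2) in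
  h [set (i, j)] C.
have := step mx1 me1 mx me' mep (law_xi HS k) (law_eta HS k) (past_indep_xi HS k)
  (past_indep_eta HS k) meanX meanE mu0 nu0 rvX rvE cX cE cX0 cE0 XF EF epsk
  (indep_xi_eta HS k) (indep_offspring_eps HS k) a b a0 b0 (gwp k.+1) (gwp k) (e k.+1) (e k)
  (leading k (a * mu + b) (a * nu)) (measurable_gw HS k.+1) (measurable_gw HS k)
  (mean_gw k.+1) (mean_gw k) ind (scaling_leading k _ _) (IH _ _ a1 b1).
move=> h; apply: (negl_eq h); near=> x; congr (_ - _); congr (rtail P _ x).
by apply/funext => w; rewrite gw_stepE.
Unshelve. all: by end_near. Qed.

End process_tail.

Theorem theorem3p5 (R : realType) (d : measure_display) (T : measurableType d)
  (P : probability T R) (Xm1 X0 : T -> nat) (xi eta : nat -> nat -> T -> nat)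
  (eps : nat -> T -> nat) (alpha : R) :
  SOGWI P Xm1 X0 xi eta eps ->
  1 <= alpha ->
  regularly_varying P X0 alpha ->
  regularly_varying P Xm1 alpha ->
  regularly_varying P (xi 1%N 1%N) alpha ->
  regularly_varying P (eta 1%N 1%N) alpha ->
  (0 < mean P X0 < +oo)%E ->
  (0 < mean P Xm1 < +oo)%E ->
  (0 < mean P (xi 1%N 1%N) < +oo)%E ->
  (0 < mean P (eta 1%N 1%N) < +oo)%E ->
  bigO_oo (tail P (xi 1%N 1%N)) (tail P X0) ->
  bigO_oo (tail P (xi 1%N 1%N)) (tail P Xm1) ->
  bigO_oo (tail P (eta 1%N 1%N)) (tail P X0) ->
  bigO_oo (tail P (eta 1%N 1%N)) (tail P Xm1) ->
  asymp_same (tail P (xi 1%N 1%N)) (tail P (eta 1%N 1%N)) ->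
  (exists r : R, alpha < r /\
     (\int[P]_w ((((eps 1%N w)%:R : R) `^ r)%:E) < +oo)%E) ->
  forall n : nat, (0 < n)%N ->
    asymp_equiv (tail P (gw Xm1 X0 xi eta eps n.+1))
                (gw_rhs P Xm1 X0 xi eta eps alpha n)
    /\ regularly_varying P (gw Xm1 X0 xi eta eps n.+1) alpha.
Proof.
move=> HS alpha1 rvX0 rvXm1 rvX rvE mX0 mXm1 mX mE bX0 bXm1 bE0 bEm1 _ [r [ar mr]] n n0.
have al0 : 0 < alpha by exact: lt_le_trans alpha1.
have meas_family i : meas_in measurable (gw_family Xm1 X0 xi eta eps i).
  by case: HS => h _ _ _ _; exact: h.
have msX0 : meas_in measurable X0 := meas_family (inl (inl (inl true))).
have msXm1 : meas_in measurable Xm1 := meas_family (inl (inl (inl false))).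
have mseps : meas_in measurable (eps 1%N) := meas_family (eps_index 0).
have finE (z : T -> nat) : (0 < mean P z < +oo)%E ->
    mean P z = (fine (mean P z))%:E /\ 0 < fine (mean P z).
  move=> /andP[h0 hoo]; have f : mean P z \is a fin_num by rewrite ge0_fin_numE// ltW.
  by rewrite fineK//; split => //; rewrite -lte_fin fineK.
have [mE1 e1p] := finE _ mX0; have [mE0 e0p] := finE _ mXm1.
have [mEx mup] := finE _ mX; have [mEe nup] := finE _ mE.
have r1 : 1 <= r by rewrite (le_trans alpha1)// ltW.
have meps0 : (0 <= mean P (eps 1%N))%E.
  by apply: integral_ge0 => w _; rewrite lee_fin.
have mEeps : mean P (eps 1%N) = (fine (mean P (eps 1%N)))%:E.
  by rewrite fineK// ge0_fin_numE//; exact: (mean_of_moment mseps mr r1).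
have mep : 0 <= fine (mean P (eps 1%N)) by exact: fine_ge0.
set mu := fine (mean P (xi 1%N 1%N)) in mEx mup.
set nu := fine (mean P (eta 1%N 1%N)) in mEe nup.
set me := fine (mean P (eps 1%N)) in mEeps mep.
set e1 := fine (mean P X0) in mE1 e1p.
set e0 := fine (mean P Xm1) in mE0 e0p.
have {}rvX0 : rv alpha (tail P X0) := (rvP _ _).2 rvX0.
have {}rvXm1 : rv alpha (tail P Xm1) := (rvP _ _).2 rvXm1.
have {}rvX : rv alpha (tail P (xi 1%N 1%N)) := (rvP _ _).2 rvX.
have {}rvE : rv alpha (tail P (eta 1%N 1%N)) := (rvP _ _).2 rvE.
pose F x := tail P X0 x + tail P Xm1 x.
have rvF : rv alpha F by exact: rv_sum.
have Fmono : {homo F : x y / x <= y >-> y <= x}.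
  by move=> x y xy; apply: lerD; exact: tail_mono.
have F0 : F x @[x --> +oo] --> (0 : R).
  apply/cvgrPdist_le => k k0; have k2 : 0 < k / 2 by rewrite divr_gt0.
  have h1 := tail_small msX0 mE1 k2; have h0 := tail_small msXm1 mE0 k2.
  near=> x; have x1 : 1 <= x by near: x; exact: near_ge.
  have t1 : x * tail P X0 x <= k / 2 by near: x.
  have t0 : x * tail P Xm1 x <= k / 2 by near: x.
  have p1 := tail_ge0 P X0 x; have p0 := tail_ge0 P Xm1 x.
  rewrite sub0r normrN ger0_norm /F; last by rewrite addr_ge0.
  have : 1 * tail P X0 x <= x * tail P X0 x by rewrite ler_wpM2r.
  have : 1 * tail P Xm1 x <= x * tail P Xm1 x by rewrite ler_wpM2r.
  by lra.
have leF0 x : tail P X0 x <= F x by rewrite /F lerDl tail_ge0.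
have leFm1 x : tail P Xm1 x <= F x by rewrite /F lerDr tail_ge0.
have domF (f : R -> R) : bigO_oo f (tail P X0) ->
    exists2 C, 0 < C & \forall x \near +oo, f x <= C * F x.
  move=> [C [C0 HC]]; exists C => //; near=> x.
  apply: (@le_trans _ _ (C * tail P X0 x)); first by near: x.
  by rewrite ler_wpM2l// ltW.
have [cX cX0 XF] := domF _ bX0; have [cE cE0 EF] := domF _ bE0.
have sc1 : scaling alpha F (tail P X0).
  by apply: (scaling_rv rvX0 ltr01); near=> x; rewrite mul1r.
have sc0 : scaling alpha F (tail P Xm1).
  by apply: (scaling_rv rvXm1 ltr01); near=> x; rewrite mul1r.
have epsF := negl_of_moment mseps mr al0 ar rvF Fmono.
pose H := leading P Xm1 X0 xi eta alpha mu nu me e1 e0 n 1 0.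
have key : negl F (fun x => tail P (gw Xm1 X0 xi eta eps n.+1) x - H x).
  have := rtail_gw HS alpha1 rvF F0 sc1 sc0 rvX rvE mE1 mE0 mEx mEe mEeps mup nup
    cX0 cE0 XF EF epsF n ltr01 (lexx 0).
  move=> h; apply: (negl_eq h); near=> x; congr (_ - _).
  rewrite /rtail /tail; congr (pr P _); apply/seteqP; split => w;
    by rewrite /= mul1r mul0r addr0.
have sH : scaling alpha F H by exact: (scaling_leading _ _ _ _ _ sc1 sc0 rvX rvE cX0 cE0 XF EF).
pose m := m_seq mu nu.
have mrec k : m k * mu + delayed nu m k = m k.+1.
  case: k => [|k]; first by rewrite /m m_seq1//= addr0 mul1r.
  by rewrite /m m_seq_rec.
have mp k : 0 < m k by exact: m_seq_gt0.
have HE x : H x = \sum_(k < n) m k `^ alpha *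
    (gw_mean mu nu me e1 e0 (n - k)%N * tail P (xi 1%N 1%N) x +
     gw_mean mu nu me e1 e0 (n - k - 1)%N * tail P (eta 1%N 1%N) x)
    + m n `^ alpha * tail P X0 x + (m n.-1 * nu) `^ alpha * tail P Xm1 x.
  rewrite /H /leading.
  have := profileE alpha (gw_mean mu nu me e1 e0) (tail P X0 x) (tail P Xm1 x)
    (tail P (xi 1%N 1%N) x) (tail P (eta 1%N 1%N) x) n 0 mrec.
  rewrite add0n => ->; congr (_ + _ * _).
  (* For n > 0, [delayed] at n is m_(n-1) times the mean of eta. *)
  by case: (n) n0.
have rhsE : gw_rhs P Xm1 X0 xi eta eps alpha n = H.
  apply/funext => x; rewrite HE /gw_rhs -/mu -/nu -/me -/e1 -/e0 -/m.
  rewrite (matrix_profile mu nu me (fun k => m k `^ alpha)).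
  by rewrite powRM// ltW.
have meanp k : 0 <= gw_mean mu nu me e1 e0 k.
  suff : 0 <= gw_mean mu nu me e1 e0 k /\ 0 <= gw_mean mu nu me e1 e0 k.+1 by case.
  elim: k => [|k [h1 h2]]; first by split; exact: ltW.
  by split => //=; rewrite !addr_ge0// mulr_ge0// ltW.
(* The two initial-value terms alone bound [H] below by a multiple of [F]; the offspring terms are
   nonnegative. *)
pose c := Num.min (m n `^ alpha) ((m n.-1 * nu) `^ alpha).
have c0 : 0 < c by rewrite lt_min !powR_gt0// mulr_gt0.
have HF : \forall x \near +oo, c * F x <= H x.
  near=> x; rewrite HE /F mulrDr -addrA; apply: ler_wpDl.
    apply: sumr_ge0 => k _; rewrite mulr_ge0 ?powR_ge0// addr_ge0// mulr_ge0//; exact: tail_ge0.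
  apply: lerD; rewrite ler_wpM2r ?tail_ge0// /c ge_min lexx ?orbT//.
have [h1 h2] := equiv_of_negl rvF c0 key sH HF.
by rewrite rhsE; split => //; exact: (rvP _ _).1 h2.
Unshelve. all: by end_near. Qed.
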